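(* Let $\mu$ and $\nu$ be two probability measures on $\mathbb{R}^d$ with respective densities $e^{-V}$ and $e^{-W}$ relatively to Lebesgue's measure, i.e. $d\mu(x)=e^{-V(x)}\,dx$ and $d\nu(x)=e^{-W(x)}\,dx$. Let $Z:=\frac12(V-W)$, $\delta:=|\nabla Z|^2-\Delta Z+\nabla Z\cdot\nabla W$, $m:=\inf_{x\in\mathbb{R}^d}\delta(x)$ and, for $p\in(1,2)$ and $p'=p/(p-1)$, $$\mathcal C_p^*:=C_p(\nu)+C_2(\mu)\,\big(2\,\|Z\|_{L^{p'}(\nu)}-m\,C_p(\nu)\big)_+,\qquad \mathcal C_p:=\frac 2p\,C_2(\mu)+\Big(\frac 2p-1\Big)\,\mathcal C_p^* .$$ If the assumptions $$C_p(\nu)<\infty,\qquad C_2(\mu)<\infty,\qquad Z\in L^{p'}(d\nu),\qquad m>-\infty$$ hold uniformly in the limit $p\to1$ and if $\liminf_{p\to1}\mathcal C_p$ is finite, then the logarithmic Sobolev inequality associated to $\mu$, $$\int u^2\,\log\Big(\frac{u^2}{\|u\|_{L^2(\mu)}^2}\Big)\,d\mu\le C_1(\mu)\,\|\nabla u\|_{L^2(\mu)}^2\qquad\forall\,u\in H^1(\mu),$$ holds with $C_1(\mu)\le\liminf_{p\to1}\mathcal C_p$.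
   Context: For a probability measure $\rho$ on $\mathbb{R}^d$, $H^1(\rho)$ denotes the space of functions $u\in L^2(\rho)$ with $\nabla u\in L^2(\rho)$. The constants $C_p(\rho)$ are the optimal constants in the following inequalities (with value $+\infty$ if no finite constant works). - $C_1(\rho)$: $\int u^2\log\big(u^2/\|u\|_{L^2(\rho)}^2\big)\,d\rho\le C_1(\rho)\int|\nabla u|^2\,d\rho$ for all $u\in H^1(\rho)$. - $C_p(\rho)$ for $p\in(1,2)$: $\frac1{p-1}\Big[\int|u|^2\,d\rho-\big(\int|u|^{2/p}\,d\rho\big)^p\Big]\le C_p(\rho)\int|\nabla u|^2\,d\rho$ for all $u\in H^1(\rho)$. - $C_2(\rho)$: $\int|u-\bar u|^2\,d\rho\le C_2(\rho)\int|\nabla u|^2\,d\rho$ for all $u\in H^1(\rho)$, with $\bar u=\int u\,d\rho$. The notation $(x)_+=\max(x,0)$ is the positive part. *)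

(* Defs.v *)
From HB Require Import structures.
From mathcomp Require Import all_boot all_order all_algebra.
From mathcomp Require Import all_classical all_reals all_analysis.

Set Implicit Arguments.
Unset Strict Implicit.
Unset Printing Implicit Defensive.

Import Order.TTheory GRing.Theory Num.Theory.
Import numFieldNormedType.Exports.

Local Open Scope classical_set_scope.
Local Open Scope ring_scope.

(* 'rV[R]_n carries the product sigma-algebra, generated by the coordinates as
   the library does for tuples; it is the Borel sigma-algebra of R^n. *)
Definition measure_rV_display : measure_display.
Proof. exact: default_measure_display. Qed.

Section measurable_rV.
Context {R : realType} (n : nat).

Let coord (i : 'I_n) (x : 'rV[R]_n) : R := x ord0 i.

Let rV_set0 : g_sigma_preimage coord set0.
Proof. exact: sigma_algebra0. Qed.

Let rV_setC A : g_sigma_preimage coord A -> g_sigma_preimage coord (~` A).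
Proof. exact: sigma_algebraC. Qed.

Let rV_bigcup (F : (set 'rV[R]_n)^nat) :
  (forall i, g_sigma_preimage coord (F i)) ->
  g_sigma_preimage coord (\bigcup_i (F i)).
Proof. exact: sigma_algebra_bigcup. Qed.

HB.instance Definition _ := @isMeasurable.Build measure_rV_display
  ('rV[R]_n) (g_sigma_preimage coord) rV_set0 rV_setC rV_bigcup.

End measurable_rV.

Section measurable_fun_rV.
Context {R : realType} d (T : measurableType d).

Lemma measurable_coord n (i : 'I_n) :
  measurable_fun [set: 'rV[R]_n] (fun x => x ord0 i).
Proof.
move=> _ Y mY; rewrite setTI; apply: sub_sigma_algebra => /=.
rewrite -bigcup_seq/=; exists i => /=; first by rewrite mem_index_enum.
by exists Y => //; rewrite setTI.
Qed.

Lemma measurable_fun_rVP n (f : T -> 'rV[R]_n) :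
  (forall i, measurable_fun setT (fun x => f x ord0 i)) ->
  measurable_fun setT f.
Proof.
move=> mf _ Y mY; rewrite setTI; move: Y mY.
suff : (measurable : set (set 'rV[R]_n)) `<=`
       [set Y | measurable (f @^-1` Y)] by [].
apply: smallest_sub.
  split => /= [|A mA|F mF].
  - by rewrite preimage_set0.
  - by rewrite setTD preimage_setC; exact: measurableC.
  - by rewrite preimage_bigcup; exact: bigcup_measurable.
rewrite -bigcup_seq => A [i _ [B mB <-]] /=.
rewrite setTI -comp_preimage.
by have := mf i measurableT B mB; rewrite setTI.
Qed.

End measurable_fun_rV.

(* The library proves this inside an instance that is later shadowed. *)
Lemma prod_sigma_finite d1 d2 (T1 : measurableType d1) (T2 : measurableType d2)
    (R : realType) (m1 : {sigma_finite_measure set T1 -> \bar R})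
    (m2 : {sigma_finite_measure set T2 -> \bar R}) :
  sigma_finite setT (m1 \x m2)%E.
Proof.
have /sigma_finiteP[F [TF ndF Foo]] := sigma_finiteT m1.
have /sigma_finiteP[G [TG ndG Goo]] := sigma_finiteT m2.
exists (fun n => F n `*` G n).
  rewrite -setXTT TF TG predeqE => -[x y]; split.
    move=> [/= [n _ Fnx] [k _ Gky]]; exists (maxn n k) => //; split.
    - by move: x Fnx; exact/subsetPset/ndF/leq_maxl.
    - by move: y Gky; exact/subsetPset/ndG/leq_maxr.
  by move=> [n _ []/= ? ?]; split; exists n.
move=> k; have [? ?] := Foo k; have [? ?] := Goo k.
split; first exact: measurableX.
by rewrite product_measure1E// lte_mul_pinfty// ge0_fin_numE.
Qed.

Section lebesgue_rV.
Context {R : realType}.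

Definition consrV n (z : R * 'rV[R]_n) : 'rV[R]_n.+1 :=
  \row_i (if unlift ord0 i is Some j then z.2 ord0 j else z.1).

Lemma measurable_consrV n : measurable_fun setT (@consrV n).
Proof.
apply: measurable_fun_rVP => i.
rewrite (_ : (fun _ => _) = fun z : R * 'rV[R]_n =>
  if unlift ord0 i is Some j then z.2 ord0 j else z.1); last first.
  by apply/funext => z; rewrite mxE.
case: (unlift ord0 i) => [j|]; last exact: measurable_fst.
exact: (measurableT_comp (measurable_coord j) measurable_snd).
Qed.

Section step.
Context n (m : {sigma_finite_measure set 'rV[R]_n -> \bar R}).

Definition lebesgue_cons (A : set 'rV[R]_n.+1) : \bar R :=
  pushforward (@lebesgue_measure R \x m)%E (@consrV n) A.

Let cons0 : lebesgue_cons set0 = 0%E.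
Proof. by rewrite /lebesgue_cons /pushforward preimage_set0 measure0. Qed.

Let cons_ge0 A : (0 <= lebesgue_cons A)%E.
Proof. by rewrite /lebesgue_cons /pushforward; exact: measure_ge0. Qed.

Let cons_sigma_additive : semi_sigma_additive lebesgue_cons.
Proof.
move=> F mF tF mUF; rewrite /lebesgue_cons /pushforward preimage_bigcup.
apply: measure_semi_sigma_additive.
- by move=> k; rewrite -[X in measurable X]setTI; exact: measurable_consrV.
- apply/trivIsetP => /= i j _ _ ij; rewrite -preimage_setI.
  by move/trivIsetP : tF => /(_ _ _ _ _ ij) ->//; rewrite preimage_set0.
- by rewrite -preimage_bigcup -[X in measurable X]setTI;
     exact: measurable_consrV.
Qed.

HB.instance Definition _ :=
  isMeasure.Build _ _ _ lebesgue_cons cons0 cons_ge0 cons_sigma_additive.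

Let cons_sigma_finite : sigma_finite setT lebesgue_cons.
Proof.
have [F UF mF] := prod_sigma_finite (@lebesgue_measure R) m.
pose unc (x : 'rV[R]_n.+1) : R * 'rV[R]_n :=
  (x ord0 ord0, \row_j x ord0 (lift ord0 j)).
have munc : measurable_fun setT unc.
  apply: measurable_fun_pair; first exact: measurable_coord.
  apply: measurable_fun_rVP => i.
  rewrite (_ : (fun _ => _) = fun x : 'rV[R]_n.+1 => x ord0 (lift ord0 i)).
    exact: measurable_coord.
  by apply/funext => x; rewrite mxE.
have consK : cancel (@consrV n) unc.
  move=> [t v]; congr pair; first by rewrite mxE unlift_none.
  by apply/rowP => j; rewrite !mxE liftK.
exists (fun k => unc @^-1` F k); first by rewrite -preimage_bigcup -UF.
move=> k; have [mFk Fk] := mF k; split.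
  by rewrite -[X in measurable X]setTI; exact: munc.
rewrite /lebesgue_cons /pushforward -comp_preimage.
by rewrite (_ : unc \o _ = id)//; apply/funext => z; exact: consK.
Qed.

HB.instance Definition _ :=
  Measure_isSigmaFinite.Build _ _ _ lebesgue_cons cons_sigma_finite.

End step.

(* Lebesgue measure on R^n (on Borel sets), as an iterated product; lemma
   lebesgue_rV_box computes it on boxes, which characterizes it. *)
Fixpoint lebesgue_rV n : {sigma_finite_measure set 'rV[R]_n -> \bar R} :=
  if n is k.+1 then lebesgue_cons (lebesgue_rV k)
  else dirac (0 : 'rV[R]_0).

End lebesgue_rV.

Lemma lebesgue_rV_box {R : realType} n (a b : 'rV[R]_n) :
  (forall i, a ord0 i <= b ord0 i) ->
  lebesgue_rV n [set x | forall i, a ord0 i <= x ord0 i <= b ord0 i] =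
  (\prod_(i < n) (b ord0 i - a ord0 i))%:E.
Proof.
elim: n a b => [|n IHn] a b ab.
  rewrite big_ord0 /= diracE (_ : _ \in _ = true)//.
  by apply/mem_set => -[].
pose tl (x : 'rV[R]_n.+1) : 'rV[R]_n := \row_j x ord0 (lift ord0 j).
have abt i : tl a ord0 i <= tl b ord0 i by rewrite !mxE.
rewrite big_ord_recl EFinM.
transitivity ((@lebesgue_measure R \x lebesgue_rV n)%E
    (`[a ord0 ord0, b ord0 ord0]%classic `*`
     [set x : 'rV[R]_n | forall i, tl a ord0 i <= x ord0 i <= tl b ord0 i])).
  congr ((_ \x _)%E _); apply/seteqP; split => [[t x] /= h|[t x] /= [t_ab h] i].
    split; first by have := h ord0; rewrite in_itv/= mxE unlift_none.
    by move=> i; have := h (lift ord0 i); rewrite !mxE liftK.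
  case: (unliftP ord0 i) => [j|] ->; rewrite !mxE ?unlift_none ?liftK.
    by have := h j; rewrite !mxE.
  by move: t_ab; rewrite in_itv.
rewrite product_measure1E//; last first.
  rewrite (_ : [set _ | _] = \bigcap_(i in [set: 'I_n])
      ((fun x : 'rV[R]_n => x ord0 i) @^-1`
         `[tl a ord0 i, tl b ord0 i]%classic)); last first.
    apply/seteqP; split => x /= h i; first by move=> _; rewrite /= in_itv; exact: h.
    by have := h i I; rewrite /= in_itv.
  apply: fin_bigcap_measurable => // i _.
  by rewrite -[X in measurable X]setTI; exact: measurable_coord.
rewrite IHn//; congr (_ * _)%E.
  transitivity (lebesgue_measure (`[a ord0 ord0, b ord0 ord0]%classic : set R)).
    by [].
  rewrite lebesgue_measure_itv/= lte_fin.
  by case: ltgtP (ab ord0) => // <- _; rewrite subrr.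
by congr EFin; apply: eq_bigr => i _; rewrite !mxE.
Qed.

Section calculus.
Context {R : realType} {d : nat}.
Implicit Types (f u : 'rV[R]_d -> R) (x y : 'rV[R]_d).

Definition dotmul x y : R := \sum_(i < d) x ord0 i * y ord0 i.

(* The Euclidean norm; the library's norm on 'rV[R]_d is the sup norm. *)
Definition enorm x : R := Num.sqrt (dotmul x x).

Definition partial (i : 'I_d) f x : R := 'D_(delta_mx ord0 i) f x.

Definition grad f x : 'rV[R]_d := \row_i partial i f x.

Definition laplacian f x : R := \sum_(i < d) partial i (partial i f) x.

(* f is of class C^k on the whole space. *)
Fixpoint class_C (k : nat) f : Prop :=
  continuous f /\
  if k is j.+1 then
    forall i : 'I_d, (forall x, derivable f x (delta_mx ord0 i)) /\
                     class_C j (partial i f)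
  else True.

Definition test_function f : Prop :=
  (forall k, class_C k f) /\ compact (closure [set x | f x != 0]).

Definition loc_integrable f : Prop :=
  measurable_fun setT f /\
  forall K, compact K -> (\int[lebesgue_rV d]_(x in K) `|f x|%:E < +oo)%E.

(* G is the gradient of u in the sense of distributions. *)
Definition weak_gradient u (G : 'rV[R]_d -> 'rV[R]_d) : Prop :=
  [/\ loc_integrable u,
      forall i, loc_integrable (fun x => G x ord0 i) &
      forall phi i, test_function phi ->
        \int[lebesgue_rV d]_x (u x * partial i phi x) =
        - \int[lebesgue_rV d]_x (G x ord0 i * phi x)].

Definition has_density (rho : probability 'rV[R]_d R) f : Prop :=
  forall A, measurable A -> rho A = (\int[lebesgue_rV d]_(x in A) (f x)%:E)%E.

End calculus.

Section constants.
Context {R : realType} {d : nat}.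
Implicit Types (rho : probability 'rV[R]_d R) (u : 'rV[R]_d -> R)
  (G : 'rV[R]_d -> 'rV[R]_d) (p : R).

(* u belongs to H^1(rho) and G is (a representative of) its distributional
   gradient. Local integrability with respect to Lebesgue measure, required by
   weak_gradient, follows from u and G being in L^2(rho) when rho has a positive
   continuous density. *)
Definition H1 rho u G : Prop :=
  [/\ weak_gradient u G, u \in Lfun rho 2%:E & enorm \o G \in Lfun rho 2%:E].

Definition energy rho G : R := \int[rho]_x (enorm (G x) ^+ 2).

(* As ln 0 = 0, the integrand vanishes where u does. Its negative part is
   integrable when u is in L^2(rho) but its positive part need not be, hence
   the extended real value. *)
Definition entropy rho u : \bar R :=
  (\int[rho]_x (u x ^+ 2 * ln (u x ^+ 2 / \int[rho]_y (u y ^+ 2))%R)%:E)%E.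

(* The infimum of the empty set is +oo: this is the value when no finite
   constant works. *)
Definition best_constant (P : R -> Prop) : \bar R :=
  ereal_inf [set C%:E | C in [set C : R | 0 <= C /\ P C]].

Definition C1 rho : \bar R := best_constant (fun C =>
  forall u G, H1 rho u G -> (entropy rho u <= (C * energy rho G)%:E)%E).

Definition Cp p rho : \bar R := best_constant (fun C =>
  forall u G, H1 rho u G ->
    (p - 1)^-1 * (\int[rho]_x (`|u x| ^+ 2) -
                  (\int[rho]_x (`|u x| `^ (2 / p))) `^ p)
    <= C * energy rho G).

Definition C2 rho : \bar R := best_constant (fun C =>
  forall u G, H1 rho u G ->
    \int[rho]_x (`|u x - \int[rho]_y u y| ^+ 2) <= C * energy rho G).

End constants.

Section perturbation.
Context {R : realType} {d : nat}.
Implicit Types (V W : 'rV[R]_d -> R) (mu nu : probability 'rV[R]_d R) (p : R).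

Definition Zfun V W : 'rV[R]_d -> R := fun x => (V x - W x) / 2.

Definition delta V W (x : 'rV[R]_d) : R :=
  enorm (grad (Zfun V W) x) ^+ 2 - laplacian (Zfun V W) x
  + dotmul (grad (Zfun V W) x) (grad W x).

Definition inf_delta V W : \bar R := ereal_inf [set (delta V W x)%:E | x in setT].

Definition conj_exp p : R := p / (p - 1).

Definition Z_norm V W nu p : \bar R :=
  ('N[nu]_(conj_exp p)%:E[EFin \o Zfun V W])%E.

Definition Cstar V W mu nu p : \bar R :=
  (Cp p nu + C2 mu * maxe (2%:E * Z_norm V W nu p - inf_delta V W * Cp p nu) 0)%E.

Definition Cbound V W mu nu p : \bar R :=
  ((2 / p)%:E * C2 mu + (2 / p - 1)%:E * Cstar V W mu nu p)%E.

End perturbation.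

(* Main.v *)
(** Let f be C^1 with bounded support and w = f exp(-Z), so that f^2 dmu = w^2 dnu.
Integrating the divergence of f^2 (grad Z) exp(-V) gives
int |grad w|^2 dnu <= int |grad f|^2 dmu - m int f^2 dmu. Moreover
int |f|^(2/p) dmu = int |w|^(2/p) exp(-(2-2/p) Z) dnu: bounding the exponential
from below by its tangent and using Hoelder's inequality and the convexity of
x^p, the cost of replacing mu by nu in the p-inequality is at most
2 ||Z||_p' int f^2 dmu. So the p-inequality for nu bounds
(p-1)^-1 (int f^2 dmu - (int |f|^(2/p) dmu)^p), which tends to the entropy of f as
p -> 1, by C_p(nu) int |grad f|^2 dmu + (2 ||Z||_p' - m C_p(nu))_+ int f^2 dmu.

Such f are dense in H^1(mu), and Fatou's lemma carries the bound in the limit to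
g = u - int u dmu, for which int g^2 dmu <= C_2(mu) int |grad u|^2 dmu. With L the
lower limit of the constants this reads
Ent(g) <= (L - 2 C_2(mu)) int |grad u|^2 dmu, and Rothaus' inequality
Ent(u) <= Ent(g) + 2 int g^2 dmu concludes. *)

From HB Require Import structures.
Require Import Defs.
From mathcomp Require Import all_boot all_order all_algebra.
From mathcomp Require Import all_classical all_reals all_analysis.
From mathcomp Require Import measurable_realfun ring lra.

Import Order.TTheory GRing.Theory Num.Theory.
Import numFieldNormedType.Exports.

Local Open Scope classical_set_scope.
Local Open Scope ring_scope.

Set Implicit Arguments.
Unset Strict Implicit.
Unset Printing Implicit Defensive.

(** * Lebesgue measure on R^d *)

(** The estimate for smooth f has a defect A_p int f^2 dmu with A_p = (2 ||Z||_p' - m C_p(nu))_+.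
    Since f approximates a centred g, C_2(mu) bounds that integral by the energy up to small errors,
    and the two terms merge into C_p(nu) + C_2(mu) A_p, which is [Cstar]. As p tends to 1, [Cbound]
    differs from 2 C_2(mu) + [Cstar] by O(p - 1); hence L - 2 C_2(mu), and the part set aside pays
    exactly for the term 2 int g^2 dmu of Rothaus' inequality.

    A lower limit is approached only along some p, and the p that suits f depends on f. The
    approximations of g therefore come each with its own p, and C_p(nu) and A_p need not converge
    along them: only their uniform bounds are at hand, and these absorb the errors in energy and in
    mass. This is what the uniformity of the assumptions is for.

    Bounded support is forced by the change of function: no growth of Z or of its gradient is
    prescribed, so for general f neither f exp(-Z) in H^1(nu) nor vanishing boundary terms could be
    expected. *)

Lemma ball_rVP {R : realType} {n} (x y : 'rV[R]_n) (e : R) : 0 < e ->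
  ball x e y <-> forall i, `|x ord0 i - y ord0 i| < e.
Proof.
move=> e0; split=> [[_ h] i|h].
  by have := h ord0 i; rewrite -ball_normE.
split=> // i j; rewrite -ball_normE /=.
by rewrite (_ : i = ord0) ?h//; apply/val_inj; case: i => -[].
Qed.

(** Cubes with rational centre and radius 1/(k+1) form a countable base of the topology, and each of
    them is a finite intersection of preimages under coordinates. *)
Lemma open_measurable_rV {R : realType} {n} (U : set 'rV[R]_n) :
  open U -> measurable U.
Proof.
move=> oU.
pose box (z : 'rV[rat]_n * nat) : set 'rV[R]_n :=
  [set x | forall i, `|x ord0 i - ratr (z.1 ord0 i)| < z.2.+1%:R^-1].
have mbox z : measurable (box z).
  rewrite (_ : box z = \bigcap_(i in [set: 'I_n]) ((fun x : 'rV[R]_n => x ord0 i) @^-1`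
      [set t | `|t - ratr (z.1 ord0 i)| < z.2.+1%:R^-1])); last first.
    by apply/seteqP; split => [x h i _|x h i]; exact: h.
  apply: fin_bigcap_measurable => // i _.
  rewrite -[X in measurable X]setTI; apply: measurable_coord => //.
  rewrite (_ : [set t | _] = ball (ratr (z.1 ord0 i) : R) z.2.+1%:R^-1).
    by apply: open_measurable; apply: ball_open; rewrite invr_gt0.
  by apply/seteqP; split => t; rewrite -ball_normE /= distrC.
rewrite (_ : U = \bigcup_(z in [set z | box z `<=` U]) box z).
  rewrite bigcup_mkcond; apply: countable_bigcupT_measurable => //.
  by move=> z; case: ifP.
apply/seteqP; split => [x Ux|x [z /= zU /zU]//].
have /nbhs_ballP[e /= e0 xeU] : nbhs x U by rewrite nbhsE; exists U.
(* The radius 1/(k+1) is at most e/2: it is spent once from x to the rational centre and once from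
   the centre to y. *)
pose k := Num.truncn (2 / e).
have ke : k.+1%:R^-1 + k.+1%:R^-1 <= e.
  have h : 2 / e < k.+1%:R by rewrite truncnS_gt.
  have k0 : (0 : R) < k.+1%:R by rewrite ltr0n.
  rewrite -mulr2n -(mulr_natl k.+1%:R^-1) ler_pdivrMr//.
  by rewrite mulrC -ler_pdivrMr// ltW.
have /choice[q hq] : forall i : 'I_n, exists r : rat,
    `|x ord0 i - ratr r| < k.+1%:R^-1.
  move=> i; have := @rat_in_itvoo R (x ord0 i) (x ord0 i + k.+1%:R^-1).
  rewrite ltrDl invr_gt0 ltr0n => /(_ isT)[r]; rewrite in_itv/= => /andP[h1 h2].
  by exists r; rewrite distrC gtr0_norm ?subr_gt0// ltrBlDl.
exists (\row_i q i, k) => /=; last by move=> i; rewrite mxE.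
move=> y hy; apply: xeU; apply/ball_rVP => // i.
have := hq i; have := hy i; rewrite mxE /= distrC => h1 h2.
apply: lt_le_trans ke; apply: le_lt_trans (ltrD h2 h1).
by rewrite -{1}[x ord0 i](subrK (ratr (q i))) -addrA; exact: ler_normD.
Qed.

Lemma continuous_measurable_rV {R : realType} {n} (f : 'rV[R]_n -> R) :
  continuous f -> measurable_fun setT f.
Proof.
move=> /continuousP cf; apply: (measurability _ (RGenOpens.measurableE R)).
move=> _ [_ [a [b ->] <-]]; rewrite setTI.
apply: open_measurable_rV; exact/cf/interval_open.
Qed.

(** * Slicing of integrals over R^(n+1) and translation invariance *)

Section integral_consrV.
Context {R : realType} {n : nat}.
Notation leb := (@lebesgue_measure R).
Notation lebn := (@lebesgue_rV R n).
Local Open Scope ereal_scope.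

Lemma ge0_integral_consrV (f : 'rV[R]_n.+1 -> \bar R) :
  measurable_fun setT f -> (forall x, 0 <= f x) ->
  \int[lebesgue_rV n.+1]_x f x =
  \int[(leb \x lebn)]_z f (consrV z).
Proof.
move=> mf f0.
exact: (@ge0_integral_pushforward _ _ (measurableTypeR R * 'rV[R]_n)%type _ R
  (@consrV R n) (@measurable_consrV R n) (leb \x lebn)).
Qed.

Lemma ge0_integral_rVS (f : 'rV[R]_n.+1 -> \bar R) :
  measurable_fun setT f -> (forall x, 0 <= f x) ->
  \int[lebesgue_rV n.+1]_x f x =
  \int[lebn]_y \int[leb]_t f (consrV (t, y)).
Proof.
move=> mf f0; rewrite ge0_integral_consrV//.
rewrite (@fubini_tonelli2 _ _ _ _ _ leb lebn (f \o @consrV R n))//; last first.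
  by move=> z; exact: f0.
by apply: measurableT_comp => //; exact: measurable_consrV.
Qed.

Lemma integrable_consrV (f : 'rV[R]_n.+1 -> \bar R) :
  (lebesgue_rV n.+1).-integrable setT f ->
  (leb \x lebn).-integrable setT (f \o @consrV R n).
Proof.
move=> /integrableP[mf foo]; apply/integrableP; split.
  by apply: measurableT_comp => //; exact: measurable_consrV.
by move: foo; rewrite ge0_integral_consrV//; exact: measurableT_comp.
Qed.

Lemma integral_consrV (f : 'rV[R]_n.+1 -> \bar R) :
  (lebesgue_rV n.+1).-integrable setT f ->
  \int[lebesgue_rV n.+1]_x f x =
  \int[(leb \x lebn)]_z f (consrV z).
Proof.
move=> intf.
apply: (@integral_pushforward _ _ (measurableTypeR R * 'rV[R]_n)%type _ R
  (@consrV R n) (@measurable_consrV R n) (leb \x lebn)) => //.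
- exact: measurable_int intf.
- exact: integrable_consrV.
Qed.

End integral_consrV.

Section translation.
Context {R : realType}.
Local Open Scope ereal_scope.

(** A measure that gives every half-open interval its length is Lebesgue measure, and translation
    preserves the length. *)
Lemma lebesgue_measureD (a : R) (A : set R) : measurable A ->
  pushforward (@lebesgue_measure R) ((fun t => t + a)%R : _ -> measurableTypeR R) A
  = lebesgue_measure A.
Proof.
have mD : measurable_fun setT ((fun t => t + a)%R : measurableTypeR R -> measurableTypeR R).
  exact: measurable_funD.
pose D : {mfun measurableTypeR R >-> measurableTypeR R} :=
  HB.pack (fun t : R => t + a)%R (isMeasurableFun.Build _ _ _ _ _ mD).
move=> mA; apply/esym.
apply: (@lebesgue_measure_unique R (pushforward lebesgue_measure D)) => //= _ [[b c]] _ <-.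
rewrite /pushforward (_ : _ @^-1` _ = `](b - a)%R, (c - a)%R]%classic); last first.
  by apply/seteqP; split => t; rewrite /= !in_itv/= ltrBlDr lerBrDr.
rewrite !lebesgue_measure_itv/= !lte_fin ltrD2r.
by case: ifP => // _; rewrite -!EFinD; congr EFin; ring.
Qed.

Lemma ge0_integral_shift (f : R -> \bar R) (a : R) :
  measurable_fun setT f -> (forall x, 0 <= f x) ->
  \int[lebesgue_measure]_t f (t + a)%R = \int[lebesgue_measure]_t f t.
Proof.
move=> mf f0.
have mD : measurable_fun setT ((fun t => t + a)%R : measurableTypeR R -> measurableTypeR R).
  exact: measurable_funD.
rewrite -(@ge0_integral_pushforward _ _ _ _ R _ mD lebesgue_measure setT f)//.
by apply: eq_measure_integral => //= A mA _; exact: lebesgue_measureD.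
Qed.

(** Induction on the dimension: after slicing, the head coordinate is shifted by the one-dimensional
    case and the tail by the induction hypothesis. *)
Lemma ge0_integral_rV_shift n (x : 'rV[R]_n) (f : 'rV[R]_n -> \bar R) :
  measurable_fun setT f -> (forall x, 0 <= f x) ->
  \int[lebesgue_rV n]_y f (y + x)%R = \int[lebesgue_rV n]_y f y.
Proof.
elim: n x f => [|n IHn] x f mf f0.
  by apply: eq_integral => y _; congr f; apply/rowP => -[].
have maddx : measurable_fun setT (fun y : 'rV[R]_n.+1 => (y + x)%R).
  apply: measurable_fun_rVP => i.
  rewrite (_ : (fun _ => _) = fun y : 'rV[R]_n.+1 => (y ord0 i + x ord0 i)%R).
    by apply: measurable_funD; [exact: measurable_coord|exact: measurable_cst].
  by apply/funext => y; rewrite mxE.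
rewrite (ge0_integral_rVS mf f0).
rewrite (ge0_integral_rVS (f := fun y => f (y + x)%R) (measurableT_comp mf maddx) (fun y => f0 _)).
pose F y := \int[lebesgue_measure]_t f (consrV (t, y)).
pose x' : 'rV[R]_n := \row_j x ord0 (lift ord0 j).
have mfc : measurable_fun setT (f \o @consrV R n).
  by apply: measurableT_comp => //; exact: measurable_consrV.
rewrite -(IHn x' F)/F; last 2 first.
- apply: (measurable_fun_fubini_tonelli_G (m1 := @lebesgue_measure R)
    (f \o @consrV R n) mfc) => z; exact: f0.
- by move=> y; apply: integral_ge0 => t _; exact: f0.
apply: eq_integral => y _.
transitivity (\int[lebesgue_measure]_t f (consrV ((t + x ord0 ord0)%R, y + x')%R)).
  apply: eq_integral => t _; congr f; apply/rowP => i; rewrite !mxE.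
  by case: (unliftP ord0 i) => [j|] ->; rewrite /= ?mxE; congr (_ + x _ _)%R; exact: val_inj.
apply: (@ge0_integral_shift (fun t : R => f (consrV (t, (y + x')%R))) (x ord0 ord0)) => //.
exact: (measurableT_comp mfc (measurable_pair2 (y + x')%R)).
Qed.

End translation.

(** * Functions of bounded support and integration of their partial derivatives *)

Section boxes.
Context {R : realType} {n : nat}.
Implicit Types (x y : 'rV[R]_n) (f g : 'rV[R]_n -> R) (M : R).

Definition rVbox M : set 'rV[R]_n := [set x | forall i, `|x ord0 i| <= M].

(** Bounded support with an explicit radius in the sup norm. In this form it passes to products and
    derivatives, and radii simply add under convolution. *)
Definition boxed M f := forall x i, M < `|x ord0 i| -> f x = 0.

Lemma boxed_notin M f x : boxed M f -> ~ rVbox M x -> f x = 0.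
Proof.
move=> bf /existsNP[i /negP]; rewrite -ltNge; exact: bf.
Qed.

Lemma boxed_le M M' f : M <= M' -> boxed M f -> boxed M' f.
Proof. by move=> MM' bf x i /(le_lt_trans MM') /bf. Qed.

Lemma rVboxE M : rVbox M = [set x | forall i, x ord0 i \in `[- M, M]].
Proof. by apply/seteqP; split => x h i; have := h i; rewrite in_itv/= ler_norml. Qed.

Lemma compact_rVbox M : compact (rVbox M).
Proof.
rewrite rVboxE; apply: (@rV_compact _ _ (fun=> `[- M, M]%classic)) => _.
exact: segment_compact.
Qed.

Lemma closed_rVbox M : closed (rVbox M).
Proof.
apply: compact_closed; [exact: norm_hausdorff|exact: compact_rVbox].
Qed.

Lemma measurable_rVbox M : measurable (rVbox M).
Proof.
rewrite -[rVbox M]setCK; apply: measurableC; apply: open_measurable_rV.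
by apply: closed_openC; exact: closed_rVbox.
Qed.

Lemma lebesgue_rVbox M : 0 <= M ->
  lebesgue_rV n (rVbox M) = (\prod_(i < n) (M + M))%:E.
Proof.
move=> M0.
have := @lebesgue_rV_box R n (const_mx (- M)) (const_mx M).
under eq_bigr do rewrite !mxE opprK.
move=> <-; last by move=> i; rewrite !mxE; lra.
by congr (lebesgue_rV n _); apply/seteqP; split=> x h i; have := h i;
  rewrite !mxE ler_norml.
Qed.

Lemma lebesgue_rVbox_fin M : (lebesgue_rV n (rVbox M) < +oo)%E.
Proof.
apply: (@le_lt_trans _ _ (lebesgue_rV n (rVbox `|M|))).
  apply: le_measure; rewrite ?inE; try exact: measurable_rVbox.
  by move=> x h i; apply: le_trans (h i) (ler_norm _).
by rewrite lebesgue_rVbox// ltry.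
Qed.

Lemma compact_sub_rVbox (K : set 'rV[R]_n) : compact K ->
  exists2 M, 0 <= M & K `<=` rVbox M.
Proof.
move=> /compact_bounded[M [Mr KM]]; exists (`|M| + 1); first by rewrite addr_ge0.
move=> x Kx i; have /KM/(_ x Kx) : M < `|M| + 1.
  by rewrite (le_lt_trans (ler_norm M))// ltrDl.
apply: le_trans.
rewrite [leRHS]/Num.norm /= mx_normrE; apply/bigmax_geP; right => /=.
by exists (ord0, i).
Qed.

Lemma compact_rV_continuous_bounded (K : set 'rV[R]_n) f :
  continuous f -> compact K -> exists2 C, 0 < C & forall x, K x -> `|f x| <= C.
Proof.
move=> cf cK.
have : compact (f @` K).
  by apply: continuous_compact => //; exact: continuous_subspaceT.
move=> /compact_bounded[M [Mr KM]]; exists (`|M| + 1).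
  by rewrite ltr_wpDl.
move=> x Kx; apply: (KM (`|M| + 1)); last by exists x.
by rewrite (le_lt_trans (ler_norm M))// ltrDl.
Qed.

Lemma boxed_bounded M f : continuous f -> boxed M f ->
  exists2 C, 0 < C & forall x, `|f x| <= C.
Proof.
move=> cf bf.
have [C C0 hC] := compact_rV_continuous_bounded cf (@compact_rVbox M).
exists C => // x; have [/hC//|/(boxed_notin bf) ->] := pselect (rVbox M x).
by rewrite normr0 ltW.
Qed.

Lemma integrable_boxed M f : continuous f -> boxed M f ->
  (lebesgue_rV n).-integrable setT (EFin \o f).
Proof.
move=> cf bf.
have mf := continuous_measurable_rV cf.
have -> : EFin \o f = (EFin \o f) \_ (rVbox M).
  apply/funext => x; rewrite patchE; case: ifPn => //.
  by rewrite notin_setE /= => /(boxed_notin bf) ->.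
apply/(integrable_mkcond _ (@measurable_rVbox M)).
apply: measurable_bounded_integrable.
- exact: measurable_rVbox.
- exact: lebesgue_rVbox_fin.
- exact: measurable_funTS.
have [C C0 hC] := boxed_bounded cf bf.
exists C; split; first exact: num_real.
by move=> D CD x _ /=; exact: le_trans (hC x) (ltW CD).
Qed.

(** The inequality in [boxed] is strict, so the region where f must vanish is open and f agrees with
    0 near each of its points. *)
Lemma boxed_partial M f i : boxed M f -> boxed M (partial i f).
Proof.
move=> bf x j Mx; rewrite /partial.
rewrite (_ : 'D_(delta_mx ord0 i) f x = 'D_(delta_mx ord0 i) (cst 0) x).
  exact: derive_cst.
apply: near_eq_derive.
have cj : (fun y : 'rV[R]_n => `|y ord0 j|) @ x --> `|x ord0 j|.
  exact: (@cvg_norm _ _ _ _ (nbhs_filter x) _ _ (@coord_continuous R 1 n ord0 j x)).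
by apply: (@filterS _ _ (nbhs_filter x) _ _ _ (cj _ (lt_nbhsr Mx))) => y /= /bf.
Qed.

(** This lemma and [derivable_line] trade directional derivatives for derivatives of one real
    variable along a line, where the chain rule applies. *)
Lemma is_derive_line f x v (t : R) : derivable f (x + t *: v) v ->
  is_derive t 1 (fun s : R => f (x + s *: v)) ('D_v f (x + t *: v)).
Proof.
move=> df.
have E : (fun h : R => h^-1 *: (((fun s : R => f (x + s *: v)) \o shift t) (h *: 1) -
      f (x + t *: v))) =
    (fun h : R => h^-1 *: ((f \o shift (x + t *: v)) (h *: v) - f (x + t *: v))).
  apply/funext => h /=; congr (_ *: (f _ - _)).
  by rewrite scalerDl addrCA /GRing.scale/= mulr1.
apply: DeriveDef; first by rewrite /derivable E.
by rewrite /derive E.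
Qed.

Lemma derivable_line0 f x v : derivable f x v -> derivable f (x + 0 *: v) v.
Proof. by rewrite scale0r addr0. Qed.

Lemma derivable_line (g : 'rV[R]_n -> R) x v df :
  is_derive (0 : R) 1 (fun s : R => g (x + s *: v)) df ->
  derivable g x v /\ 'D_v g x = df.
Proof.
have E : (fun h : R => h^-1 *: (((fun s : R => g (x + s *: v)) \o shift 0) (h *: 1) -
      g (x + 0 *: v))) =
    (fun h : R => h^-1 *: ((g \o shift x) (h *: v) - g x)).
  apply/funext => h /=; rewrite scale0r !addr0; congr (_ *: (g _ - _)).
  by rewrite addrC /GRing.scale/= mulr1.
move=> [d1 d2]; split; first by rewrite /derivable -E.
by rewrite /derive -E.
Qed.

End boxes.

Lemma integral_derive_compact {R : realType} (g : R -> R) (M : R) :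
  (forall t, derivable g t 1) -> continuous (derive1 g) ->
  (forall t, M < `|t| -> g t = 0) -> (\int[lebesgue_measure]_t (derive1 g t)%:E = 0)%E.
Proof.
move=> dg cg gM.
have g'M t : M < `|t| -> derive1 g t = 0.
  move=> Mt; rewrite derive1E (_ : 'D_1 g t = 'D_1 (cst 0) t); first exact: derive_cst.
  apply: near_eq_derive.
  have ct : (fun s : R => `|s|) @ t --> `|t| by apply: cvg_norm; exact: cvg_id.
  by apply: (@filterS _ _ (nbhs_filter t) _ _ _ (ct _ (lt_nbhsr Mt))) => s /= /gM.
(* [N] is positive and exceeds M, so g vanishes at both ends of [[- N, N]]. *)
pose N := `|M| + 1.
have NM t : t \notin `[- N, N] -> M < `|t|.
  rewrite in_itv/= -ler_norml -ltNge; apply: lt_trans.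
  by rewrite (le_lt_trans (ler_norm M))// ltrDl.
have N0 : 0 < N by rewrite ltr_wpDl.
rewrite (_ : (fun t => _) = ((fun t => (derive1 g t)%:E) \_ `[- N, N])); last first.
  apply/funext => t; rewrite patchE; case: ifPn => //.
  by rewrite mem_setE => /NM /g'M ->.
rewrite -integral_mkcond (@continuous_FTC2 _ _ g).
- rewrite !gM ?subee//; rewrite ?normrN (gtr0_norm N0);
  by rewrite (le_lt_trans (ler_norm M))// ltrDl.
- lra.
- exact: continuous_subspaceT.
- split; first by move=> x _; exact: dg.
  + apply: cvg_at_right_filter; exact/differentiable_continuous/derivable1_diffP/dg.
  + apply: cvg_at_left_filter; exact/differentiable_continuous/derivable1_diffP/dg.
- by [].
Qed.

Lemma consrV_shift {R : realType} n (t : R) (y : 'rV[R]_n) :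
  consrV (t, y) = consrV (0, y) + t *: delta_mx ord0 ord0.
Proof.
apply/rowP => i; rewrite !mxE; case: (unliftP ord0 i) => [j|] -> /=.
  by rewrite mulr0 addr0.
by rewrite mulr1 add0r.
Qed.

Lemma consrV_tail {R : realType} n (t s : R) (y : 'rV[R]_n) (j : 'I_n) :
  consrV (t, y + s *: delta_mx ord0 j) =
  consrV (t, y) + s *: delta_mx ord0 (lift ord0 j).
Proof.
apply/rowP => i; rewrite !mxE; case: (unliftP ord0 i) => [k|] -> /=.
  by rewrite !mxE/= (inj_eq lift_inj).
by rewrite mulr0 addr0.
Qed.

Lemma continuous_rV {R : realType} {T : topologicalType} n (f : T -> 'rV[R]_n) :
  (forall i, continuous (fun x => f x ord0 i)) -> continuous f.
Proof.
move=> cf x; apply/cvg_ballP => e e0.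
near=> y; apply/ball_rVP => //; near: y.
apply: filter_forall => i.
by have /cvgrPdist_lt/(_ e e0) := cf i x.
Unshelve. all: by end_near. Qed.

Lemma continuous_consrV1 {R : realType} n (y : 'rV[R]_n) :
  continuous (fun t : R => consrV (t, y)).
Proof.
apply: continuous_rV => i t.
under eq_fun do rewrite mxE.
case: (unlift ord0 i) => [j|]; last exact: cvg_id.
exact: (@cst_continuous _ _ (y ord0 j)).
Qed.

Lemma continuous_consrV2 {R : realType} n (t : R) :
  continuous (fun y : 'rV[R]_n => consrV (t, y)).
Proof.
apply: continuous_rV => i y.
under eq_fun do rewrite mxE.
case: (unlift ord0 i) => [j|]; last exact: (@cst_continuous _ _ t).
exact: (@coord_continuous R 1 n ord0 j y).
Qed.

(** Fubini's theorem, in the order that makes the inner integral vanish: over the tail by induction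
    when the derivative is in a tail coordinate, over the head by the fundamental theorem of
    calculus when it is in the head coordinate. *)
Lemma integral_partial {R : realType} n (f : 'rV[R]_n -> R) (M : R) (i : 'I_n) :
  continuous f -> (forall x, derivable f x (delta_mx ord0 i)) ->
  continuous (partial i f) -> boxed M f ->
  (\int[lebesgue_rV n]_x (partial i f x)%:E = 0)%E.
Proof.
elim: n f i => [f []//|n IHn] f i cf df cpf bf.
have intf := integrable_boxed cpf (boxed_partial i bf).
have intc := integrable_consrV intf.
rewrite integral_consrV//.
case: (unliftP ord0 i) => [j|] ij.
  rewrite -(integral12_prod_meas1 intc) /fubini_F.
  rewrite (_ : (fun x => _) = cst 0%E) ?integral0//; apply/funext => t /=.
  pose g y := f (consrV (t, y)).
  have lineE y s : g (y + s *: delta_mx ord0 j) =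
      f (consrV (t, y) + s *: delta_mx ord0 i).
    by rewrite /g consrV_tail ij.
  have dg y : derivable g y (delta_mx ord0 j) /\
      partial j g y = partial i f (consrV (t, y)).
    have [d1 d2] := is_derive_line (derivable_line0 (df (consrV (t, y)))).
    apply: derivable_line.
    under eq_fun do rewrite lineE.
    by move: d2; rewrite scale0r addr0 => d2; exact: DeriveDef.
  under eq_integral do rewrite -(dg _).2.
  apply: IHn.
  - by move=> y; apply: continuous_comp; [exact: continuous_consrV2|exact: cf].
  - by move=> y; exact: (dg y).1.
  - rewrite (_ : partial j g = fun y => partial i f (consrV (t, y))).
      by move=> y; apply: continuous_comp; [exact: continuous_consrV2|exact: cpf].
    by apply/funext => y; exact: (dg y).2.
  - move=> y k Mk; apply: (bf _ (lift ord0 k)).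
    by rewrite mxE liftK.
rewrite -(integral21_prod_meas1 intc) /fubini_G.
rewrite (_ : (fun x => _) = cst 0%E) ?integral0//; apply/funext => y /=.
pose g t := f (consrV (t, y)).
have gE t : g t = f (consrV (0, y) + t *: delta_mx ord0 i).
  by rewrite /g (consrV_shift t) ij.
have dg (t : R) : is_derive t 1 g (partial i f (consrV (t, y))).
  rewrite (_ : g = fun t => f (consrV (0, y) + t *: delta_mx ord0 i)).
    by rewrite (consrV_shift t) -ij; exact/is_derive_line/df.
  exact/funext.
have d1g : derive1 g = fun t => partial i f (consrV (t, y)).
  by apply/funext => t; rewrite derive1E; apply: derive_val.
rewrite -[RHS](@integral_derive_compact _ g M).
- by rewrite d1g.
- by move=> t; have [] := dg t.
- by rewrite d1g => t; apply: continuous_comp; [exact: continuous_consrV1|exact: cpf].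
- by move=> t Mt; apply: (bf _ ord0); rewrite mxE unlift_none.
Qed.

(** * Rothaus' inequality, pointwise *)

Section rothaus_pointwise.
Context {R : realType}.
Implicit Types (f g : R -> R) (x t h a b : R).

Lemma is_derive_add f g x a b : is_derive x 1 f a -> is_derive x 1 g b ->
  is_derive x 1 (fun y => f y + g y) (a + b).
Proof. by move=> df dg; apply: is_deriveD. Qed.

Lemma is_derive_mul f g x a b : is_derive x 1 f a -> is_derive x 1 g b ->
  is_derive x 1 (fun y => f y * g y) (f x * b + g x * a).
Proof. by move=> df dg; apply: is_deriveM. Qed.

Lemma is_derive_scale c f x a : is_derive x 1 f a ->
  is_derive x 1 (fun y => c * f y) (c * a).
Proof. by move=> df; apply: is_deriveZ. Qed.

Lemma is_derive_ln_comp f x a : 0 < f x -> is_derive x 1 f a ->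
  is_derive x 1 (fun y => ln (f y)) (a / f x).
Proof.
move=> fx df; rewrite mulrC.
by apply: (@is_derive1_comp _ (@ln R) f); exact: is_derive1_ln.
Qed.

Lemma is_derive_line1 x a b : is_derive x 1 (fun y => a + y * b) b.
Proof.
have /is_derive_eq := is_derive_add (is_derive_cst a x 1)
  (is_derive_mul (is_derive_id x 1) (is_derive_cst b x 1)).
by apply; rewrite mulr0 mulr1 !add0r.
Qed.

Lemma is_derive_sqr x : is_derive x 1 (fun y => y ^+ 2) (2 * x).
Proof.
have /is_derive_eq := is_derive_mul (is_derive_id x 1) (is_derive_id x 1).
by apply; ring.
Qed.

Lemma is_derive_continuous f (df : R -> R) :
  (forall x, is_derive x 1 f (df x)) -> continuous f.
Proof.
by move=> H x; apply/differentiable_continuous/derivable1_diffP; have [] := H x.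
Qed.

(** One exceptional point is allowed because the logarithms of [(1 + s * h) ^+ 2] met below are
    singular where [1 + s * h] vanishes. Continuity there glues the two monotone pieces together. *)
Lemma ge0_derive_except_le f (df : R -> R) c :
  (forall x, 0 <= x -> {for x, continuous f}) ->
  (forall x, 0 < x -> x != c -> is_derive x 1 f (df x)) ->
  (forall x, 0 < x -> x != c -> 0 <= df x) ->
  forall x, 0 <= x -> f 0 <= f x.
Proof.
move=> cf Hd Hp x x0.
have K (u v : R) : 0 <= u -> u <= v -> (c <= u) || (v <= c) -> f u <= f v.
  move=> u0 uv cuv.
  have Hin y : y \in `]u, v[ -> 0 < y /\ y != c.
    rewrite in_itv/= => /andP[uy yv]; split; first exact: le_lt_trans uy.
    move: cuv => /orP[cu|vc]; first by rewrite gt_eqF// (le_lt_trans cu).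
    by rewrite lt_eqF// (lt_le_trans yv).
  apply: (@ger0_derive1_ndecr _ f u v) => //.
  - by move=> y /Hin[y0 yc]; have [] := Hd y y0 yc.
  - move=> y /Hin[y0 yc]; rewrite derive1E.
    by have [_ ->] := Hd y y0 yc; exact: Hp.
  - apply: continuous_in_subspaceT => y /set_mem/=; rewrite in_itv/= => /andP[uy _].
    by apply: cf; exact: le_trans uy.
have [c0|c0] := leP c 0; first by apply: K => //; rewrite c0.
have [xc|/ltW cx] := leP x c; first by apply: K => //; rewrite xc orbT.
apply: (@le_trans _ _ (f c)); first by apply: K; rewrite ?lexx ?orbT// ltW.
by apply: K => //; rewrite ?lexx// ltW.
Qed.

(** Only [ln z <= z] is used: at z = y^2 for the upper side, and at z = 1 / sqrt y for the lower
    one, y^2 being the fourth power of sqrt y. The bound tends to 0 with x, which gives the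
    continuity of [x * ln (x ^+ 2)] at 0. *)
Lemma ln_sqr_le x : x != 0 -> `|x * ln (x ^+ 2)| <= 4 * Num.sqrt `|x| + `|x| ^+ 3.
Proof.
move=> x0; have ax0 : 0 < `|x| by rewrite normr_gt0.
have s0 : 0 < Num.sqrt `|x| by rewrite sqrtr_gt0.
have lnle y : 0 < y -> ln y <= y.
  move=> y0; have := @le_ln1Dx _ (y - 1); rewrite addrCA subrr addr0 => H.
  by apply: le_trans (H _) _; lra.
rewrite normrM -real_normK ?num_real//.
set y := `|x| in ax0 s0 *.
have up : ln (y ^+ 2) <= y ^+ 2 by apply: lnle; rewrite exprn_gt0.
have lo : - (4 / Num.sqrt y) <= ln (y ^+ 2).
  rewrite -[in y ^+ 2](sqr_sqrtr (ltW ax0)) -exprM lnXn// -mulr_natl.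
  have : ln ((Num.sqrt y)^-1) <= (Num.sqrt y)^-1 by apply: lnle; rewrite invr_gt0.
  by rewrite lnV ?posrE//; lra.
have -> : 4 * Num.sqrt y = y * (4 / Num.sqrt y).
  by rewrite -[X in _ = X * _](sqr_sqrtr (ltW ax0)); field; rewrite gt_eqF.
rewrite (_ : y ^+ 3 = y * y ^+ 2)// -mulrDr ler_pM2l// ler_norml.
have y20 : 0 <= y ^+ 2 by rewrite sqr_ge0.
have : 0 <= 4 / Num.sqrt y by rewrite divr_ge0// ltW.
by lra.
Qed.

Lemma is_derive_xlnsqr x : x != 0 ->
  is_derive x 1 (fun y : R => y * ln (y ^+ 2)) (ln (x ^+ 2) + 2).
Proof.
move=> x0; have x2 : 0 < x ^+ 2 by rewrite exprn_even_gt0.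
have /is_derive_eq := is_derive_mul (is_derive_id x 1)
  (@is_derive_ln_comp (fun y => y ^+ 2) x _ x2 (is_derive_sqr x)).
by apply; field.
Qed.

Lemma continuous_xlnsqr : continuous (fun x : R => x * ln (x ^+ 2)).
Proof.
move=> x; have [->|x0] := eqVneq x 0; last first.
  apply/differentiable_continuous/derivable1_diffP.
  by have [] := is_derive_xlnsqr x0.
rewrite /continuous_at mul0r; apply/norm_cvg0P.
have b0 : 4 * Num.sqrt `|y| + `|y| ^+ 3 @[y --> (0:R)] --> (0 : R).
  suff : 4 * Num.sqrt `|y| + `|y| ^+ 3 @[y --> (0:R)] -->
      4 * Num.sqrt `|0 : R| + `|0 : R| ^+ 3.
    by rewrite normr0 sqrtr0 mulr0 add0r expr0n.
  have cn : `|y| @[y --> (0:R)] --> `|0 : R| by apply: cvg_norm; exact: cvg_id.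
  apply: cvgD; last exact: (cvg_comp _ _ cn (@exprn_continuous R 3 _)).
  apply: cvgM; first exact: cvg_cst.
  exact: (cvg_comp _ _ cn (@sqrt_continuous R _)).
apply: (@squeeze_cvgr _ _ _ _ (fun=> 0) (fun y => 4 * Num.sqrt `|y| + `|y| ^+ 3)) => //; last exact: cvg_cst.
apply: nearW => y; rewrite normr_ge0/=.
have [->|y0] := eqVneq y 0; last exact: ln_sqr_le.
by rewrite !mul0r normr0 sqrtr0 mulr0 add0r expr0n.
Qed.

Lemma is_derive_sqrlnsqr x : x != 0 ->
  is_derive x 1 (fun y : R => y ^+ 2 * ln (y ^+ 2)) (2 * (x * ln (x ^+ 2)) + 2 * x).
Proof.
move=> x0.
rewrite (_ : (fun y => _) = fun y => y * (y * ln (y ^+ 2))); last first.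
  by apply/funext => y; rewrite mulrA.
have /is_derive_eq := is_derive_mul (is_derive_id x 1) (is_derive_xlnsqr x0).
by apply; ring.
Qed.

Lemma continuous_sqrlnsqr : continuous (fun x : R => x ^+ 2 * ln (x ^+ 2)).
Proof.
rewrite (_ : (fun y => _) = fun y => y * (y * ln (y ^+ 2))); last first.
  by apply/funext => y; rewrite mulrA.
by move=> x; apply: cvgM; [exact: cvg_id|exact: continuous_xlnsqr].
Qed.

(* For the variance normalized to 1, the entropy of (1 + t * h) ^+ 2 has second
   derivative in t controlled by the variational formula for the entropy; the
   coefficients in t below are chosen so that this becomes the pointwise
   convexity in t of the difference of the two sides. *)
Lemma rothaus_pointwise t h : 0 <= t ->
  (1 + t * h) ^+ 2 * ln ((1 + t * h) ^+ 2) <=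
  t ^+ 2 * (h ^+ 2 * ln (h ^+ 2)) + t ^+ 2
  + (2 * t ^+ 2 + 6 * t - 4 * ((1 + t) * ln (1 + t))) * h
  + ((1 + t ^+ 2) * ln (1 + t ^+ 2) + t ^+ 2) * h ^+ 2.
Proof.
move=> t0; set k := h ^+ 2 * ln (h ^+ 2).
pose X s := 1 + s * h.
pose H (y : R) := y ^+ 2 * ln (y ^+ 2).
pose G (y : R) := y * ln (y ^+ 2).
pose F s := s ^+ 2 * (k + 1 + 2 * h + h ^+ 2) + s * (6 * h)
  + (- 4 * h) * ((1 + s) * ln (1 + s)) + h ^+ 2 * ((1 + s ^+ 2) * ln (1 + s ^+ 2))
  + (- 1) * H (X s).
pose F1 s := s * (2 * (k + 1 + 2 * h + h ^+ 2)) + 2 * h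
  + (- 4 * h) * ln (1 + s) + h ^+ 2 * (s * (2 * ln (1 + s ^+ 2) + 2))
  + (- 2 * h) * (G (X s) + X s).
pose F2 s := 2 * (k + 1 + 2 * h + h ^+ 2) + (- 4 * h) / (1 + s)
  + h ^+ 2 * (2 * ln (1 + s ^+ 2) + 2 + s * (2 * (2 * s / (1 + s ^+ 2))))
  + (- 2 * h) * ((ln (X s ^+ 2) + 2) * h + h).
have id1 (s : R) : is_derive s 1 (fun s => s) 1 := is_derive_id s 1.
have ic (c s : R) : is_derive s 1 (fun=> c) 0 := is_derive_cst c s 1.
have dX (s : R) : is_derive s 1 X h := is_derive_line1 s 1 h.
have dln (s : R) : 0 <= s -> is_derive s 1 (fun s => ln (1 + s)) (1 + s)^-1.
  move=> s0; have := @is_derive_ln_comp (fun s => 1 + s) s 1.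
  rewrite div1r; apply; first by rewrite ltr_pwDl.
  have := is_derive_line1 s 1 1.
  by rewrite (_ : (fun y => _) = fun s => 1 + s)//; apply/funext => y; rewrite mulr1.
have q0 (s : R) : 0 < 1 + s ^+ 2 by rewrite ltr_pwDl// sqr_ge0.
have dq (s : R) : is_derive s 1 (fun s => 1 + s ^+ 2) (2 * s).
  have := is_derive_add (ic 1 s) (is_derive_sqr s).
  by rewrite add0r.
have dlnq (s : R) := @is_derive_ln_comp (fun s => 1 + s ^+ 2) s _ (q0 s) (dq s).
(* For [h = 0] the excluded point is 0 and [X] is constantly 1, so a single exceptional point serves
   all values of h. *)
have Xc (s : R) : s != - h^-1 -> X s != 0.
  move=> sh; apply/eqP => Xs; move/eqP: sh; apply.
  have [h0|h0] := eqVneq h 0; first by move: Xs; rewrite /X h0; lra.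
  by apply: (mulIf h0); rewrite mulNr mulVf//; move: Xs; rewrite /X; lra.
have cont (f : R -> R) (s a : R) : is_derive s 1 f a -> {for s, continuous f}.
  by move=> [d _]; exact/differentiable_continuous/derivable1_diffP.
pose P s := s ^+ 2 * (k + 1 + 2 * h + h ^+ 2) + s * (6 * h)
  + (- 4 * h) * ((1 + s) * ln (1 + s)) + h ^+ 2 * ((1 + s ^+ 2) * ln (1 + s ^+ 2)).
pose P1 s := s * (2 * (k + 1 + 2 * h + h ^+ 2)) + 2 * h
  + (- 4 * h) * ln (1 + s) + h ^+ 2 * (s * (2 * ln (1 + s ^+ 2) + 2)).
have d1s (s : R) : is_derive s 1 (fun s => 1 + s) 1.
  have := is_derive_line1 s 1 1.
  by rewrite (_ : (fun y => _) = fun s => 1 + s)//; apply/funext => y; rewrite mulr1.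
have dP (s : R) : 0 <= s -> is_derive s 1 P (P1 s).
  move=> s0; have s1 : 0 < 1 + s by rewrite ltr_pwDl.
  have /is_derive_eq := is_derive_add (is_derive_add (is_derive_add
    (is_derive_mul (is_derive_sqr s) (ic (k + 1 + 2 * h + h ^+ 2) s))
    (is_derive_mul (id1 s) (ic (6 * h) s)))
    (is_derive_scale (- 4 * h) (is_derive_mul (d1s s) (dln s s0))))
    (is_derive_scale (h ^+ 2) (is_derive_mul (dq s) (dlnq s))).
  apply; rewrite /P1; field; by rewrite !gt_eqF.
have dP1 (s : R) : 0 <= s -> is_derive s 1 P1 (2 * (k + 1 + 2 * h + h ^+ 2)
  + (- 4 * h) / (1 + s)
  + h ^+ 2 * (2 * ln (1 + s ^+ 2) + 2 + s * (2 * (2 * s / (1 + s ^+ 2))))).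
  move=> s0; have s1 : 0 < 1 + s by rewrite ltr_pwDl.
  have /is_derive_eq := is_derive_add (is_derive_add (is_derive_add
    (is_derive_mul (id1 s) (ic (2 * (k + 1 + 2 * h + h ^+ 2)) s))
    (ic (2 * h) s))
    (is_derive_scale (- 4 * h) (dln s s0)))
    (is_derive_scale (h ^+ 2) (is_derive_mul (id1 s)
      (is_derive_add (is_derive_scale 2 (dlnq s)) (ic 2 s)))).
  apply; field; by rewrite !gt_eqF.
have dF (s : R) : 0 < s -> s != - h^-1 -> is_derive s 1 F (F1 s).
  move=> s0 /Xc Xs.
  have /is_derive_eq := is_derive_add (dP s (ltW s0)) (is_derive_scale (- 1)
    (is_derive1_comp (is_derive_sqrlnsqr Xs) (dX s))).
  by apply; rewrite /F1 /P1 /G; ring.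
have dF1 (s : R) : 0 < s -> s != - h^-1 -> is_derive s 1 F1 (F2 s).
  move=> s0 /Xc Xs.
  have /is_derive_eq := is_derive_add (dP1 s (ltW s0)) (is_derive_scale (- 2 * h)
    (is_derive_add (is_derive1_comp (is_derive_xlnsqr Xs) (dX s)) (dX s))).
  by apply.
have cX (s : R) : {for s, continuous X} := cont _ _ _ (dX s).
have cF (s : R) : 0 <= s -> {for s, continuous F}.
  move=> /dP/cont cP; apply: cvgD; first exact: cP.
  apply: cvgM; first exact: cvg_cst.
  exact: (cvg_comp _ _ (cX s) (@continuous_sqrlnsqr _)).
have cF1 (s : R) : 0 <= s -> {for s, continuous F1}.
  move=> /dP1/cont cP; apply: cvgD; first exact: cP.
  apply: cvgM; first exact: cvg_cst.
  apply: cvgD; last exact: cX.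
  exact: (cvg_comp _ _ (cX s) (@continuous_xlnsqr _)).
(* This is [ln z <= z - 1] at [z = X s ^+ 2 / (h ^+ 2 * (1 + s ^+ 2))], multiplied by [h ^+ 2]. When
   h is centred with variance 1, [1 + s ^+ 2] is the mean of [X s ^+ 2] and both sides are the
   integrands of the variational formula for the entropy. *)
have gibbs (s : R) : X s != 0 ->
    h ^+ 2 * ln (X s ^+ 2) - k - h ^+ 2 * ln (1 + s ^+ 2) <=
    X s ^+ 2 / (1 + s ^+ 2) - h ^+ 2.
  move=> Xs; rewrite /k; have [->|h0] := eqVneq h 0.
    by rewrite expr0n/= !mul0r !subr0 divr_ge0 ?sqr_ge0// ltW.
  have h2 : 0 < h ^+ 2 by rewrite exprn_even_gt0.
  have X2 : 0 < X s ^+ 2 by rewrite exprn_even_gt0.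
  have := @le_ln1Dx _ (X s ^+ 2 / (h ^+ 2 * (1 + s ^+ 2)) - 1).
  have hq : 0 < h ^+ 2 * (1 + s ^+ 2) by rewrite mulr_gt0.
  rewrite addrCA subrr addr0 ltrDr divr_gt0// => /(_ isT).
  rewrite ln_div ?posrE// lnM ?posrE// => L.
  have := ler_wpM2l (ltW h2) L.
  rewrite (_ : h ^+ 2 * (_ / _ - 1) = X s ^+ 2 / (1 + s ^+ 2) - h ^+ 2); first lra.
  by field; rewrite h0 gt_eqF.
have F2ge0 (s : R) : 0 < s -> s != - h^-1 -> 0 <= F2 s.
  move=> s0 /Xc/gibbs g.
  have s1 : 0 < 1 + s by rewrite addr_gt0.
  (* Twice the slack in [gibbs], plus a remainder in which the square in h has been completed. The
     coefficient of h in the statement is the one for which [4 s / (1 + s)^2] and the square of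
     [(s - 1) / (1 + s)] add up to 1. *)
  have E : F2 s = 2 * (X s ^+ 2 / (1 + s ^+ 2) - h ^+ 2 -
      (h ^+ 2 * ln (X s ^+ 2) - k - h ^+ 2 * ln (1 + s ^+ 2))) +
      2 * s ^+ 2 / (1 + s ^+ 2) * (4 * s / (1 + s) ^+ 2 + (h + (s - 1) / (1 + s)) ^+ 2).
    by rewrite /F2 /X; field; rewrite !gt_eqF.
  rewrite E addr_ge0//; first by rewrite mulr_ge0// subr_ge0.
  rewrite mulr_ge0//.
    by rewrite divr_ge0 ?mulr_ge0 ?sqr_ge0// ltW.
  by rewrite addr_ge0 ?sqr_ge0// divr_ge0 ?mulr_ge0 ?sqr_ge0// ltW.
have F1_0 : F1 0 = 0.
  by rewrite /F1 /G /X !mul0r !addr0 expr1n ln1; ring.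
have F1ge0 (s : R) : 0 <= s -> 0 <= F1 s.
  by move=> s0; rewrite -F1_0; exact: (ge0_derive_except_le cF1 dF1 F2ge0).
have F00 : F 0 = 0.
  by rewrite /F /H /X !mul0r expr0n/= !addr0 expr1n ln1; ring.
have F1ge0w (s : R) : 0 < s -> s != - h^-1 -> 0 <= F1 s by move=> s0 _; exact/F1ge0/ltW.
have := ge0_derive_except_le cF dF F1ge0w t0.
rewrite F00 => Ft; rewrite -subr_ge0.
by apply: le_trans Ft _; rewrite le_eqVlt; apply/orP; left; apply/eqP; rewrite /F /H /X; ring.
Qed.

(** The pointwise inequality rescaled: with [t = sqrt (S / a ^+ 2)] and [h = g / (a * t)] one has
    [a + g = a * (1 + t * h)] and [h ^+ 2 = g ^+ 2 / S]. The components of [c] are the coefficients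
    of 1, g and g^2. The middle one is left free since it will multiply the integral of a centred
    function; the other two integrate to the 2 S of Rothaus' inequality. *)
Lemma rothaus_shift a (S : R) : a != 0 -> 0 < S ->
  exists c : R * R * R, c.1.1 + c.2 * S = 2 * S /\
  forall g : R, (a + g) ^+ 2 * ln ((a + g) ^+ 2 / (a ^+ 2 + S)) <=
    g ^+ 2 * ln (g ^+ 2 / S) + c.1.1 + c.1.2 * g + c.2 * g ^+ 2.
Proof.
move=> a0 S0; have a2 : 0 < a ^+ 2 by rewrite exprn_even_gt0.
pose t := Num.sqrt (S / a ^+ 2).
have t2 : t ^+ 2 = S / a ^+ 2 by rewrite sqr_sqrtr// divr_ge0 ?ltW.
have t0 : 0 < t by rewrite sqrtr_gt0 divr_gt0.
pose L := ln (1 + t ^+ 2).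
exists (a ^+ 2 * (t ^+ 2 - L),
  a ^+ 2 * (2 * t ^+ 2 + 6 * t - 4 * ((1 + t) * ln (1 + t)) - 2 * t * L) / (a * t),
  (L + t ^+ 2) * a ^+ 2 / S) => /=; split.
  by rewrite t2; field; rewrite a0 gt_eqF.
move=> g; pose h := g / (a * t).
have at0 : a * t != 0 by rewrite mulf_neq0// gt_eqF.
have th : t * h = g / a by rewrite /h; field; rewrite a0 gt_eqF.
have gE : a + g = a * (1 + t * h) by rewrite th; field.
have h2 : h ^+ 2 = g ^+ 2 / S.
  rewrite /h expr_div_n exprMn t2; field.
  by rewrite a0 gt_eqF.
have P := rothaus_pointwise h (ltW t0).
have D : (a + g) ^+ 2 / (a ^+ 2 + S) = (1 + t * h) ^+ 2 / (1 + t ^+ 2).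
  rewrite gE t2 exprMn; field.
  by rewrite a0/= gt_eqF ?addr_gt0.
have E : (1 + t * h) ^+ 2 * ln ((a + g) ^+ 2 / (a ^+ 2 + S)) =
    (1 + t * h) ^+ 2 * ln ((1 + t * h) ^+ 2) - (1 + t * h) ^+ 2 * L.
  rewrite D; have [->|X0] := eqVneq (1 + t * h) 0; first by rewrite !expr0n/= !mul0r subr0.
  rewrite ln_div ?posrE ?mulrBr// ?exprn_even_gt0//.
  by rewrite ltr_pwDl// sqr_ge0.
have -> : (a + g) ^+ 2 * ln ((a + g) ^+ 2 / (a ^+ 2 + S)) =
    a ^+ 2 * ((1 + t * h) ^+ 2 * ln ((1 + t * h) ^+ 2) - (1 + t * h) ^+ 2 * L).
  by rewrite -E {1}gE; ring.
have gh : g = h * (a * t) by rewrite /h divfK.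
have gS : g ^+ 2 = h ^+ 2 * S by rewrite h2; field; rewrite gt_eqF.
apply: (@le_trans _ _ (a ^+ 2 *
  ((t ^+ 2 * (h ^+ 2 * ln (h ^+ 2)) + t ^+ 2
  + (2 * t ^+ 2 + 6 * t - 4 * ((1 + t) * ln (1 + t))) * h
  + ((1 + t ^+ 2) * L + t ^+ 2) * h ^+ 2) - (1 + t * h) ^+ 2 * L))).
  by apply: ler_wpM2l; [exact: ltW|rewrite lerD2r].
have ch c : c / (a * t) * g = c * h by rewrite /h; ring.
rewrite ch -h2.
rewrite le_eqVlt; apply/orP; left; apply/eqP.
rewrite gS.
have -> : (L + t ^+ 2) * a ^+ 2 / S * (h ^+ 2 * S) = (L + t ^+ 2) * a ^+ 2 * h ^+ 2.
  by field; rewrite gt_eqF.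
have -> : h ^+ 2 * S * ln (h ^+ 2) = a ^+ 2 * t ^+ 2 * (h ^+ 2 * ln (h ^+ 2)).
  by rewrite t2; field; rewrite a0.
by ring.
Qed.

End rothaus_pointwise.

(** * Smooth cut-off functions *)

Section class_C_closure.
Context {R : realType} {n : nat}.
Implicit Types (f g : 'rV[R]_n -> R) (k : nat).

Lemma continuous_fD f g : continuous f -> continuous g ->
  continuous (fun x => f x + g x).
Proof.
move=> cf cg x.
exact: (@cvgD _ _ _ _ (nbhs_filter x) _ _ _ _ (cf x) (cg x)).
Qed.

Lemma continuous_fM f g : continuous f -> continuous g ->
  continuous (fun x => f x * g x).
Proof.
move=> cf cg x.
exact: (@cvgM _ _ _ (nbhs_filter x) _ _ _ _ (cf x) (cg x)).
Qed.

Lemma class_C_continuous k f : class_C k f -> continuous f.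
Proof. by case: k => [|k] []. Qed.

Lemma class_C_derivable k f i x : class_C k.+1 f -> derivable f x (delta_mx ord0 i).
Proof. by move=> [_ /(_ i)[]]. Qed.

Lemma class_C_partial k f i : class_C k.+1 f -> class_C k (partial i f).
Proof. by move=> [_ /(_ i)[]]. Qed.

Lemma class_CW k f : class_C k.+1 f -> class_C k f.
Proof.
elim: k f => [|k IHk] f [cf Hf]; split => // i.
by have [df Cf] := Hf i; split => //; exact: IHk.
Qed.

Lemma class_C_cst k (c : R) : class_C k (fun _ : 'rV[R]_n => c).
Proof.
elim: k c => [|k IHk] c; split; try exact: cst_continuous; first by [].
move=> i; split; first by move=> x; exact: derivable_cst.
rewrite (_ : partial i _ = fun=> 0) ?IHk//.
by apply/funext => x; exact: derive_cst.
Qed.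

Lemma class_CD k f g : class_C k f -> class_C k g -> class_C k (fun x => f x + g x).
Proof.
elim: k f g => [|k IHk] f g [cf Hf] [cg Hg]; split => //.
- exact: continuous_fD.
- exact: continuous_fD.
- move=> i; have [df Cf] := Hf i; have [dg Cg] := Hg i; split.
    by move=> x; exact: derivableD.
  rewrite (_ : partial i _ = fun x => partial i f x + partial i g x).
    exact: IHk.
  by apply/funext => x; exact: deriveD.
Qed.

Lemma class_CM k f g : class_C k f -> class_C k g -> class_C k (fun x => f x * g x).
Proof.
elim: k f g => [|k IHk] f g Hf Hg.
  split => //; move: Hf Hg => [cf _] [cg _].
  exact: continuous_fM.
split.
  by apply: continuous_fM; apply: class_C_continuous; eassumption.
move=> i; split.
  by move=> x; apply: derivableM; apply: class_C_derivable; eassumption.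
rewrite (_ : partial i _ = fun x => f x * partial i g x + g x * partial i f x).
  by apply: class_CD; apply: IHk; (exact: class_CW || exact: class_C_partial).
by apply/funext => x; apply: deriveM; apply: class_C_derivable; eassumption.
Qed.

Lemma class_C_prod k (I : Type) (s : seq I) (F : I -> 'rV[R]_n -> R) :
  (forall i, class_C k (F i)) -> class_C k (fun x => \prod_(i <- s) F i x).
Proof.
move=> HF; elim: s => [|i s IHs].
  rewrite (_ : (fun x => _) = fun=> 1); first exact: class_C_cst.
  by apply/funext => x; rewrite big_nil.
rewrite (_ : (fun x => _) = fun x => F i x * \prod_(i <- s) F i x).
  exact: class_CM.
by apply/funext => x; rewrite big_cons.
Qed.

End class_C_closure.

Section flat.
Context {R : realType}.
Implicit Types (t : R) (j : nat).

(** The case [j = 0] is the classical smooth function that is flat at 0. The other indices are there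
    because the family is closed under differentiation up to linear combinations, so smoothness
    becomes an induction. *)
Definition flat j t : R := if 0 < t then t^-1 ^+ j * expR (- t^-1) else 0.

Lemma flat_ge0 j t : 0 <= flat j t.
Proof.
rewrite /flat; case: ifP => // t0.
by rewrite mulr_ge0 ?expR_ge0// exprn_ge0// invr_ge0 ltW.
Qed.

Lemma flatE0 j t : t <= 0 -> flat j t = 0.
Proof. by move=> t0; rewrite /flat ltNge t0. Qed.

(** One term of the exponential series, [y ^+ j.+1 / (j.+1)!] at [y = t^-1], is below [expR y]. The
    linear bound is what makes difference quotients at 0 converge. *)
Lemma flat_le j t : 0 < t -> flat j t <= (j.+1)`!%:R * t.
Proof.
move=> t0; rewrite /flat t0 expRN.
have y0 : 0 < t^-1 by rewrite invr_gt0.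
have h := @expR_ge1Dxn _ t^-1 j (ltW y0).
have f0 : 0 < (j.+1)`!%:R :> R by rewrite ltr0n fact_gt0.
have {}h : t^-1 ^+ j.+1 / (j.+1)`!%:R <= expR t^-1 by lra.
rewrite ler_pdivrMr ?expR_gt0//.
have -> : t^-1 ^+ j = t * t^-1 ^+ j.+1 by rewrite exprS mulrA mulfV ?mul1r ?gt_eqF.
rewrite mulrAC -mulrA mulrCA [leRHS]mulrC -mulrA mulrC -mulrA ler_pM2l//.
by move: h; rewrite ler_pdivrMr// mulrC.
Qed.

Lemma flat_bounded j t : flat j t <= (j`!)%:R.
Proof.
have [t0|t0] := leP t 0; first by rewrite flatE0.
rewrite /flat t0 expRN ler_pdivrMr ?expR_gt0//.
have y0 : 0 < t^-1 by rewrite invr_gt0.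
case: j => [|j].
  by rewrite expr0 fact0 mul1r; have := expR_ge1Dx t^-1; lra.
have h := @expR_ge1Dxn _ t^-1 j (ltW y0).
have f0 : 0 < (j.+1)`!%:R :> R by rewrite ltr0n fact_gt0.
rewrite -ler_pdivrMl// mulrC; lra.
Qed.

Lemma is_derive_flat j t :
  is_derive t 1 (flat j) (- j%:R * flat j.+1 t + flat j.+2 t).
Proof.
have [t0|t0|->] := ltgtP t 0.
- rewrite !flatE0 ?ltW// mulr0 addr0.
  apply: (@near_eq_is_derive _ _ _ (fun=> 0)).
    by near=> s; rewrite flatE0// ltW//; near: s; exact: lt_nbhsl.
- have tN0 : t != 0 by rewrite gt_eqF.
  apply: (@near_eq_is_derive _ _ _ (fun s : R => s^-1 ^+ j * expR (- s^-1))).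
    near=> s; rewrite /flat ifT//; near: s; exact: lt_nbhsr.
  have dV : is_derive t 1 (fun s : R => s^-1) (- t^-1 ^+ 2).
    have /is_derive_eq := @is_deriveV _ id t 1 1 tN0 (is_derive_id t 1).
    by apply; rewrite /GRing.scale/= mulr1 exprVn.
  have dVj : is_derive t 1 (fun s : R => s^-1 ^+ j) (- j%:R * t^-1 ^+ j.+1).
    rewrite (_ : (fun s : R => s^-1 ^+ j) = (fun s : R => s^-1) ^+ j); last first.
      by apply/funext => s; rewrite exprfctE.
    have /is_derive_eq := @is_deriveX _ _ (fun s : R => s^-1) j t 1 _ dV.
    apply; rewrite /GRing.scale/=; case: (j) => [|i]; first by ring.
    rewrite /= !exprS; ring.
  have dE : is_derive t 1 (fun s : R => expR (- s^-1)) (expR (- t^-1) * t^-1 ^+ 2).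
    apply: (@is_derive1_comp _ expR (fun s => - s^-1)).
    by rewrite -[t^-1 ^+ 2]opprK; exact: is_deriveN.
  have /is_derive_eq := is_derive_mul dVj dE.
  apply; rewrite /flat t0 !exprS; ring.
- rewrite !flatE0// mulr0 addr0.
  have L : (h^-1 *: (flat j (h + 0) - flat j 0)) @[h --> (0:R)^'] --> (0:R).
    apply: norm_cvg0.
    apply: (@squeeze_cvgr _ _ _ _ (fun=> 0) (fun y => (j.+2)`!%:R * `|y|)).
    + apply: nearW => h; rewrite normr_ge0/= addr0 (flatE0 j (lexx 0)) subr0.
      have [h0|h0] := leP h 0; first by rewrite flatE0// scaler0 normr0 mulr_ge0.
      rewrite (gtr0_norm h0) ger0_norm.
        (* Dividing [flat j h] by h gives [flat j.+1 h], which is of order h. *)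
        have := flat_le j.+1 h0; rewrite /flat h0 exprS.
        by rewrite /GRing.scale/= mulrA.
      by rewrite /GRing.scale/= mulr_ge0 ?flat_ge0// invr_ge0 ltW.
    + exact: cvg_cst.
    + rewrite -[X in _ --> X](mulr0 (j.+2)`!%:R).
      apply: cvgM; first exact: cvg_cst.
      have : `|y| @[y --> (0:R)^'] --> `|0 : R|.
        by apply: cvg_norm; apply: cvg_within.
      by rewrite normr0.
  have E : (fun h : R => h^-1 *: ((flat j \o shift 0) (h *: 1) - flat j 0)) =
      (fun h : R => h^-1 *: (flat j (h + 0) - flat j 0)).
    by apply/funext => h /=; rewrite [h *: 1]mulr1.
  apply: DeriveDef; first by rewrite /derivable E; apply/cvg_ex; exists 0.
  by rewrite /derive E; apply/cvg_lim.
Unshelve. all: by end_near. Qed.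

End flat.

(** The limit [0 ^+ j] is 1 for [j = 0] and 0 otherwise: cut-offs of growing radius tend to 1 while
    their derivatives, made of [flat 2], tend to 0. *)
Lemma flat_cvg {R : realType} j (c : R) :
  flat j (m%:R + c) @[m --> \oo] --> (0 ^+ j : R).
Proof.
have ny : (m%:R + c) @[m --> \oo] --> +oo%R.
  apply/cvgryPge => A; near=> m; rewrite -lerBlDr.
  by near: m; exact: nbhs_infty_ger.
have v0 : (m%:R + c)^-1 @[m --> \oo] --> (0 : R).
  have h0 : \forall m \near \oo, 0 < m%:R + c by move/cvgryPgt : ny; apply.
  exact: ((gtr0_cvgV0 h0).2 ny).
have lim : (m%:R + c)^-1 ^+ j * expR (- (m%:R + c)^-1) @[m --> \oo] --> (0 ^+ j * expR (- 0) : R).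
  apply: cvgM; first exact: (cvg_comp _ _ v0 (@exprn_continuous R j 0)).
  exact: (cvg_comp _ _ (cvgN v0) (@continuous_expR R (- 0))).
rewrite oppr0 expR0 mulr1 in lim.
apply: cvg_trans lim; apply: near_eq_cvg.
have : \forall m \near \oo, 0 < m%:R + c by move/cvgryPgt : ny; apply.
by apply: filterS => m m0; rewrite /flat m0.
Unshelve. all: by end_near. Qed.

Lemma continuous_flat {R : realType} j : continuous (@flat R j).
Proof. exact: (is_derive_continuous (is_derive_flat j)). Qed.

Lemma flat_le1 {R : realType} (t : R) : flat 0 t <= 1.
Proof. exact: flat_bounded. Qed.

Section flat_coord.
Context {R : realType} {n : nat}.
Implicit Types (r : R) (y : 'rV[R]_n).

(** The induction on k is over all j at once, as one derivative of [flat j] involves [flat j.+1] and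
    [flat j.+2]. *)
Lemma class_C_flat k j (a b : R) (i : 'I_n) :
  class_C k (fun y : 'rV[R]_n => flat j (a + b * y ord0 i)).
Proof.
have aff : continuous (fun y : 'rV[R]_n => a + b * y ord0 i).
  apply: continuous_fD; first exact: cst_continuous.
  by apply: continuous_fM; [exact: cst_continuous|exact: coord_continuous].
have cont : continuous (fun y : 'rV[R]_n => flat j (a + b * y ord0 i)).
  by move=> y; apply: (cvg_comp _ _ (aff y)); exact: continuous_flat.
elim: k j cont => [|k IHk] j cont; first by split.
split => // l.
have D y : derivable (fun y : 'rV[R]_n => flat j (a + b * y ord0 i)) y (delta_mx ord0 l) /\
    'D_(delta_mx ord0 l) (fun y : 'rV[R]_n => flat j (a + b * y ord0 i)) y =
    (b * (i == l)%:R) * (- j%:R * flat j.+1 (a + b * y ord0 i) +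
    flat j.+2 (a + b * y ord0 i)).
  apply: derivable_line.
  pose L (s : R) := (a + b * y ord0 i) + s * (b * (i == l)%:R).
  rewrite (_ : (fun s : R => _) = flat j \o L); last first.
    apply/funext => s; rewrite /L /= !mxE eqxx/=; congr flat; ring.
  rewrite mulrC; apply: is_derive1_comp; last exact: is_derive_line1.
  rewrite /L mul0r addr0; exact: is_derive_flat.
split; first by move=> y; exact: (D y).1.
rewrite (_ : partial l _ = fun y => (b * (i == l)%:R) *
    (- j%:R * flat j.+1 (a + b * y ord0 i) + flat j.+2 (a + b * y ord0 i))).
  have C m : class_C k (fun y : 'rV[R]_n => flat m (a + b * y ord0 i)).
    apply: IHk => y; apply: (cvg_comp _ _ (aff y)); exact: continuous_flat.
  apply: class_CM; first exact: class_C_cst.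
  apply: class_CD => //; apply: class_CM => //; exact: class_C_cst.
by apply/funext => y; exact: (D y).2.
Qed.

(** An even smooth bump with values in [0, 1], supported in the cube of radius r. It has two uses:
    with r tending to infinity it truncates, and with r tending to 0, after division by its mass, it
    is the mollifying kernel. *)
Definition cutoff (r : R) (y : 'rV[R]_n) : R :=
  \prod_(i < n) (flat 0 (r + y ord0 i) * flat 0 (r - y ord0 i)).

Lemma class_C_cutoff k r (x : 'rV[R]_n) : class_C k (fun y => cutoff r (y - x)).
Proof.
apply: class_C_prod => i; apply: class_CM.
  rewrite (_ : (fun y => _) = fun y : 'rV[R]_n => flat 0 ((r - x ord0 i) + 1 * y ord0 i)).
    exact: class_C_flat.
  by apply/funext => y; rewrite !mxE; congr flat; ring.
rewrite (_ : (fun y => _) = fun y : 'rV[R]_n => flat 0 ((r + x ord0 i) + (-1) * y ord0 i)).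
  exact: class_C_flat.
by apply/funext => y; rewrite !mxE; congr flat; ring.
Qed.

Lemma class_C_cutoff0 k r : class_C k (cutoff r).
Proof.
have := class_C_cutoff k r 0.
by rewrite (_ : (fun y => _) = cutoff r)//; apply/funext => y; rewrite subr0.
Qed.

Lemma cutoff_ge0 r y : 0 <= cutoff r y.
Proof. by apply: prodr_ge0 => i _; rewrite mulr_ge0 ?flat_ge0. Qed.

Lemma cutoff_le1 r y : cutoff r y <= 1.
Proof.
rewrite [leRHS](_ : 1 = \prod_(i < n) (1 : R)); last by rewrite big1_eq.
apply: ler_prod => i _; rewrite mulr_ge0 ?flat_ge0//=.
by rewrite mulr_ile1 ?flat_ge0 ?flat_le1.
Qed.

Lemma cutoffN r y : cutoff r (- y) = cutoff r y.
Proof.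
by apply: eq_bigr => i _; rewrite !mxE opprK mulrC.
Qed.

Lemma boxed_cutoff r : boxed r (cutoff r).
Proof.
move=> y i ry; rewrite /cutoff (bigD1 i)//=.
suff -> : flat 0 (r + y ord0 i) * flat 0 (r - y ord0 i) = 0 by rewrite mul0r.
have [y0|y0] := leP 0 (y ord0 i).
  by rewrite [X in _ * X]flatE0 ?mulr0//; move: ry; rewrite ger0_norm//; lra.
by rewrite flatE0 ?mul0r//; move: ry; rewrite ltr0_norm//; lra.
Qed.

Lemma cutoff_cvg y : cutoff m%:R y @[m --> \oo] --> (1 : R).
Proof.
have H : cutoff m%:R y @[m --> \oo] --> (\prod_(i < n) (1 : R)).
  apply: cvg_big.
    by move=> z; exact: mul_continuous.
  move=> i _; have := @cvgM _ _ \oo _ _ _ _ _ (@flat_cvg R 0 (y ord0 i)) (@flat_cvg R 0 (- y ord0 i)).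
  by rewrite expr0 mulr1; exact.
by rewrite big1_eq in H.
Qed.

(** The derivative of [flat 0] is [flat 2], and every factor left undifferentiated is at most 1. The
    right side is bounded by 4 whatever r is, and tends to 0 as r grows. *)
Lemma partial_cutoff_le r i y :
  `|partial i (cutoff r) y| <= flat 2 (r + y ord0 i) + flat 2 (r - y ord0 i).
Proof.
pose K := \prod_(j < n | j != i) (flat 0 (r + y ord0 j) * flat 0 (r - y ord0 j)).
have K01 : 0 <= K <= 1.
  apply/andP; split; first by apply: prodr_ge0 => j _; rewrite mulr_ge0 ?flat_ge0.
  rewrite [leRHS](_ : 1 = \prod_(j < n | j != i) (1 : R)); last by rewrite big1_eq.
  apply: ler_prod => j _; rewrite mulr_ge0 ?flat_ge0//=.
  by rewrite mulr_ile1 ?flat_ge0 ?flat_le1.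
have -> : partial i (cutoff r) y =
    K * (flat 0 (r + y ord0 i) * (- flat 2 (r - y ord0 i)) +
         flat 0 (r - y ord0 i) * flat 2 (r + y ord0 i)).
  apply: (derivable_line _).2.
  rewrite (_ : (fun s : R => _) = fun s => K *
      (flat 0 (r + y ord0 i + s * 1) * flat 0 (r - y ord0 i + s * (-1)))).
    have D a b := @is_derive1_comp _ (flat 0) (fun s : R => a + s * b) 0 _ _
      (is_derive_flat 0 _) (is_derive_line1 0 a b).
    have /is_derive_eq := is_derive_scale K
      (is_derive_mul (D (r + y ord0 i) 1) (D (r - y ord0 i) (- 1))).
    by apply; rewrite /= !mul0r !addr0; ring.
  apply/funext => s; rewrite /cutoff (bigD1 i)//= mulrC; congr (_ * _).
    apply: eq_bigr => j ji; rewrite !mxE eqxx/= (negbTE ji).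
    by rewrite mulr0 addr0.
  by rewrite !mxE !eqxx/=; congr (flat _ _ * flat _ _); ring.
have [/andP[K0 K1]] := K01.
rewrite normrM (ger0_norm K0).
apply: (@le_trans _ _ `|flat 0 (r + y ord0 i) * - flat 2 (r - y ord0 i) +
    flat 0 (r - y ord0 i) * flat 2 (r + y ord0 i)|).
  by rewrite ler_piMl.
apply: (le_trans (ler_normD _ _)).
rewrite !normrM normrN !(ger0_norm (flat_ge0 _ _)) addrC.
by apply: lerD; rewrite ler_piMl ?flat_ge0 ?flat_le1.
Qed.

Lemma partial_cutoff_bounded r i y : `|partial i (cutoff r) y| <= 4.
Proof.
apply: (le_trans (partial_cutoff_le _ _ _)).
have h1 := @flat_bounded R 2 (r + y ord0 i).
have h2 := @flat_bounded R 2 (r - y ord0 i).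
by rewrite (_ : 4 = (2`!)%:R + (2`!)%:R) ?lerD//= -natrD.
Qed.

Lemma partial_cutoff_cvg i y : partial i (cutoff m%:R) y @[m --> \oo] --> (0 : R).
Proof.
apply: norm_cvg0.
apply: (@squeeze_cvgr _ _ _ _ (fun=> 0)
  (fun m => flat 2 (m%:R + y ord0 i) + flat 2 (m%:R - y ord0 i))).
- by apply: nearW => m; rewrite normr_ge0 partial_cutoff_le.
- exact: cvg_cst.
- have H := @cvgD _ _ _ \oo _ _ _ _ _ (@flat_cvg R 2 (y ord0 i)) (@flat_cvg R 2 (- y ord0 i)).
  by rewrite expr0n/= addr0 in H; exact: H.
Qed.

Lemma test_function_boxed (f : 'rV[R]_n -> R) M :
  (forall k, class_C k f) -> boxed M f -> test_function f.
Proof.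
move=> Cf bf; split => //.
apply: (subclosed_compact _ (@compact_rVbox R n M)); first exact: closed_closure.
rewrite [X in _ `<=` X]((closure_id _).1 (@closed_rVbox R n M)).
apply: closure_subset => y /= fy; apply: contrapT => /(boxed_notin bf) fy0.
by move: fy; rewrite fy0 eqxx.
Qed.

End flat_coord.

(** * Density of C^1 functions in H^1 *)

Section integrable_real.
Context d (T : measurableType d) (R : realType) (mu : {measure set T -> \bar R}).
Implicit Types f g : T -> R.

Lemma integrable_fD f g :
  mu.-integrable setT (EFin \o f) -> mu.-integrable setT (EFin \o g) ->
  mu.-integrable setT (EFin \o (fun x => f x + g x)).
Proof.
move=> iF iG; rewrite (_ : EFin \o _ = ((EFin \o f) \+ (EFin \o g))%E)//.
exact: integrableD.
Qed.

Lemma integrable_fB f g :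
  mu.-integrable setT (EFin \o f) -> mu.-integrable setT (EFin \o g) ->
  mu.-integrable setT (EFin \o (fun x => f x - g x)).
Proof.
move=> iF iG; rewrite (_ : EFin \o _ = ((EFin \o f) \- (EFin \o g))%E)//.
exact: integrableB.
Qed.

Lemma integrable_fZl c f : mu.-integrable setT (EFin \o f) ->
  mu.-integrable setT (EFin \o (fun x => c * f x)).
Proof.
move=> iF; rewrite (_ : EFin \o _ = (fun x => (c%:E * (f x)%:E)%E))//.
exact: integrableZl.
Qed.

Lemma EFin_Rintegral f : mu.-integrable setT (EFin \o f) ->
  (\int[mu]_x (f x)%:E)%E = (\int[mu]_x f x)%:E.
Proof. by move=> iF; rewrite /Rintegral fineK//; exact: integrable_fin_num iF. Qed.

Lemma integrable_fle f g : measurable_fun setT f ->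
  (forall x, `|f x| <= g x) -> mu.-integrable setT (EFin \o g) ->
  mu.-integrable setT (EFin \o f).
Proof.
move=> mf fg; apply: le_integrable => //; first exact/measurable_EFinP.
by move=> x _ /=; rewrite lee_fin (le_trans (fg x))// ler_norm.
Qed.

End integrable_real.

Lemma sqr_le2 {R : realType} (c a b : R) : `|c| <= `|a| + `|b| ->
  c ^+ 2 <= 2 * a ^+ 2 + 2 * b ^+ 2.
Proof.
move=> h; rewrite -(real_normK (num_real c)) -(real_normK (num_real a))
  -(real_normK (num_real b)).
have a0 := normr_ge0 a; have b0 := normr_ge0 b; have c0 := normr_ge0 c.
have h3 : `|c| ^+ 2 <= (`|a| + `|b|) ^+ 2 by rewrite ler_sqr ?nnegrE ?addr_ge0.
have h4 : 0 <= (`|a| - `|b|) ^+ 2 by rewrite sqr_ge0.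
by apply: (le_trans h3); lra.
Qed.

Lemma cvge0_near_le {R : realType} (u : (\bar R)^nat) (e : R) : 0 < e ->
  u @ \oo --> 0%E -> \forall k \near \oo, (u k <= e%:E)%E.
Proof.
move=> e0 /fine_cvgP[fin /cvgrPdist_le/(_ e e0)].
apply: filterS2 fin => k uk; rewrite sub0r normrN /= => h.
by rewrite -(fineK uk) lee_fin (le_trans (ler_norm _)).
Qed.

Section sqdist.
Context d (T : measurableType d) {R : realType} (mu : {measure set T -> \bar R}).
Implicit Types (D : set T) (f g h : T -> R).
Local Open Scope ereal_scope.

(** The squared L^2 distance as an extended real, so that no integrability has to be carried along.
    The price is a factor 2 on each term of the triangle inequality. *)
Definition sqdist D f g : \bar R := \int[mu]_(x in D) ((f x - g x) ^+ 2)%:E.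

Lemma sqdist_ge0 D f g : 0 <= sqdist D f g.
Proof. by apply: integral_ge0 => x _; rewrite lee_fin sqr_ge0. Qed.

Lemma sqdistC D f g : sqdist D f g = sqdist D g f.
Proof. by apply: eq_integral => x _; congr EFin; ring. Qed.

Lemma measurable_sqdiff D f g : measurable_fun D f -> measurable_fun D g ->
  measurable_fun D (fun x => ((f x - g x) ^+ 2)%:E).
Proof.
move=> mf mg; apply/measurable_EFinP; apply: measurable_funX.
exact: measurable_funB.
Qed.

Lemma le_sqdist2 D f g f1 g1 f2 g2 : measurable D ->
  measurable_fun D f -> measurable_fun D g ->
  measurable_fun D f1 -> measurable_fun D g1 ->
  measurable_fun D f2 -> measurable_fun D g2 ->
  (forall x, D x ->
    `|f x - g x| <= `|f1 x - g1 x| + `|f2 x - g2 x|)%R ->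
  sqdist D f g <= 2%:E * sqdist D f1 g1 + 2%:E * sqdist D f2 g2.
Proof.
move=> mD mf mg mf1 mg1 mf2 mg2 H.
have m1 := measurable_sqdiff mf1 mg1; have m2 := measurable_sqdiff mf2 mg2.
have p (a b : T -> R) x : 0 <= ((a x - b x) ^+ 2)%:E by rewrite lee_fin sqr_ge0.
rewrite -!ge0_integralZl// -ge0_integralD//; last 4 first.
- by move=> x _; rewrite mule_ge0.
- exact: measurable_funeM.
- by move=> x _; rewrite mule_ge0.
- exact: measurable_funeM.
apply: ge0_le_integral => //.
- exact: measurable_sqdiff.
- by apply: emeasurable_funD; exact: measurable_funeM.
move=> x Dx; rewrite lee_fin.
exact: sqr_le2 (H x Dx).
Qed.

Lemma sqdist_triangle D f g h : measurable D ->
  measurable_fun D f -> measurable_fun D g -> measurable_fun D h ->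
  sqdist D f h <= 2%:E * sqdist D f g + 2%:E * sqdist D g h.
Proof.
move=> mD mf mg mh; apply: le_sqdist2 => // x _.
by rewrite (_ : (f x - h x = (f x - g x) + (g x - h x))%R) ?ler_normD//; ring.
Qed.

Lemma le_sqdist D f g f1 g1 : measurable D ->
  measurable_fun D f -> measurable_fun D g ->
  measurable_fun D f1 -> measurable_fun D g1 ->
  (forall x, D x -> `|f x - g x| <= `|f1 x - g1 x|)%R ->
  sqdist D f g <= sqdist D f1 g1.
Proof.
move=> mD mf mg mf1 mg1 H; apply: ge0_le_integral => //.
- by move=> x _; rewrite lee_fin sqr_ge0.
- exact: measurable_sqdiff.
- exact: measurable_sqdiff.
- move=> x Dx; rewrite lee_fin -real_normK ?num_real//.
  rewrite -[leRHS]real_normK ?num_real// ler_sqr ?nnegrE//.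
  exact: H.
Qed.

Lemma sqdistZ D c f g : measurable D -> measurable_fun D f -> measurable_fun D g ->
  sqdist D (fun x => c * f x)%R (fun x => c * g x)%R = (c ^+ 2)%:E * sqdist D f g.
Proof.
move=> mD mf mg; rewrite /sqdist -ge0_integralZl//.
- by apply: eq_integral => x _; rewrite -EFinM; congr EFin; ring.
- exact: measurable_sqdiff.
- by move=> x _; rewrite lee_fin sqr_ge0.
- by rewrite lee_fin sqr_ge0.
Qed.

Lemma sqdist_cvg0 D (f : (T -> R)^nat) g G : measurable D ->
  (forall k, measurable_fun D (f k)) -> measurable_fun D g ->
  (forall x, D x -> f k x @[k --> \oo] --> g x) ->
  mu.-integrable D (EFin \o G) ->
  (forall k x, D x -> (f k x - g x) ^+ 2 <= G x)%R ->
  sqdist D (f k) g @[k --> \oo] --> 0.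
Proof.
move=> mD mf mg fg iG fG.
have [] := @dominated_convergence _ _ _ mu D mD
  (fun k x => ((f k x - g x) ^+ 2)%:E) (cst 0) (EFin \o G).
- by move=> k; exact: measurable_sqdiff.
- exact: measurable_cst.
- apply: aeW => x Dx; apply: cvg_EFin; first exact: nearW.
  have h : (f k x - g x)%R @[k --> \oo] --> (0 : R)%R.
    by rewrite -(subrr (g x)); apply: cvgB; [exact: fg|exact: cvg_cst].
  have := cvg_comp _ _ h (@exprn_continuous R 2 0%R).
  by rewrite expr0n.
- exact: iG.
- apply: aeW => x k Dx; rewrite gee0_abs ?lee_fin ?sqr_ge0//; exact: fG.
move=> _ _; rewrite integral0 => H; exact: H.
Qed.

End sqdist.

(** * Continuous functions are dense in L^2 of a finite measure *)

Section density.
Context {R : realType} {n : nat} (mu : {measure set 'rV[R]_n -> \bar R}).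
Variable D : set 'rV[R]_n.
Hypothesis mD : measurable D.
Hypothesis Dfin : (mu D < +oo)%E.
Implicit Types (f g h : 'rV[R]_n -> R) (A B : set 'rV[R]_n).

Let integrable_cstD (c : R) : mu.-integrable D (EFin \o cst c).
Proof.
apply: measurable_bounded_integrable => //; exists `|c|; split => //.
by move=> M cM x _; exact: ltW.
Qed.

Let mT f : measurable_fun setT f -> measurable_fun D f.
Proof. exact: measurable_funTS. Qed.

(** Such sets will be shown to form a sigma-algebra. The bound [0 <= h x <= 1] is part of the
    definition because intersections are approximated by products of the approximants. *)
Definition capprox_set A := measurable A /\ forall e : R, 0 < e ->
  exists h, [/\ continuous h, forall x, 0 <= h x <= 1 &
    (sqdist mu D (\1_A) h <= e%:E)%E].

Lemma capprox_setC A : capprox_set A -> capprox_set (~` A).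
Proof.
move=> [mA H]; split; first exact: measurableC.
move=> e /H[h [ch h01 he]]; exists (fun x => 1 + (-1) * h x); split.
- apply: continuous_fD; first exact: cst_continuous.
  by apply: continuous_fM => //; exact: cst_continuous.
- by move=> x; have /andP[] := h01 x; lra.
- rewrite (_ : sqdist _ _ _ _ = sqdist mu D (\1_A) h)//.
  apply: eq_integral => x _; congr EFin; rewrite !indicE in_setC.
  by case: (x \in A) => /=; ring.
Qed.

Lemma capprox_setI A B : capprox_set A -> capprox_set B -> capprox_set (A `&` B).
Proof.
move=> [mA HA] [mB HB]; split; first exact: measurableI.
move=> e e0; have e4 : 0 < e / 4 by rewrite divr_gt0.
have [h [ch h01 he]] := HA _ e4; have [k [ck k01 ke]] := HB _ e4.
exists (fun x => h x * k x); split.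
- exact: continuous_fM.
- move=> x; have /andP[h0 h1] := h01 x; have /andP[k0 k1] := k01 x.
  by rewrite mulr_ge0// mulr_ile1.
have mh := continuous_measurable_rV ch; have mk := continuous_measurable_rV ck.
apply: (@le_trans _ _ (2%:E * sqdist mu D (\1_A) h + 2%:E * sqdist mu D (\1_B) k)%E).
  apply: le_sqdist2 => //; try exact: mT.
  - apply: mT; apply: measurable_indic; exact: measurableI.
  - by apply: mT; exact: measurable_funM.
  move=> x _; rewrite !indicE in_setI.
  have /andP[h0 h1] := h01 x; have /andP[k0 k1] := k01 x.
  have -> : ((x \in A) && (x \in B))%:R - h x * k x =
      (x \in A)%:R * ((x \in B)%:R - k x) + k x * ((x \in A)%:R - h x) :> R.
    by case: (x \in A); case: (x \in B) => /=; ring.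
  rewrite (le_trans (ler_normD _ _))// addrC !normrM lerD//.
    by rewrite ler_piMl// ger0_norm.
  by rewrite ler_piMl// ger0_norm//; case: (x \in A).
apply: (@le_trans _ _ (2%:E * (e / 4)%:E + 2%:E * (e / 4)%:E)%E).
  by apply: leeD; apply: lee_pmul => //; exact: sqdist_ge0.
by rewrite -!EFinM -EFinD lee_fin; lra.
Qed.

Lemma capprox_set_lim (A : (set 'rV[R]_n)^nat) B : measurable B ->
  (forall k, capprox_set (A k)) ->
  (forall x, (\1_(A k) x : R) @[k --> \oo] --> (\1_B x : R)) -> capprox_set B.
Proof.
move=> mB HA AB; split => // e e0; have e4 : 0 < e / 4 by rewrite divr_gt0.
have mA k : measurable (A k) by case: (HA k).
have : sqdist mu D (\1_(A k)) (\1_B) @[k --> \oo] --> 0%E.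
  apply: (@sqdist_cvg0 _ _ _ _ _ _ _ (cst 1)) => //.
  by move=> k x _; rewrite !indicE; case: (_ \in _); case: (_ \in _) => /=; lra.
move=> /(cvge0_near_le e4)[k _ /(_ k (leqnn k)) Hk].
have [_ /(_ _ e4)[h [ch h01 he]]] := HA k; exists h; split => //.
apply: (le_trans (sqdist_triangle mu mD (g := \1_(A k)) _ _ _)).
- by apply: mT; exact: measurable_indic.
- by apply: mT; exact: measurable_indic.
- by apply: mT; exact: continuous_measurable_rV.
apply: (@le_trans _ _ (2%:E * (e / 4)%:E + 2%:E * (e / 4)%:E)%E).
  by rewrite sqdistC; apply: leeD; apply: lee_pmul => //; exact: sqdist_ge0.
by rewrite -!EFinM -EFinD lee_fin; lra.
Qed.

Lemma capprox_set0 : capprox_set set0.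
Proof.
split=> // e e0; exists (fun=> 0); split; first exact: cst_continuous.
  by move=> x; rewrite lexx ler01.
rewrite /sqdist (eq_integral (cst 0%E)) ?integral0 ?lee_fin ?ltW//.
by move=> x _; rewrite indic0 subr0 expr0n.
Qed.

Lemma capprox_bigcup (A : (set 'rV[R]_n)^nat) :
  (forall k, capprox_set (A k)) -> capprox_set (\bigcup_k A k).
Proof.
move=> HA.
have HU k : capprox_set (\big[setU/set0]_(i < k) A i).
  elim: k => [|k IHk]; first by rewrite big_ord0; exact: capprox_set0.
  rewrite big_ord_recr/= -[X in capprox_set X]setCK setCU.
  by apply: capprox_setC; apply: capprox_setI; exact: capprox_setC.
apply: (capprox_set_lim _ HU).
  by apply: bigcup_measurable => k _; case: (HA k).
move=> x; have [[k _ Ak]|nA] := pselect ((\bigcup_k A k) x).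
  apply: cvg_near_cst; exists k.+1 => // m /= km.
  rewrite !indicE !mem_set//; first by exists k.
  by rewrite -bigcup_mkord; exists k.
rewrite (_ : (fun k => _) = cst (\1_(\bigcup_k A k) x)); first exact: cvg_cst.
apply/funext => k; rewrite !indicE !memNset//.
by rewrite -bigcup_mkord => -[i _ Ai]; apply: nA; exists i.
Qed.

(** Piecewise linear ramps of slope k converge pointwise to the indicator of the open ray and stay
    in [0, 1]. *)
Lemma capprox_ray (i : 'I_n) (a : R) :
  capprox_set ((fun x : 'rV[R]_n => x ord0 i) @^-1` `]a, +oo[).
Proof.
set A := _ @^-1` _.
have mA : measurable A.
  by rewrite -[A]setTI; apply: measurable_coord.
split => // e e0.
pose h k (x : 'rV[R]_n) : R := Num.min 1 (Num.max 0 (k%:R * (x ord0 i - a))).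
have ch k : continuous (h k).
  have c1 : continuous (fun x : 'rV[R]_n => k%:R * (x ord0 i - a) : R).
    apply: continuous_fM; first exact: cst_continuous.
    by apply: continuous_fD; [exact: coord_continuous|exact: cst_continuous].
  have c2 : continuous (fun x : 'rV[R]_n => Num.max 0 (k%:R * (x ord0 i - a)) : R).
    by move=> x; exact: (continuous_max (@cst_continuous _ _ 0 x) (c1 x)).
  by rewrite /h => x; have := @continuous_min R _ (fun=> 1 : R) _ x (@cst_continuous _ _ (1 : R) x) (c2 x).
have h01 k x : 0 <= h k x <= 1.
  by rewrite /h le_min ler01 le_max lexx ge_min lexx.
have : sqdist mu D (h k) (\1_A) @[k --> \oo] --> 0%E.
  apply: (@sqdist_cvg0 _ _ _ _ _ _ _ (cst 1)) => //.
  - by move=> k; apply: mT; exact: continuous_measurable_rV.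
  - move=> x _; have [xa|ax] := leP (x ord0 i) a.
      rewrite (_ : (fun k => _) = cst 0).
        by rewrite indicE memNset; [exact: cvg_cst|rewrite /A /= in_itv/= andbT ltNge xa].
      apply/funext => k; rewrite /h max_l ?min_r//.
      by rewrite mulr_ge0_le0// subr_le0.
    rewrite indicE mem_set; last by rewrite /A /= in_itv/= andbT.
    apply: cvg_near_cst; near=> k; rewrite /h min_l// le_max; apply/orP; right.
    rewrite -ler_pdivrMr ?subr_gt0//; near: k; exact: nbhs_infty_ger.
  - move=> k x _; have /andP[h0 h1] := h01 k x; rewrite indicE.
    by case: (x \in A) => /=; rewrite ?subr0; [nra|nra].
move=> /(cvge0_near_le e0)[k _ /(_ k (leqnn k)) Hk].
by exists (h k); rewrite sqdistC; split.
Unshelve. all: by end_near. Qed.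

(** Generators are used twice: sets defined by one coordinate generate the sigma-algebra of R^n, and
    for a fixed coordinate open rays generate that of R. *)
Lemma capprox_measurable A : measurable A -> capprox_set A.
Proof.
move: A; suff : (measurable : set (set 'rV[R]_n)) `<=` capprox_set by [].
have sC : sigma_algebra setT capprox_set.
  split => [|A|]; first exact: capprox_set0.
    by rewrite setTD; exact: capprox_setC.
  exact: capprox_bigcup.
apply: smallest_sub => //.
rewrite -bigcup_seq => A [i _ [B mB <-]] /=; rewrite setTI.
move: B mB; suff : (measurable : set (set R)) `<=`
    [set B | capprox_set ((fun x : 'rV[R]_n => x ord0 i) @^-1` B)] by apply.
rewrite (_ : measurable = (@RGenOInfty.G R).-sigma.-measurable :> set (set R));
  last exact: RGenOInfty.measurableE.
apply: smallest_sub.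
  split => /= [|B|F].
  - by rewrite preimage_set0; exact: capprox_set0.
  - by rewrite setTD preimage_setC; exact: capprox_setC.
  - by rewrite preimage_bigcup; exact: capprox_bigcup.
by move=> _ [a ->]; exact: capprox_ray.
Qed.

End density.

Section density_fun.
Context {R : realType} {n : nat} (mu : {measure set 'rV[R]_n -> \bar R}).
Variable D : set 'rV[R]_n.
Hypothesis mD : measurable D.
Hypothesis Dfin : (mu D < +oo)%E.
Implicit Types (f g h : 'rV[R]_n -> R).

Let mT f : measurable_fun setT f -> measurable_fun D f.
Proof. exact: measurable_funTS. Qed.

Let mc h : continuous h -> measurable_fun D h.
Proof. by move=> ch; apply: mT; exact: continuous_measurable_rV. Qed.

Definition capprox f := measurable_fun setT f /\ forall e : R, 0 < e ->
  exists2 h, continuous h & (sqdist mu D f h <= e%:E)%E.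

Let half2 (a b : \bar R) (e : R) : (0 <= a)%E -> (0 <= b)%E ->
  (a <= (e / 4)%:E)%E -> (b <= (e / 4)%:E)%E ->
  (2%:E * a + 2%:E * b <= e%:E)%E.
Proof.
move=> a0 b0 ae be.
apply: (@le_trans _ _ (2%:E * (e / 4)%:E + 2%:E * (e / 4)%:E)%E).
  by apply: leeD; apply: lee_pmul.
by rewrite -!EFinM -EFinD lee_fin; lra.
Qed.

Lemma capprox_lim (f : ('rV[R]_n -> R)^nat) g : measurable_fun setT g ->
  (forall k, capprox (f k)) -> sqdist mu D (f k) g @[k --> \oo] --> 0%E ->
  capprox g.
Proof.
move=> mg Hf fg; split => // e e0; have e4 : 0 < e / 4 by rewrite divr_gt0.
have [k _ /(_ k (leqnn k)) Hk] := cvge0_near_le e4 fg.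
have [mf /(_ _ e4)[h ch he]] := Hf k; exists h => //.
apply: (le_trans (sqdist_triangle mu mD (g := f k) _ _ _)); [exact: mT..|exact: mc|].
by apply: half2; rewrite ?sqdist_ge0// sqdistC.
Qed.

Lemma capproxD f g : capprox f -> capprox g -> capprox (fun x => f x + g x).
Proof.
move=> [mf Hf] [mg Hg]; split; first exact: measurable_funD.
move=> e e0; have e4 : 0 < e / 4 by rewrite divr_gt0.
have [h ch he] := Hf _ e4; have [k ck ke] := Hg _ e4.
exists (fun x => h x + k x); first exact: continuous_fD.
apply: (@le_trans _ _ (2%:E * sqdist mu D f h + 2%:E * sqdist mu D g k)%E).
  apply: le_sqdist2 => //; try exact: mT; try exact: mc.
  - by apply: mT; exact: measurable_funD.
  - by apply: mc; exact: continuous_fD.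
  - move=> x _; rewrite (_ : f x + g x - _ = (f x - h x) + (g x - k x)); last ring.
    exact: ler_normD.
by apply: half2; rewrite ?sqdist_ge0.
Qed.

Lemma capproxZ c f : capprox f -> capprox (fun x => c * f x).
Proof.
move=> [mf Hf]; split; first exact: measurable_funM.
move=> e e0; have c2 : 0 < c ^+ 2 + 1 by rewrite ltr_wpDl// sqr_ge0.
have [h ch he] := Hf _ (divr_gt0 e0 c2).
exists (fun x => c * h x).
  by apply: continuous_fM => //; exact: cst_continuous.
rewrite sqdistZ//; [|exact: mT|exact: mc].
apply: (@le_trans _ _ ((c ^+ 2)%:E * (e / (c ^+ 2 + 1))%:E)%E).
  by apply: lee_pmul => //; [rewrite lee_fin sqr_ge0|exact: sqdist_ge0].
rewrite -EFinM lee_fin mulrCA ler_piMr//; first exact: ltW.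
by rewrite ler_pdivrMr// mul1r lerDl.
Qed.

Lemma capprox_indic A : measurable A -> capprox (\1_A).
Proof.
move=> mA; split; first exact: measurable_indic.
by move=> e /(capprox_measurable mD Dfin mA).2[h [ch _ he]]; exists h.
Qed.

Lemma capprox_sum (I : Type) (s : seq I) (F : I -> 'rV[R]_n -> R) :
  (forall i, capprox (F i)) -> capprox (fun x => \sum_(i <- s) F i x).
Proof.
move=> HF; elim: s => [|i s IHs].
  rewrite (_ : (fun x => _) = \1_set0); first exact: capprox_indic.
  by apply/funext => x; rewrite big_nil indic0.
rewrite (_ : (fun x => _) = fun x => F i x + \sum_(i <- s) F i x).
  exact: capproxD.
by apply/funext => x; rewrite big_cons.
Qed.

Import HBNNSimple.

Lemma capprox_nnsfun (f : {nnsfun 'rV[R]_n >-> R}) : capprox f.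
Proof.
rewrite (_ : (f : _ -> R) = fun x =>
   \sum_(y <- finmap.enum_fset (fset_set (range f))) y * \1_(f @^-1` [set y]) x).
  by apply: capprox_sum => y; apply: capproxZ; exact: capprox_indic.
by apply/funext => x; rewrite fimfunE fsbig_finite.
Qed.

(** Simple functions increase to f, and the square of the gap is dominated by the integrable f^2. *)
Lemma capprox_ge0 f : measurable_fun setT f -> (forall x, 0 <= f x) ->
  mu.-integrable D (EFin \o (fun x => f x ^+ 2)) -> capprox f.
Proof.
move=> mf f0 if2.
have mef : measurable_fun setT (EFin \o f) by exact/measurable_EFinP.
pose F k : 'rV[R]_n -> R := nnsfun_approx measurableT mef k.
have Fcvg x : F k x @[k --> \oo] --> f x.
  have h : (F k x)%:E @[k --> \oo] --> (f x)%:E.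
    by apply: (cvg_nnsfun_approx measurableT mef) => // y _; rewrite lee_fin.
  by apply: (fine_cvg h).
have Fle k x : F k x <= f x.
  rewrite -(cvg_lim _ (Fcvg x))//; apply: nondecreasing_cvgn_le.
    by move=> a b ab; have /lefP := nd_nnsfun_approx measurableT mef ab; apply.
  by apply/cvg_ex; exists (f x); exact: Fcvg.
have F0 k x : 0 <= F k x by rewrite /F.
apply: (@capprox_lim F) => //; first by move=> k; exact: capprox_nnsfun.
apply: (@sqdist_cvg0 _ _ _ _ _ _ _ (fun x => f x ^+ 2)) => //.
- by move=> k; apply: mT; apply: (capprox_nnsfun _).1.
- exact: mT.
- move=> k x _; have := Fle k x; have := F0 k x; have := f0 x.
  by move=> *; nra.
Qed.

Lemma capprox_sqr_integrable f : measurable_fun setT f ->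
  mu.-integrable D (EFin \o (fun x => f x ^+ 2)) -> capprox f.
Proof.
move=> mf if2.
have mn : measurable_fun setT (fun x => `|f x|) by exact: measurableT_comp.
have P : capprox (fun x => `|f x| + f x).
  apply: capprox_ge0; first exact: measurable_funD.
    by move=> x; rewrite addrC -lerBlDr sub0r lerNl ler_normr lexx orbT.
  apply: (@le_integrable _ _ _ mu D mD _ (fun x => (4 * f x ^+ 2)%:E)).
  - apply/measurable_EFinP; apply: measurable_funX; apply: mT.
    exact: measurable_funD.
  - move=> x _; rewrite /= lee_fin; apply: le_trans (ler_norm _).
    rewrite ger0_norm ?sqr_ge0//; apply: (le_trans (sqr_le2 (a := f x) (b := f x) _)).
      by rewrite (le_trans (ler_normD _ _))// normr_id.
    lra.
  - by under eq_fun do rewrite EFinM; exact: integrableZl.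
have Q : capprox (fun x => `|f x|).
  apply: capprox_ge0 => //.
  by under eq_fun do rewrite /= real_normK ?num_real//.
have := capproxD P (capproxZ (-1) Q).
by rewrite (_ : (fun x => _) = f)//; apply/funext => x; ring.
Qed.

End density_fun.

(** An approximant on the cube of radius M + 1 is multiplied by a continuous [chi] that is 1 on the
    cube of radius M and vanishes outside the larger one. Since [f = chi * f] and [0 <= chi <= 1],
    this does not increase the distance. *)
Lemma capprox_boxed {R : realType} n (M : R) (f : 'rV[R]_n -> R) :
  0 <= M -> measurable_fun setT f -> boxed M f ->
  (lebesgue_rV n).-integrable setT (EFin \o (fun x => f x ^+ 2)) ->
  forall e : R, 0 < e -> exists h, [/\ continuous h, boxed (M + 1) h &
    (sqdist (lebesgue_rV n) setT f h <= e%:E)%E].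
Proof.
move=> M0 mf bf if2 e e0.
pose D : set 'rV[R]_n := rVbox (M + 1).
have mD : measurable D by exact: measurable_rVbox.
have iD := integrableS measurableT mD (@subsetT _ D) if2.
have [_ /(_ e e0)[h ch he]] := capprox_sqr_integrable mD (lebesgue_rVbox_fin _) mf iD.
pose chi (x : 'rV[R]_n) : R := Num.min 1 (Num.max 0 (M + 1 - `|x|)).
have cchi : continuous chi.
  have c1 : continuous (fun x : 'rV[R]_n => M + 1 - `|x| : R).
    move=> x; exact: (@cvgB _ _ _ _ (nbhs_filter x) _ _ _ _
      (@cst_continuous _ _ (M + 1) x) (@norm_continuous _ _ x)).
  have c2 : continuous (fun x : 'rV[R]_n => Num.max 0 (M + 1 - `|x|) : R).
    by move=> x; exact: (continuous_max (@cst_continuous _ _ 0 x) (c1 x)).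
  by rewrite /chi => x; have := @continuous_min R _ (fun=> 1 : R) _ x (@cst_continuous _ _ (1 : R) x) (c2 x).
have chi01 x : 0 <= chi x <= 1 by rewrite /chi le_min ler01 le_max lexx ge_min lexx.
have coordle (x : 'rV[R]_n) i : `|x ord0 i| <= `|x|.
  rewrite [leRHS]/Num.norm /= mx_normrE; apply/bigmax_geP; right => /=.
  by exists (ord0, i).
have chib : boxed (M + 1) chi.
  move=> x i Mx; rewrite /chi max_l ?min_r//.
  by rewrite subr_le0 (le_trans (ltW Mx)).
have chif x : f x = chi x * f x.
  have [xM|/(boxed_notin bf) ->] := pselect (rVbox M x); last by rewrite mulr0.
  rewrite /chi min_l ?mul1r// le_max; apply/orP; right.
  rewrite lerBrDr addrC -lerBrDr addrK.
  by rewrite [leLHS]/Num.norm /= mx_normrE; apply/bigmax_leP; split => // -[a b] _ /=; rewrite (ord1 a).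
exists (fun x => chi x * h x); split; first exact: continuous_fM.
  by move=> x i /chib ->; rewrite mul0r.
apply: le_trans he.
have mh := continuous_measurable_rV ch.
have mch : measurable_fun setT (fun x => chi x * h x).
  by apply: measurable_funM => //; exact: continuous_measurable_rV.
apply: (@le_trans _ _ (sqdist (lebesgue_rV n) D f (fun x => chi x * h x))).
  rewrite /sqdist [leRHS]integral_mkcond.
  rewrite le_eqVlt; apply/orP; left; apply/eqP; apply: eq_integral => x _.
  rewrite patchE; case: ifPn => //; rewrite notin_setE => xD.
  by rewrite chif (boxed_notin chib xD) !mul0r subr0 expr0n.
apply: le_sqdist => //; try exact: measurable_funTS.
move=> x _; rewrite {1}chif -mulrBr normrM ler_piMl//.
by have /andP[c0 c1] := chi01 x; rewrite ger0_norm.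
Qed.

(** Dominated convergence is about sequences; this turns it into the continuity of convolutions. *)
Lemma continuous_seqP {R : realType} n (f : 'rV[R]_n -> R) (x : 'rV[R]_n) :
  (forall u : nat -> 'rV[R]_n, u @ \oo --> x -> f (u k) @[k --> \oo] --> f x) ->
  {for x, continuous f}.
Proof.
move=> H; apply/(@cvgrPdist_lt _ _ _ _ (nbhs_filter x)) => e e0; apply: contrapT => nE.
have P (k : nat) : exists y, ball x k.+1%:R^-1 y /\ ~ (`|f x - f y| < e).
  apply: contrapT => /forallNP nP; apply: nE.
  apply/nbhs_ballP; exists k.+1%:R^-1 => /=; first by rewrite invr_gt0.
  by move=> y yk; apply: contrapT => fe; apply: (nP y).
have [u Hu] := choice P.
have ux : u @ \oo --> x.
  apply/cvg_ballP => d d0; near=> k.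
  apply: (le_ball _ (Hu k).1); rewrite ltW//.
  by near: k; exact: near_infty_natSinv_lt (PosNum d0).
have /cvgrPdist_lt/(_ e e0)[k _ /(_ k (leqnn k))] := H u ux.
exact: (Hu k).2.
Unshelve. all: by end_near. Qed.

(** * Convolution and mollification *)

Section conv.
Context {R : realType} {n : nat}.
Notation leb := (@lebesgue_rV R n).
Implicit Types (H K phi : 'rV[R]_n -> R) (x y : 'rV[R]_n) (C M r : R).

(** The kernel is taken at [y - x] so that, as a function of y, it is a translate that can enter a
    test function. For the even kernel [cutoff] this is the usual convolution; differentiation in x
    produces a minus sign. *)
Definition conv H phi x : R := \int[leb]_y (H y * phi (y - x)).

Lemma continuous_subr phi x : continuous phi -> continuous (fun y => phi (y - x)).
Proof.
have cs : continuous (fun y : 'rV[R]_n => y - x).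
  apply: continuous_rV => i.
  rewrite (_ : (fun y => _) = fun y : 'rV[R]_n => y ord0 i + - x ord0 i).
    by apply: continuous_fD; [exact: coord_continuous|exact: cst_continuous].
  by apply/funext => y; rewrite !mxE.
by move=> cp y; exact: (cvg_comp _ _ (cs y) (cp (y - x))).
Qed.

Lemma measurable_subr phi x : continuous phi -> measurable_fun setT (fun y => phi (y - x)).
Proof. by move=> cp; apply: continuous_measurable_rV; exact: continuous_subr. Qed.

Lemma integrable_mul_bounded H phi C : leb.-integrable setT (EFin \o H) ->
  measurable_fun setT phi -> (forall y, `|phi y| <= C) ->
  leb.-integrable setT (fun y => (H y * phi y)%:E).
Proof.
move=> iH mphi hC.
have mH : measurable_fun setT H by apply/measurable_EFinP; exact: measurable_int iH.
apply: (@le_integrable _ _ _ leb setT measurableT _ (fun y => C%:E * (H y)%:E)%E).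
- by apply/measurable_EFinP; exact: measurable_funM.
- move=> y _; rewrite -EFinM /= lee_fin !normrM mulrC ler_wpM2r//.
  exact: le_trans (hC y) (ler_norm _).
- exact: integrableZl.
Qed.

Lemma integrable_conv H phi C x : leb.-integrable setT (EFin \o H) ->
  continuous phi -> (forall y, `|phi y| <= C) ->
  leb.-integrable setT (fun y => (H y * phi (y - x))%:E).
Proof.
move=> iH cphi hC; apply: integrable_mul_bounded => //; exact: measurable_subr.
Qed.

Lemma continuous_conv H phi C : leb.-integrable setT (EFin \o H) ->
  continuous phi -> (forall y, `|phi y| <= C) -> continuous (conv H phi).
Proof.
move=> iH cphi hC x; apply: continuous_seqP => u ux.
have mH : measurable_fun setT H by apply/measurable_EFinP; exact: measurable_int iH.
have [] := @dominated_convergence _ _ _ leb setT measurableT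
  (fun k y => (H y * phi (y - u k))%:E) (fun y => (H y * phi (y - x))%:E)
  (fun y => C%:E * `|(H y)%:E|)%E.
- move=> k; apply/measurable_EFinP; apply: measurable_funM => //.
  exact: measurable_subr.
- apply/measurable_EFinP; apply: measurable_funM => //.
  exact: measurable_subr.
- apply: aeW => y _; apply: cvg_EFin; first exact: nearW.
  apply: cvgM; first exact: cvg_cst.
  have yux : (y - u k) @[k --> \oo] --> y - x.
    exact: (@cvgB _ _ _ \oo _ _ _ _ _ (@cvg_cst _ y _ \oo _) ux).
  exact: (cvg_comp _ _ yux (cphi (y - x))).
- by apply: integrableZl => //; exact: integrable_abse.
- apply: aeW => y k _; rewrite /= lee_fin normrM mulrC ler_wpM2r//.
move=> _ _ h; apply: fine_cvg; rewrite /conv /Rintegral fineK; first exact: h.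
by apply: integrable_fin_num => //; exact: integrable_conv hC.
Qed.

Lemma derivable_conv H phi C i x : leb.-integrable setT (EFin \o H) ->
  continuous phi -> (forall y, `|phi y| <= C) ->
  (forall y, derivable phi y (delta_mx ord0 i)) ->
  continuous (partial i phi) -> (forall y, `|partial i phi y| <= C) ->
  derivable (conv H phi) x (delta_mx ord0 i) /\
  partial i (conv H phi) x = - conv H (partial i phi) x.
Proof.
move=> iH cphi hC dphi cpphi hC'.
apply: derivable_line.
pose e : 'rV[R]_n := delta_mx ord0 i.
pose F (t : R) y := H y * phi (y - (x + t *: e)).
have dF (t : R) y : is_derive t 1 (F ^~ y) (- (H y * partial i phi (y - (x + t *: e)))).
  have E s : y - (x + s *: e) = (y - x) + (- s) *: e.
    by rewrite scaleNr opprD addrA.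
  have dl := is_derive_line (dphi ((y - x) + (- t) *: e)).
  have dn : is_derive t 1 (fun s : R => - s) (- 1) := is_deriveN (is_derive_id t 1).
  have := is_derive_scale (H y) (@is_derive1_comp _ _ (fun s : R => - s) t _ _ dl dn).
  rewrite (_ : F ^~ y = fun s => H y * phi ((y - x) + (- s) *: e)); last first.
    by apply/funext => s; rewrite /F E.
  by rewrite mulrN1 mulrN -E.
have d1F t y : partial1of2 F t y = - (H y * partial i phi (y - (x + t *: e))).
  by rewrite partial1of2E; apply: derive_val.
have o0 : `](-1 : R), (1 : R)[%classic (0 : R) by rewrite /= in_itv/=; lra.
have iF t : leb.-integrable setT (EFin \o F t) by exact: integrable_conv hC.
have iG : leb.-integrable setT (EFin \o (fun y => C * `|H y|)).
  by rewrite /comp; under eq_fun do rewrite EFinM; apply: integrableZl => //; exact: integrable_norm.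
have C0 : 0 <= C by apply: le_trans (hC x); rewrite normr_ge0.
have G0 y : 0 <= C * `|H y| by rewrite mulr_ge0.
have dF' (t : R) y : `](-1 : R), (1 : R)[%classic t -> setT y -> derivable (F^~ y) t 1.
  by move=> _ _; have [] := dF t y.
have bF (t : R) y : `](-1 : R), (1 : R)[%classic t -> setT y -> `|partial1of2 F t y| <= C * `|H y|.
  by move=> _ _; rewrite d1F normrN normrM mulrC ler_wpM2r.
have D1 := derivable_under_integral measurableT o0 (fun t _ => iF t) dF' G0 iG bF.
have D2 := differentiation_under_integral measurableT o0 (fun t _ => iF t) dF' G0 iG bF.
apply: DeriveDef; first exact: D1.
rewrite -derive1E D2 /conv.
under eq_Rintegral do rewrite d1F scale0r addr0 -mulN1r.
rewrite RintegralZl ?mulN1r//; exact: integrable_conv hC'.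
Qed.

Lemma boxed_conv H phi M r : boxed M H -> boxed r phi -> boxed (M + r) (conv H phi).
Proof.
move=> bH bphi x i Mx; rewrite /conv (@eq_Rintegral _ _ _ leb setT (cst 0)) ?Rintegral_cst ?mul0r//.
move=> y _ /=; have [My|yM] := ltP M `|y ord0 i|; first by rewrite (bH y i My) mul0r.
rewrite (bphi (y - x) i) ?mulr0// !mxE.
have := ler_normB (x ord0 i) (y ord0 i).
by have := lerB_dist (x ord0 i) (y ord0 i); rewrite distrC; lra.
Qed.

End conv.

Section moll.
Context {R : realType} {n : nat}.
Notation leb := (@lebesgue_rV R n).
Implicit Types (H K h : 'rV[R]_n -> R) (x y : 'rV[R]_n) (C M r : R).

Lemma continuous_cutoff r : continuous (@cutoff R n r).
Proof. exact: (class_C_continuous (class_C_cutoff0 0 r)). Qed.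

Lemma cutoff_norm_le1 r y : `|cutoff r y| <= 1.
Proof. by rewrite ger0_norm ?cutoff_ge0 ?cutoff_le1. Qed.

Definition cutoff_mass r : R := \int[leb]_y cutoff r y.

Lemma integrable_cutoff r : leb.-integrable setT (EFin \o @cutoff R n r).
Proof. exact: integrable_boxed (@continuous_cutoff r) (@boxed_cutoff R n r). Qed.

Lemma cutoff_massE r : (\int[leb]_y (cutoff r y)%:E = (cutoff_mass r)%:E)%E.
Proof.
rewrite /cutoff_mass /Rintegral fineK//; apply: integrable_fin_num => //.
exact: integrable_cutoff.
Qed.

Lemma cutoff_mass_shift r x :
  (\int[leb]_y (cutoff r (y - x))%:E = (cutoff_mass r)%:E)%E.
Proof.
rewrite -cutoff_massE.
apply: (@ge0_integral_rV_shift R n (- x) (EFin \o cutoff r)).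
  by apply/measurable_EFinP; apply: continuous_measurable_rV; exact: continuous_cutoff.
by move=> y; rewrite lee_fin cutoff_ge0.
Qed.

Lemma cutoff_mass_shiftl r y :
  (\int[leb]_x (cutoff r (y - x))%:E = (cutoff_mass r)%:E)%E.
Proof.
rewrite -(cutoff_mass_shift r y); apply: eq_integral => x _.
by rewrite -cutoffN opprB.
Qed.

(** On the cube of radius r/2 all arguments of [flat 0] are at least r/2, which bounds [cutoff r]
    below by a positive constant on a set of positive measure. *)
Lemma cutoff_mass_gt0 r : 0 < r -> 0 < cutoff_mass r.
Proof.
move=> r0; have r20 : 0 <= r / 2 by rewrite divr_ge0// ltW.
have E1 : 0 < expR (- (2 / r)) :> R by exact: expR_gt0.
pose c : R := \prod_(i < n) (expR (- (2 / r)) * expR (- (2 / r))).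
have c0 : 0 < c by apply: prodr_gt0 => i _; rewrite mulr_gt0.
have v0 : 0 < \prod_(i < n) (r / 2 + r / 2) by apply: prodr_gt0 => i _; lra.
have B y : rVbox (r / 2) y -> c <= cutoff r y.
  move=> hy; apply: ler_prod => i _; rewrite ltW ?mulr_gt0//=.
  have K t : r / 2 <= t -> expR (- (2 / r)) <= flat 0 t.
    move=> rt; have t0 : 0 < t by apply: lt_le_trans rt; rewrite divr_gt0.
    rewrite /flat t0 expr0 mul1r ler_expR lerN2 -[2 / r]invrK lef_pV2 ?posrE ?invr_gt0 ?divr_gt0//.
    by rewrite invf_div.
  have := hy i; rewrite ler_norml => /andP[h1 h2].
  by apply: ler_pM; [exact: ltW|exact: ltW|apply: K; lra|apply: K; lra].
have : ((c * \prod_(i < n) (r / 2 + r / 2))%:E <= (cutoff_mass r)%:E)%E.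
  rewrite -cutoff_massE EFinM -(@lebesgue_rVbox R n _ r20).
  rewrite -(integral_cst leb (@measurable_rVbox R n (r / 2)) c%:E).
  apply: (@le_trans _ _ (\int[leb]_(x in rVbox (r / 2)) (cutoff r x)%:E)%E).
    apply: ge0_le_integral => //.
    - exact: measurable_rVbox.
    - by move=> x _; rewrite lee_fin ltW.
    - apply/measurable_EFinP; apply: measurable_funTS.
      by apply: continuous_measurable_rV; exact: continuous_cutoff.
  apply: ge0_subset_integral => //.
  - exact: measurable_rVbox.
  - apply/measurable_EFinP.
    by apply: continuous_measurable_rV; exact: continuous_cutoff.
  - by move=> x _; rewrite lee_fin cutoff_ge0.
by rewrite lee_fin; apply: lt_le_trans; rewrite mulr_gt0.
Qed.

Definition moll r H x : R := (cutoff_mass r)^-1 * conv H (cutoff r) x.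

Lemma continuous_moll r H : leb.-integrable setT (EFin \o H) -> continuous (moll r H).
Proof.
move=> iH; apply: continuous_fM; first exact: cst_continuous.
apply: (continuous_conv iH); [exact: continuous_cutoff|exact: cutoff_norm_le1].
Qed.

Lemma mollB r H K x : leb.-integrable setT (EFin \o H) ->
  leb.-integrable setT (EFin \o K) ->
  moll r H x - moll r K x = moll r (fun y => H y - K y) x.
Proof.
move=> iH iK; rewrite /moll -mulrBr; congr (_ * _); rewrite /conv -RintegralB//.
- by apply: eq_Rintegral => y _; rewrite mulrBl.
- exact: (integrable_conv x iH (@continuous_cutoff r) (cutoff_norm_le1 r)).
- exact: (integrable_conv x iK (@continuous_cutoff r) (cutoff_norm_le1 r)).
Qed.

(** Jensen's inequality for the normalized kernel, obtained by expanding the nonnegative integral of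
    [(H y - a) ^+ 2] against the kernel, where [a] is the mollified value. *)
Lemma moll_sqr_le r H x : 0 < r -> leb.-integrable setT (EFin \o H) ->
  leb.-integrable setT (EFin \o (fun y => H y ^+ 2)) ->
  (((moll r H x) ^+ 2)%:E <=
   ((cutoff_mass r)^-1)%:E * \int[leb]_y (H y ^+ 2 * cutoff r (y - x))%:E)%E.
Proof.
move=> r0 iH iH2; have c0 := cutoff_mass_gt0 r0.
have cc := @continuous_cutoff r; have c1 := cutoff_norm_le1 r.
have i1 := integrable_conv x iH cc c1; have i2 := integrable_conv x iH2 cc c1.
have i0 : leb.-integrable setT (fun y => (cutoff r (y - x))%:E).
  apply: (@integrable_boxed _ _ (r + \big[Num.max/0]_(i < n) `|x ord0 i|)).
    exact: continuous_subr.
  move=> y i Hy; apply: (@boxed_cutoff R n r _ i); rewrite !mxE.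
  have h1 : `|x ord0 i| <= \big[Num.max/0]_(i < n) `|x ord0 i|.
    by apply/bigmax_geP; right; exists i.
  have := lerB_dist (y ord0 i) (x ord0 i); lra.
set a := moll r H x.
have aE : conv H (cutoff r) x = cutoff_mass r * a by rewrite /a /moll mulrA divff ?mul1r// gt_eqF.
have m0 : \int[leb]_y cutoff r (y - x) = cutoff_mass r.
  by rewrite /Rintegral cutoff_mass_shift.
have P : 0 <= \int[leb]_y ((H y - a) ^+ 2 * cutoff r (y - x)).
  by apply: Rintegral_ge0 => y _; rewrite mulr_ge0 ?sqr_ge0 ?cutoff_ge0.
have E : \int[leb]_y ((H y - a) ^+ 2 * cutoff r (y - x)) =
    \int[leb]_y (H y ^+ 2 * cutoff r (y - x)) - a ^+ 2 * cutoff_mass r.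
  transitivity (\int[leb]_y (H y ^+ 2 * cutoff r (y - x) +
      ((- 2 * a) * (H y * cutoff r (y - x)) + a ^+ 2 * cutoff r (y - x)))).
    by apply: eq_Rintegral => y _; ring.
  have j1 := integrable_fZl (- 2 * a) i1; have j0 := integrable_fZl (a ^+ 2) i0.
  rewrite (RintegralD measurableT i2 (integrable_fD j1 j0)) (RintegralD measurableT j1 j0).
  rewrite (RintegralZl _ measurableT i1) (RintegralZl _ measurableT i0) m0 -/(conv H (cutoff r) x) aE; ring.
rewrite E in P.
have -> : (\int[leb]_y (H y ^+ 2 * cutoff r (y - x))%:E =
    (\int[leb]_y (H y ^+ 2 * cutoff r (y - x)))%:E)%E.
  by rewrite /Rintegral fineK//; exact: integrable_fin_num.
by rewrite -EFinM lee_fin ler_pdivlMl// mulrC; lra.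
Qed.

(** Mollification contracts L^2: after the pointwise Jensen bound, Tonelli's theorem integrates the
    kernel in x first, and its mass does not depend on y. *)
Lemma sqdist_moll r H K : 0 < r -> leb.-integrable setT (EFin \o H) ->
  leb.-integrable setT (EFin \o K) ->
  leb.-integrable setT (EFin \o (fun y => (H y - K y) ^+ 2)) ->
  (sqdist leb setT (moll r H) (moll r K) <= sqdist leb setT H K)%E.
Proof.
move=> r0 iH iK iHK2; have c0 := cutoff_mass_gt0 r0.
pose L y := H y - K y.
have iL : leb.-integrable setT (EFin \o L).
  by rewrite /comp /L; under eq_fun do rewrite EFinB; exact: integrableB.
have mL : measurable_fun setT L by apply/measurable_EFinP; exact: measurable_int iL.
pose F (z : 'rV[R]_n * 'rV[R]_n) : \bar R := (L z.2 ^+ 2 * cutoff r (z.2 - z.1))%:E.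
have mF : measurable_fun setT F.
  apply/measurable_EFinP; apply: measurable_funM.
    apply: measurable_funX; exact: (measurableT_comp mL measurable_snd).
  apply: (measurableT_comp (continuous_measurable_rV (@continuous_cutoff r))).
  apply: measurable_fun_rVP => i.
  rewrite (_ : (fun _ => _) = fun z : 'rV[R]_n * 'rV[R]_n => z.2 ord0 i - z.1 ord0 i).
    apply: measurable_funB.
      exact: (measurableT_comp (measurable_coord i) measurable_snd).
    exact: (measurableT_comp (measurable_coord i) measurable_fst).
  by apply/funext => z; rewrite !mxE.
have F0 z : (0 <= F z)%E by rewrite lee_fin mulr_ge0 ?sqr_ge0 ?cutoff_ge0.
apply: (@le_trans _ _ (\int[leb]_x (((cutoff_mass r)^-1)%:E * \int[leb]_y F (x, y)))%E).
  apply: ge0_le_integral => //.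
  - by move=> x _; rewrite lee_fin sqr_ge0.
  - by apply: measurable_sqdiff; apply: continuous_measurable_rV; exact: continuous_moll.
  - by apply: measurable_funeM; exact: (measurable_fun_fubini_tonelli_F (m2 := leb) F mF F0).
  - by move=> x _; rewrite mollB//; exact: moll_sqr_le.
rewrite ge0_integralZl//; last 3 first.
- exact: (measurable_fun_fubini_tonelli_F (m2 := leb) F mF F0).
- by move=> x _; exact: integral_ge0.
- by rewrite lee_fin invr_ge0 ltW.
rewrite (@fubini_tonelli _ _ _ _ _ leb leb F mF F0).
rewrite (eq_integral (fun y => (cutoff_mass r)%:E * (L y ^+ 2)%:E)%E).
  rewrite ge0_integralZl//.
  - by rewrite muleA -EFinM mulVf ?mul1e// gt_eqF.
  - by apply/measurable_EFinP; exact: measurable_funX.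
  - by move=> x _; rewrite lee_fin sqr_ge0.
  - by rewrite lee_fin ltW.
move=> y _; rewrite muleC -(cutoff_mass_shiftl r y) -ge0_integralZl//.
- apply/measurable_EFinP.
  rewrite (_ : (fun x => _) = fun x => cutoff r (x - y)).
    exact: measurable_subr (@continuous_cutoff r).
  by apply/funext => x; rewrite -cutoffN opprB.
- by move=> *; rewrite lee_fin cutoff_ge0.
- by rewrite lee_fin sqr_ge0.
Qed.

End moll.

Section moll_cvg.
Context {R : realType} {n : nat}.
Notation leb := (@lebesgue_rV R n).
Implicit Types (H K h : 'rV[R]_n -> R) (x y : 'rV[R]_n) (C M r : R).

Lemma integrable_indic_rVbox C M :
  leb.-integrable setT (fun x => (C * \1_(rVbox M) x)%:E).
Proof.
under eq_fun do rewrite EFinM; apply: integrableZl => //.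
apply/integrableP; split.
  by apply/measurable_EFinP; apply: measurable_indic; exact: measurable_rVbox.
under eq_integral do rewrite gee0_abs ?lee_fin//.
rewrite integral_indic//; last exact: measurable_rVbox.
by rewrite setIT; exact: lebesgue_rVbox_fin.
Qed.

Lemma boxed_sqr_integrable M H : measurable_fun setT H -> boxed M H ->
  leb.-integrable setT (EFin \o (fun x => H x ^+ 2)) ->
  leb.-integrable setT (EFin \o H).
Proof.
move=> mH bH iH2.
apply: (@le_integrable _ _ _ leb setT measurableT _
  (fun x => (1 * \1_(rVbox M) x)%:E + (H x ^+ 2)%:E)%E).
- exact/measurable_EFinP.
- move=> x _; rewrite /= lee_fin; apply: le_trans (ler_norm _).
  have [xM|xM] := pselect (rVbox M x).
    rewrite indicE mem_set// mulr1 -[H x ^+ 2]real_normK ?num_real//.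
    by have := sqr_ge0 (`|H x| - 1); have := normr_ge0 (H x); rewrite sqrrB; lra.
  by rewrite (boxed_notin bH xM) normr0 expr0n/= addr0 mul1r indicE.
- by apply: integrableD => //; exact: integrable_indic_rVbox.
Qed.

Lemma integrable_cutoff_shift r x :
  leb.-integrable setT (EFin \o (fun y => cutoff r (y - x))).
Proof.
apply/integrableP; split.
  by apply/measurable_EFinP; exact: (measurable_subr x (@continuous_cutoff R n r)).
rewrite (eq_integral (fun y => (cutoff r (y - x))%:E)) ?cutoff_mass_shift ?ltry//.
by move=> y _; rewrite /= ger0_norm ?cutoff_ge0.
Qed.

Lemma moll_le r h C x : 0 < r -> continuous h -> leb.-integrable setT (EFin \o h) ->
  (forall y, (forall i, `|y ord0 i - x ord0 i| <= r) -> `|h y| <= C) ->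
  `|moll r h x| <= C.
Proof.
move=> r0 ch ih hC; have c0 := cutoff_mass_gt0 (n := n) r0.
have i1 := integrable_conv x ih (@continuous_cutoff R n r) (cutoff_norm_le1 r).
have i0 := integrable_cutoff_shift r x.
rewrite /moll normrM gtr0_norm ?invr_gt0// ler_pdivrMl//.
have m0 : \int[leb]_y cutoff r (y - x) = @cutoff_mass R n r.
  by rewrite /Rintegral cutoff_mass_shift.
apply: le_trans (le_normr_Rintegral measurableT i1) _.
rewrite mulrC -m0 -(RintegralZl _ measurableT i0); apply: le_Rintegral => //.
- exact: integrable_norm.
- exact: integrable_fZl.
move=> y _; rewrite normrM [`|cutoff _ _|]ger0_norm ?cutoff_ge0//.
have [hy|/existsNP[i /negP hy]] := pselect (forall i, `|y ord0 i - x ord0 i| <= r).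
  by rewrite ler_wpM2r ?cutoff_ge0// hC.
rewrite (_ : cutoff r (y - x) = 0) ?mulr0//.
by apply: (@boxed_cutoff R n r _ i); rewrite !mxE ltNge.
Qed.

Lemma mollB_cst r h a x : 0 < r -> leb.-integrable setT (EFin \o h) ->
  moll r h x - a = (@cutoff_mass R n r)^-1 * \int[leb]_y ((h y - a) * cutoff r (y - x)).
Proof.
move=> r0 ih; have c0 := cutoff_mass_gt0 (n := n) r0.
have i1 := integrable_conv x ih (@continuous_cutoff R n r) (cutoff_norm_le1 r).
have i0 := integrable_cutoff_shift r x.
have m0 : \int[leb]_y cutoff r (y - x) = @cutoff_mass R n r.
  by rewrite /Rintegral cutoff_mass_shift.
rewrite /moll /conv; under [in RHS]eq_Rintegral do rewrite mulrBl.
rewrite (RintegralB measurableT i1 (integrable_fZl a i0)).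
rewrite (RintegralZl _ measurableT i0) m0; field.
by rewrite gt_eqF.
Qed.

Lemma moll_cvg_pt h M x : continuous h -> boxed M h ->
  moll k.+1%:R^-1 h x @[k --> \oo] --> h x.
Proof.
move=> ch bh; have ih := integrable_boxed ch bh.
apply/cvgrPdist_le => e e0.
have /cvgrPdist_le/(_ e e0) := ch x; rewrite -nbhs_ballE => -[d /= d0 dx].
near=> k.
have r0 : 0 < k.+1%:R^-1 :> R by rewrite invr_gt0.
have kd : k.+1%:R^-1 < d by near: k; exact: near_infty_natSinv_lt (PosNum d0).
have c0 := cutoff_mass_gt0 (n := n) r0; set r := k.+1%:R^-1 in r0 kd c0 *.
rewrite distrC mollB_cst// normrM gtr0_norm ?invr_gt0// ler_pdivrMl//.
have m0 : \int[leb]_y cutoff r (y - x) = @cutoff_mass R n r.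
  by rewrite /Rintegral cutoff_mass_shift.
have i0 := integrable_cutoff_shift r x.
have i1 : leb.-integrable setT (EFin \o (fun y => (h y - h x) * cutoff r (y - x))).
  rewrite (_ : (fun y => _) = fun y => h y * cutoff r (y - x) - h x * cutoff r (y - x)).
    apply: integrable_fB; last exact: integrable_fZl.
    exact: (integrable_conv x ih (@continuous_cutoff R n r) (cutoff_norm_le1 r)).
  by apply/funext => y; rewrite mulrBl.
apply: le_trans (le_normr_Rintegral measurableT i1) _.
rewrite mulrC -m0 -(RintegralZl _ measurableT i0); apply: le_Rintegral => //.
- exact: integrable_norm.
- exact: integrable_fZl.
move=> y _; rewrite normrM [`|cutoff _ _|]ger0_norm ?cutoff_ge0//.
have [hy|/existsNP[i /negP hy]] := pselect (forall i, `|y ord0 i - x ord0 i| <= r).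
  rewrite ler_wpM2r ?cutoff_ge0// distrC; apply: dx.
  by apply/ball_rVP => // i; rewrite distrC (le_lt_trans (hy i)).
rewrite (_ : cutoff r (y - x) = 0) ?mulr0//.
by apply: (@boxed_cutoff R n r _ i); rewrite !mxE ltNge.
Unshelve. all: by end_near. Qed.

Lemma boxed_moll r M h : boxed M h -> boxed (M + r) (moll r h).
Proof.
move=> bh x i Mx; rewrite /moll (boxed_conv bh (@boxed_cutoff R n r) Mx) mulr0//.
Qed.

(** All radii are at most 1, so every mollification lives in the cube of radius M + 1 and obeys the
    sup bound of h; dominated convergence applies. *)
Lemma moll_cvg_continuous h M : continuous h -> boxed M h ->
  sqdist leb setT (moll k.+1%:R^-1 h) h @[k --> \oo] --> 0%E.
Proof.
move=> ch bh; have ih := integrable_boxed ch bh.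
have [C C0 hC] := boxed_bounded ch bh.
have r0 k : 0 < k.+1%:R^-1 :> R by rewrite invr_gt0.
have bm k : boxed (M + 1) (moll k.+1%:R^-1 h).
  apply: boxed_le (boxed_moll bh); rewrite lerD2l invf_le1//.
  by rewrite ler1n.
apply: (@sqdist_cvg0 _ _ _ _ _ _ _ (fun x => (2 * C) ^+ 2 * \1_(rVbox (M + 1)) x)) => //.
- by move=> k; apply: continuous_measurable_rV; exact: continuous_moll.
- exact: continuous_measurable_rV.
- by move=> x _; exact: moll_cvg_pt bh.
- exact: integrable_indic_rVbox.
move=> k x _; have [xM|xM] := pselect (rVbox (M + 1) x).
  rewrite indicE mem_set// mulr1 -real_normK ?num_real// ler_sqr ?nnegrE//; last lra.
  rewrite (le_trans (ler_normB _ _))// mulr_natl mulr2n lerD//.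
  by apply: moll_le.
rewrite (boxed_notin (bm k) xM) (boxed_notin (boxed_le _ bh) xM) ?subrr ?expr0n.
  by rewrite mulr_ge0 ?sqr_ge0// indicE.
by rewrite lerDl.
Qed.

Lemma moll_cvg H M (e : R) : 0 <= M -> measurable_fun setT H -> boxed M H ->
  leb.-integrable setT (EFin \o (fun x => H x ^+ 2)) -> 0 < e ->
  \forall k \near \oo, (sqdist leb setT (moll k.+1%:R^-1 H) H <= e%:E)%E.
Proof.
move=> M0 mH bH iH2 e0; have iH := boxed_sqr_integrable mH bH iH2.
(* The triangle inequality is used twice, around an approximant h of H. The inner use costs 4 e/12 =
   e/3, and the outer one 2 e/12 + 2 e/3, which is below e. *)
have e12 : 0 < e / 12 by rewrite divr_gt0.
have [h [ch bh he]] := capprox_boxed M0 mH bH iH2 e12.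
have ih := integrable_boxed ch bh.
have mh := continuous_measurable_rV ch.
have ihH2 : leb.-integrable setT (EFin \o (fun x => (H x - h x) ^+ 2)).
  apply/integrableP; split; first exact: measurable_sqdiff.
  under eq_integral do rewrite gee0_abs ?lee_fin ?sqr_ge0//.
  by apply: le_lt_trans he _; rewrite ltry.
have := cvge0_near_le e12 (moll_cvg_continuous ch bh).
apply: filterS => k hk.
have r0 : 0 < k.+1%:R^-1 :> R by rewrite invr_gt0.
have cm f : leb.-integrable setT (EFin \o f) -> measurable_fun setT (moll k.+1%:R^-1 f).
  by move=> i; apply: continuous_measurable_rV; exact: continuous_moll.
apply: (le_trans (sqdist_triangle leb measurableT (cm _ iH) (cm _ ih) mH)).
have s1 := le_trans (sqdist_moll r0 iH ih ihH2) he.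
have s2 : (sqdist leb setT (moll k.+1%:R^-1 h) H <= (e / 3)%:E)%E.
  apply: (le_trans (sqdist_triangle leb measurableT (cm _ ih) mh mH)).
  rewrite [X in (_ + _ * X)%E]sqdistC.
  apply: (@le_trans _ _ (2%:E * (e / 12)%:E + 2%:E * (e / 12)%:E)%E).
    by apply: leeD; apply: lee_pmul => //; exact: sqdist_ge0.
  by rewrite -!EFinM -EFinD lee_fin; lra.
apply: (@le_trans _ _ (2%:E * (e / 12)%:E + 2%:E * (e / 3)%:E)%E).
  by apply: leeD; apply: lee_pmul => //; exact: sqdist_ge0.
by rewrite -!EFinM -EFinD lee_fin; lra.
Qed.

End moll_cvg.

(** * Integration against a measure given by a density *)

Section integral_density.
Context d (T : measurableType d) {R : realType}.
Variables (mu leb : {measure set T -> \bar R}) (w : T -> R).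
Hypothesis mw : measurable_fun setT w.
Hypothesis w0 : forall x, 0 <= w x.
Hypothesis muE : forall A, measurable A -> mu A = (\int[leb]_(x in A) (w x)%:E)%E.
Import HBNNSimple.
Local Open Scope ereal_scope.

Let mew : measurable_fun setT (EFin \o w).
Proof. exact/measurable_EFinP. Qed.

Let integral_density_nnsfun (h : {nnsfun T >-> R}) :
  \int[leb]_x ((h x)%:E * (w x)%:E) = \int[mu]_x (h x)%:E.
Proof.
have hE x : (h x)%:E = \sum_(y \in range h) (y * \1_(h @^-1` [set y]) x)%:E.
  by rewrite fimfunE -fsumEFin.
have mind r : measurable_fun setT (fun x => (r * \1_(h @^-1` [set r]) x)%:E).
  exact/measurable_EFinP/measurable_funM.
under [RHS]eq_integral do rewrite hE.
rewrite ge0_integral_fsum//; last by move=> y x _; exact: nnfun_muleindic_ge0.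
transitivity (\int[leb]_x \sum_(y \in range h)
    ((y * \1_(h @^-1` [set y]) x)%:E * (w x)%:E)).
  apply: eq_integral => x _; rewrite hE ge0_mule_fsuml// => y.
  exact: nnfun_muleindic_ge0.
rewrite ge0_integral_fsum//; last 2 first.
- by move=> y; exact: emeasurable_funM.
- by move=> y x _; apply: mule_ge0; rewrite ?lee_fin//; exact: nnfun_muleindic_ge0.
apply: eq_fsbigr => r rh; have r0 : (0 <= r)%R.
  by move: rh; rewrite inE => -[t _ <-].
under [RHS]eq_integral do rewrite EFinM.
rewrite integralZl_indic_nnsfun// integral_indic// setIT muE//.
under eq_integral do rewrite EFinM -muleA.
rewrite ge0_integralZl//; last 2 first.
- by apply: emeasurable_funM => //; exact/measurable_EFinP.
- by move=> x _; rewrite mule_ge0 ?lee_fin ?w0.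
congr (_ * _); rewrite [RHS]integral_mkcond; apply: eq_integral => x _.
by rewrite patchE indicE; case: (x \in _); rewrite ?mul1e ?mul0e.
Qed.

Lemma ge0_integral_density (f : T -> \bar R) : measurable_fun setT f ->
  (forall x, 0 <= f x) -> \int[mu]_x f x = \int[leb]_x (f x * (w x)%:E).
Proof.
move=> mf f0; pose h := nnsfun_approx measurableT mf.
have hf x : (h n x)%:E @[n --> \oo] --> f x.
  by apply: (cvg_nnsfun_approx measurableT mf) => // y _; exact: f0.
have ndh x a b : (a <= b)%N -> (h a x <= h b x)%R.
  by move=> ab; have /lefP := nd_nnsfun_approx measurableT mf ab; apply.
transitivity (limn (fun n => \int[mu]_x (h n x)%:E)).
  rewrite -monotone_convergence//.
  - by apply: eq_integral => x _; apply/esym/cvg_lim.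
  - by move=> n; exact/measurable_EFinP.
  - by move=> n x _; rewrite lee_fin.
  - by move=> x _ a b ab; rewrite lee_fin ndh.
transitivity (limn (fun n => \int[leb]_x ((h n x)%:E * (w x)%:E))).
  by congr (limn _); apply/funext => n; rewrite integral_density_nnsfun.
rewrite -monotone_convergence//.
- by apply: eq_integral => x _; apply/cvg_lim => //; exact: cvgeZr.
- by move=> n; apply: emeasurable_funM => //; exact/measurable_EFinP.
- by move=> n x _; rewrite mule_ge0 ?lee_fin.
- by move=> x _ a b ab; rewrite lee_wpmul2r ?lee_fin ?ndh.
Qed.

Lemma integrable_density (f : T -> R) : measurable_fun setT f ->
  mu.-integrable setT (EFin \o f) <->
  leb.-integrable setT (EFin \o (fun x => f x * w x)%R).
Proof.
move=> mf.
have E : \int[mu]_x `|(f x)%:E| = \int[leb]_x `|(f x * w x)%:E|.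
  rewrite ge0_integral_density//; last exact/measurableT_comp/measurable_EFinP.
  by apply: eq_integral => x _; rewrite EFinM abseM (gee0_abs (x := (w x)%:E)) ?lee_fin.
split=> /integrableP[_ foo]; apply/integrableP; split.
- exact/measurable_EFinP/measurable_funM.
- by move: foo; rewrite /comp E.
- exact/measurable_EFinP.
- by move: foo; rewrite /comp -E.
Qed.

(** Reduced to the nonnegative case by writing f as [(|f| + f) - |f|]. *)
Lemma Rintegral_density (f : T -> R) : mu.-integrable setT (EFin \o f) ->
  (\int[mu]_x f x = \int[leb]_x (f x * w x))%R.
Proof.
move=> intf; have mf : measurable_fun setT f.
  by apply/measurable_EFinP; exact: measurable_int intf.
have P (g : T -> R) : measurable_fun setT g -> (forall x, 0 <= g x)%R ->
    (\int[mu]_x g x = \int[leb]_x (g x * w x))%R.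
  move=> mg g0; rewrite /Rintegral ge0_integral_density//; exact/measurable_EFinP.
have iN : mu.-integrable setT (EFin \o (fun x => `|f x|%R)) by exact: integrable_norm.
have iP : mu.-integrable setT (EFin \o (fun x => `|f x| + f x)%R).
  by rewrite /comp; under eq_fun do rewrite EFinD; exact: integrableD.
have mN : measurable_fun setT (fun x => `|f x|%R) by exact: measurableT_comp.
have mP : measurable_fun setT (fun x => `|f x| + f x)%R by exact: measurable_funD.
have P0 x : (0 <= `|f x| + f x)%R.
  by rewrite addrC -lerBlDr sub0r lerNl ler_normr lexx orbT.
transitivity (\int[mu]_x ((`|f x| + f x) - `|f x|))%R.
  by apply: eq_Rintegral => x _; ring.
rewrite RintegralB// !P// -RintegralB//.
- by apply: eq_Rintegral => x _; ring.
- exact/integrable_density.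
- exact/integrable_density.
Qed.

End integral_density.

(** * Approximation of a weak gradient by truncation and mollification *)

Definition C1_boxed {R : realType} {d : nat} (f : 'rV[R]_d -> R) : Prop :=
  class_C 1 f /\ exists2 M, 0 <= M & boxed M f.

Lemma Lfun_measurable {d} {T : measurableType d} {R : realType}
    (mu : {measure set T -> \bar R}) p (f : T -> R) :
  f \in Lfun mu p -> measurable_fun setT f.
Proof. by rewrite inE => /andP[/[!inE]]. Qed.

Section H1_approx.
Context {R : realType} {d : nat}.
Notation leb := (@lebesgue_rV R d).
Variables (V : 'rV[R]_d -> R) (mu : probability 'rV[R]_d R).
Hypothesis cV : continuous V.
Hypothesis muV : has_density mu (fun x => expR (- V x)).
Implicit Types (f g u : 'rV[R]_d -> R) (M : R).

Let w x := expR (- V x).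

Lemma continuous_expRN_comp : continuous (fun x => expR (- V x)).
Proof.
move=> x.
exact: (cvg_comp _ _ (@cvgN _ _ _ _ (nbhs_filter x) _ _ (@cV x)) (@continuous_expR R (- V x))).
Qed.

Let mw : measurable_fun setT w.
Proof. exact: (continuous_measurable_rV continuous_expRN_comp). Qed.

Let w0 x : 0 <= w x. Proof. exact: expR_ge0. Qed.

(** The density is continuous, hence bounded on a cube. Mollification is controlled for Lebesgue
    measure only, and this carries its convergence over to mu, at fixed radius. *)
Lemma sqdist_le_lebesgue M : exists2 C, 0 < C & forall f g,
  measurable_fun setT f -> measurable_fun setT g -> boxed M f -> boxed M g ->
  (sqdist mu setT f g <= C%:E * sqdist leb setT f g)%E.
Proof.
have [C C0 hC] := compact_rV_continuous_bounded continuous_expRN_comp (@compact_rVbox R d M).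
exists C => // f g mf mg bf bg.
have ms := @measurable_sqdiff _ _ R setT _ _ mf mg.
rewrite /sqdist (ge0_integral_density mw w0 muV)//; last first.
  by move=> x; rewrite lee_fin sqr_ge0.
rewrite -ge0_integralZl//; last 2 first.
- by move=> x _; rewrite lee_fin sqr_ge0.
- by rewrite lee_fin ltW.
apply: ge0_le_integral => //.
- by move=> x _; rewrite mule_ge0 ?lee_fin ?sqr_ge0.
- by apply: emeasurable_funM => //; exact/measurable_EFinP.
- exact: measurable_funeM.
move=> x _; rewrite -!EFinM lee_fin mulrC.
have [xM|xM] := pselect (rVbox M x).
  by rewrite ler_wpM2r ?sqr_ge0//; apply: le_trans (hC x xM); exact: ler_norm.
by rewrite (boxed_notin bf xM) (boxed_notin bg xM) subrr expr0n/= !mulr0.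
Qed.

(** The converse passage: the density is also bounded away from 0 on a cube. *)
Lemma boxed_sqr_integrable_lebesgue M f : measurable_fun setT f -> boxed M f ->
  mu.-integrable setT (EFin \o (fun x => f x ^+ 2)) ->
  leb.-integrable setT (EFin \o (fun x => f x ^+ 2)).
Proof.
move=> mf bf.
have mf2 : measurable_fun setT (fun x => f x ^+ 2) by exact: measurable_funX.
move=> /(integrable_density mw w0 muV mf2).1 iw.
have cVi : continuous (fun x => (expR (- V x))^-1).
  move=> x; apply: (@cvgV _ _ _ (nbhs_filter x)); first by rewrite gt_eqF ?expR_gt0.
  exact: continuous_expRN_comp.
have [C C0 hC] := compact_rV_continuous_bounded cVi (@compact_rVbox R d M).
apply: (@le_integrable _ _ _ leb setT measurableT _ (fun x => C%:E * (f x ^+ 2 * w x)%:E)%E).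
- exact/measurable_EFinP.
- move=> x _; rewrite /= lee_fin; apply: le_trans (ler_norm _).
  rewrite ger0_norm ?sqr_ge0//.
  have [xM|xM] := pselect (rVbox M x); last first.
    by rewrite (boxed_notin bf xM) expr0n/= mul0r mulr0.
  rewrite mulrCA ler_peMr ?sqr_ge0// -ler_pdivrMr ?expR_gt0// div1r.
  by apply: le_trans (hC x xM); exact: ler_norm.
- exact: integrableZl.
Qed.

Lemma partial_subr f i (x y : 'rV[R]_d) : (forall z, derivable f z (delta_mx ord0 i)) ->
  derivable (fun z => f (z - x)) y (delta_mx ord0 i) /\
  partial i (fun z => f (z - x)) y = partial i f (y - x).
Proof.
move=> df; apply: derivable_line.
rewrite (_ : (fun s : R => _) = fun s => f ((y - x) + s *: delta_mx ord0 i)).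
  have := is_derive_line (derivable_line0 (df (y - x))).
  by rewrite scale0r addr0.
by apply/funext => s; rewrite addrAC.
Qed.

Section weak.
Variables (u : 'rV[R]_d -> R) (G : 'rV[R]_d -> 'rV[R]_d).
Hypothesis uG : weak_gradient u G.
Hypothesis u2 : mu.-integrable setT (EFin \o (fun x => u x ^+ 2)).
Hypothesis G2 : forall i, mu.-integrable setT (EFin \o (fun x => G x ord0 i ^+ 2)).

Let mu_ : measurable_fun setT u. Proof. by case: uG => -[]. Qed.
Let mG i : measurable_fun setT (fun x => G x ord0 i).
Proof. by case: uG => _ /(_ i)[]. Qed.

Definition trunc m y := cutoff m%:R y * u y.
(** Leibniz' rule for the i-th weak derivative of [trunc]. That it is one enters only through the
    kernels tested in [conv_trunc_partial]. *)
Definition truncG m i y := cutoff m%:R y * G y ord0 i + partial i (cutoff m%:R) y * u y.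

Let cpc m i : continuous (partial i (@cutoff R d m)).
Proof. exact: (class_C_continuous (class_C_partial i (class_C_cutoff0 1 m))). Qed.

Let mcut m : measurable_fun setT (@cutoff R d m).
Proof. exact: (continuous_measurable_rV (@continuous_cutoff R d m)). Qed.

Let mpc m i : measurable_fun setT (partial i (@cutoff R d m)).
Proof. exact: (continuous_measurable_rV (@cpc m i)). Qed.

Lemma measurable_trunc m : measurable_fun setT (trunc m).
Proof. exact: measurable_funM. Qed.

Lemma measurable_truncG m i : measurable_fun setT (truncG m i).
Proof. by apply: measurable_funD; exact: measurable_funM. Qed.

Lemma boxed_trunc m : boxed m%:R (trunc m).
Proof. by move=> x i mx; rewrite /trunc (boxed_cutoff mx) mul0r. Qed.

Lemma boxed_truncG m i : boxed m%:R (truncG m i).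
Proof.
move=> x j mx; rewrite /truncG (boxed_cutoff mx) mul0r add0r.
by rewrite (boxed_partial i (@boxed_cutoff R d m%:R) mx) mul0r.
Qed.

Lemma trunc_cvg : sqdist mu setT (trunc m) u @[m --> \oo] --> 0%E.
Proof.
apply: (@sqdist_cvg0 _ _ _ _ _ _ _ (fun x => u x ^+ 2)) => //.
- exact: measurable_trunc.
- move=> x _; rewrite -[X in _ --> X]mul1r; apply: cvgM; last exact: cvg_cst.
  exact: cutoff_cvg.
- move=> m x _; rewrite /trunc -{2}[u x]mul1r -mulrBl exprMn ler_piMl ?sqr_ge0//.
  by have := cutoff_ge0 m%:R x; have := cutoff_le1 m%:R x; nra.
Qed.

Lemma truncG_cvg i :
  sqdist mu setT (truncG m i) (fun x => G x ord0 i) @[m --> \oo] --> 0%E.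
Proof.
(* The difference is at most [|G x ord0 i| + 4 * |u x|], where 4 bounds the derivative of the
   cut-off for every m; squaring gives the factors 2 and 2 * 4^2. *)
apply: (@sqdist_cvg0 _ _ _ _ _ _ _ (fun x => 2 * G x ord0 i ^+ 2 + 32 * u x ^+ 2)) => //.
- by move=> m; exact: measurable_truncG.
- move=> x _; rewrite -[X in _ --> X](addr0) -[X in _ --> X + _]mul1r.
  rewrite -[X in _ --> _ + X](mul0r (u x)).
  apply: cvgD; apply: cvgM; try exact: cvg_cst.
    exact: cutoff_cvg.
  exact: partial_cutoff_cvg.
- rewrite (_ : EFin \o _ = fun x =>
    (2%:E * (G x ord0 i ^+ 2)%:E + 32%:E * (u x ^+ 2)%:E)%E)//.
  by apply: integrableD => //; apply: integrableZl => //; exact: G2.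
- move=> m x _.
  have h := @sqr_le2 R (truncG m i x - G x ord0 i) (G x ord0 i) (4 * u x) _.
  apply: le_trans (h _) _; last by rewrite exprMn; lra.
  rewrite /truncG addrAC -[X in _ - X]mul1r -mulrBl (le_trans (ler_normD _ _))//.
  rewrite !normrM lerD//.
    rewrite ler_piMl// ler_norml.
    by have := cutoff_ge0 m%:R x; have := cutoff_le1 m%:R x; lra.
  by rewrite ler_wpM2r// (ger0_norm (x := 4))//; exact: partial_cutoff_bounded.
Qed.

End weak.
End H1_approx.

Lemma partialM {R : realType} {d : nat} (f g : 'rV[R]_d -> R) i x :
  class_C 1 f -> class_C 1 g ->
  partial i (fun y => f y * g y) x = f x * partial i g x + g x * partial i f x.
Proof. by move=> Cf Cg; apply: deriveM; apply: class_C_derivable; eassumption. Qed.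

Section H1_approx.
Context {R : realType} {d : nat}.
Notation leb := (@lebesgue_rV R d).
Variables (V : 'rV[R]_d -> R) (mu : probability 'rV[R]_d R).
Hypothesis cV : continuous V.
Hypothesis muV : has_density mu (fun x => expR (- V x)).

Lemma loc_integrable_mul_boxed (f g : 'rV[R]_d -> R) M : loc_integrable f ->
  continuous g -> boxed M g -> leb.-integrable setT (fun x => (f x * g x)%:E).
Proof.
move=> [mf lf] cg bg; have [C C0 hC] := boxed_bounded cg bg.
have mB := @measurable_rVbox R d M.
have -> : (fun x => (f x * g x)%:E) = (fun x => (f x * g x)%:E) \_ (rVbox M).
  apply/funext => x; rewrite patchE; case: ifPn => //.
  by rewrite notin_setE => /(boxed_notin bg) ->; rewrite mulr0.
apply/(integrable_mkcond _ mB).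
have mg := continuous_measurable_rV cg.
have iF : leb.-integrable (rVbox M) (EFin \o f).
  apply/integrableP; split; first by apply/measurable_EFinP; exact: measurable_funTS.
  have := lf _ (@compact_rVbox R d M).
  by rewrite (eq_integral (fun x => `|(EFin \o f) x|%E)).
apply: (@le_integrable _ _ _ leb _ mB _ (fun x => C%:E * (f x)%:E)%E).
- by apply/measurable_EFinP; apply: measurable_funTS; exact: measurable_funM.
- move=> x _; rewrite -EFinM /= lee_fin !normrM mulrC ler_wpM2r//.
  exact: le_trans (hC x) (ler_norm _).
- exact: integrableZl.
Qed.

Section weak.
Variables (u : 'rV[R]_d -> R) (G : 'rV[R]_d -> 'rV[R]_d).
Hypothesis uG : weak_gradient u G.
Hypothesis u2 : mu.-integrable setT (EFin \o (fun x => u x ^+ 2)).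
Hypothesis G2 : forall i, mu.-integrable setT (EFin \o (fun x => G x ord0 i ^+ 2)).

Let intE (f : 'rV[R]_d -> R) m : measurable_fun setT f -> boxed m%:R f ->
  mu.-integrable setT (EFin \o (fun x => f x ^+ 2)) ->
  leb.-integrable setT (EFin \o f).
Proof.
move=> mf bf f2; apply: boxed_sqr_integrable (bf) _ => //.
exact: (boxed_sqr_integrable_lebesgue cV muV mf bf).
Qed.

Lemma trunc_sqr_integrable m :
  mu.-integrable setT (EFin \o (fun x => trunc u m x ^+ 2)).
Proof.
have [[mu_ _] _ _] := uG.
have mt := measurable_trunc uG m.
apply: (@le_integrable _ _ _ mu setT measurableT _ (fun x => (u x ^+ 2)%:E)) => //.
  by apply/measurable_EFinP; exact: measurable_funX.
move=> x _; rewrite /= lee_fin !ger0_norm ?sqr_ge0// /trunc exprMn ler_piMl ?sqr_ge0//.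
by rewrite expr_le1 ?cutoff_ge0 ?cutoff_le1.
Qed.

Lemma truncG_sqr_integrable m i :
  mu.-integrable setT (EFin \o (fun x => truncG u G m i x ^+ 2)).
Proof.
have mt := measurable_truncG uG m i.
apply: (@le_integrable _ _ _ mu setT measurableT _
  (fun x => (2%:E * (G x ord0 i ^+ 2)%:E + 32%:E * (u x ^+ 2)%:E)%E)).
- by apply/measurable_EFinP; exact: measurable_funX.
- move=> x _; rewrite /= lee_fin; apply: le_trans (ler_norm _).
  rewrite ger0_norm ?sqr_ge0//.
  have h := @sqr_le2 R (truncG u G m i x) (G x ord0 i) (4 * u x) _.
  apply: le_trans (h _) _; last by rewrite exprMn; lra.
  rewrite /truncG (le_trans (ler_normD _ _))// !normrM lerD//.
    by rewrite ler_piMl// cutoff_norm_le1.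
  by rewrite ler_wpM2r// (ger0_norm (x := 4))//; exact: partial_cutoff_bounded.
- by apply: integrableD => //; apply: integrableZl => //; exact: G2.
Qed.

Lemma integrable_trunc m : leb.-integrable setT (EFin \o trunc u m).
Proof.
exact: intE (measurable_trunc uG m) (@boxed_trunc _ _ u m) (trunc_sqr_integrable m).
Qed.

Lemma integrable_truncG m i : leb.-integrable setT (EFin \o truncG u G m i).
Proof.
exact: intE (measurable_truncG uG m i) (@boxed_truncG _ _ u G m i) (truncG_sqr_integrable m i).
Qed.

Let ccut (r : R) : continuous (@cutoff R d r).
Proof. exact: continuous_cutoff. Qed.

Let cpc (r : R) i : continuous (partial i (@cutoff R d r)).
Proof. exact: (class_C_continuous (class_C_partial i (class_C_cutoff0 1 r))). Qed.

Let dcut (r : R) i (z : 'rV[R]_d) : derivable (@cutoff R d r) z (delta_mx ord0 i).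
Proof. exact: (class_C_derivable (class_C_cutoff0 1 r)). Qed.

(** The definition of the weak gradient is applied to the product of the cut-off and the translated
    kernel. Of the two terms in the derivative of that product, the one with the differentiated
    cut-off moves into [truncG]. *)
Lemma conv_trunc_partial m r i x :
  conv (trunc u m) (partial i (cutoff r)) x = - conv (truncG u G m i) (cutoff r) x.
Proof.
have [lu lG wG] := uG.
pose phi (y : 'rV[R]_d) := cutoff m%:R y * cutoff r (y - x).
have tphi : test_function phi.
  apply: (@test_function_boxed _ _ _ m%:R).
    by move=> k; apply: class_CM; [exact: class_C_cutoff0|exact: class_C_cutoff].
  by move=> y j my; rewrite /phi (boxed_cutoff my) mul0r.
have dphi y : partial i phi y = cutoff m%:R y * partial i (cutoff r) (y - x) +
    cutoff r (y - x) * partial i (cutoff m%:R) y.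
  have [d1 d2] := @partial_subr R d (cutoff r) i x y (fun z => @dcut r i z).
  by rewrite -d2; exact: (partialM i y (class_C_cutoff0 1 m%:R) (class_C_cutoff 1 r x)).
have := wG phi i tphi.
under eq_Rintegral do rewrite dphi mulrDr.
have bprod (f g : 'rV[R]_d -> R) : boxed m%:R f -> boxed m%:R (fun y => f y * g y).
  by move=> bf y j my; rewrite (bf y j my) mul0r.
have bm := @boxed_cutoff R d m%:R.
have bpm := boxed_partial i bm.
have i1 : leb.-integrable setT
    (fun y => (u y * (cutoff m%:R y * partial i (cutoff r) (y - x)))%:E).
  apply: (loc_integrable_mul_boxed lu) (bprod _ _ bm).
  by apply: continuous_fM; [exact: ccut|apply: continuous_subr; exact: cpc].
have i2' : leb.-integrable setT
    (fun y => (u y * (partial i (cutoff m%:R) y * cutoff r (y - x)))%:E).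
  apply: (loc_integrable_mul_boxed lu) (bprod _ _ bpm).
  by apply: continuous_fM; [exact: cpc|apply: continuous_subr; exact: ccut].
have i2 : leb.-integrable setT
    (fun y => (u y * (cutoff r (y - x) * partial i (cutoff m%:R) y))%:E).
  by under eq_fun do rewrite [X in _ * X]mulrC.
have i3 : leb.-integrable setT (fun y => (G y ord0 i * phi y)%:E).
  apply: (loc_integrable_mul_boxed (lG i)) (bprod _ _ bm).
  by apply: continuous_fM; [exact: ccut|apply: continuous_subr; exact: ccut].
rewrite (RintegralD measurableT i1 i2) => E.
rewrite /conv.
have -> : \int[leb]_y (trunc u m y * partial i (cutoff r) (y - x)) =
    \int[leb]_y (u y * (cutoff m%:R y * partial i (cutoff r) (y - x))).
  by apply: eq_Rintegral => y _; rewrite /trunc; ring.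
have -> : \int[leb]_y (truncG u G m i y * cutoff r (y - x)) =
    \int[leb]_y (G y ord0 i * phi y +
      u y * (cutoff r (y - x) * partial i (cutoff m%:R) y)).
  by apply: eq_Rintegral => y _; rewrite /truncG /phi; ring.
by rewrite (RintegralD measurableT i3 i2) opprD -E addrK.
Qed.

(** Mollification commutes with differentiation: the sign from differentiating [conv] cancels the
    sign from integrating by parts. *)
Lemma partial_moll_trunc m r i x : 0 < r ->
  derivable (moll r (trunc u m)) x (delta_mx ord0 i) /\
  partial i (moll r (trunc u m)) x = moll r (truncG u G m i) x.
Proof.
move=> r0.
have c4 (y : 'rV[R]_d) : `|cutoff r y| <= 4.
  by apply: (le_trans (cutoff_norm_le1 r y)); lra.
have [d1 d2] := @derivable_conv R d _ _ 4 i x (integrable_trunc m) (@ccut r) c4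
  (fun z => @dcut r i z) (@cpc r i) (partial_cutoff_bounded r i).
pose c := (@cutoff_mass R d r)^-1.
have e1 : moll r (trunc u m) = c \*: conv (trunc u m) (cutoff r) by [].
rewrite e1; split; first by apply: derivableZ.
rewrite /partial in d2 *; rewrite (deriveZ c d1) d2 conv_trunc_partial opprK.
by [].
Qed.

(** The truncation m is fixed first. It determines a cube of radius m + 1 that contains all
    mollifications of radius at most 1, hence the constant C comparing mu with Lebesgue measure
    there, hence the tolerance e/4/C. One radius serves u and all its derivatives, as there are
    finitely many of them. *)
Lemma H1_approx (e : R) : 0 < e -> exists f, C1_boxed f /\
  (sqdist mu setT f u <= e%:E)%E /\
  forall i, (sqdist mu setT (partial i f) (fun x => G x ord0 i) <= e%:E)%E.
Proof.
move=> e0; have e4 : 0 < e / 4 by rewrite divr_gt0.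
have [[mu_ _] lG _] := uG.
have mG i : measurable_fun setT (fun x => G x ord0 i) by case: (lG i).
have [m _ /(_ m (leqnn m))[h1 h2]] : \forall m \near \oo,
    (sqdist mu setT (trunc u m) u <= (e / 4)%:E)%E /\
    forall i, (sqdist mu setT (truncG u G m i) (fun x => G x ord0 i) <= (e / 4)%:E)%E.
  near=> m; split; near: m; first exact: (cvge0_near_le e4 (trunc_cvg uG u2)).
  apply: filter_forall => i.
  exact: (cvge0_near_le e4 (truncG_cvg uG u2 G2 i)).
have [C C0 hC] := sqdist_le_lebesgue cV muV (m%:R + 1).
have eC : 0 < e / 4 / C by rewrite divr_gt0.
have m0 : 0 <= m%:R :> R by [].
have mt := measurable_trunc uG m.
have mtG i := measurable_truncG uG m i.
have bt := @boxed_trunc _ _ u m.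
have btG i := @boxed_truncG _ _ u G m i.
have [k _ /(_ k (leqnn k))[h3 h4]] : \forall k \near \oo,
    (sqdist leb setT (moll k.+1%:R^-1 (trunc u m)) (trunc u m) <= (e / 4 / C)%:E)%E /\
    forall i, (sqdist leb setT (moll k.+1%:R^-1 (truncG u G m i)) (truncG u G m i)
       <= (e / 4 / C)%:E)%E.
  near=> k; split; near: k.
    apply: (moll_cvg m0 mt bt _ eC).
    exact: (boxed_sqr_integrable_lebesgue cV muV mt bt (trunc_sqr_integrable m)).
  apply: filter_forall => i; apply: (moll_cvg m0 (mtG i) (btG i) _ eC).
  exact: (boxed_sqr_integrable_lebesgue cV muV (mtG i) (btG i) (truncG_sqr_integrable m i)).
set r := k.+1%:R^-1 in h3 h4 *.
have r0 : 0 < r by rewrite invr_gt0.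
have r1 : r <= 1 by rewrite invf_le1// ler1n.
pose f := moll r (trunc u m).
have bf : boxed (m%:R + 1) f by apply: boxed_le (boxed_moll bt); rewrite lerD2l.
have cm := continuous_moll (r := r) (integrable_trunc m).
have cmG i := continuous_moll (r := r) (integrable_truncG m i).
have pf i : partial i f = moll r (truncG u G m i).
  by apply/funext => x; exact: (partial_moll_trunc m i x r0).2.
have final (g H K : 'rV[R]_d -> R) : measurable_fun setT g -> measurable_fun setT H ->
    measurable_fun setT K -> boxed (m%:R + 1) g -> boxed m%:R H ->
    (sqdist leb setT g H <= (e / 4 / C)%:E)%E ->
    (sqdist mu setT H K <= (e / 4)%:E)%E -> (sqdist mu setT g K <= e%:E)%E.
  move=> mg mH mK bg bH l1 l2.
  apply: (le_trans (sqdist_triangle mu measurableT mg mH mK)).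
  have l3 : (sqdist mu setT g H <= (e / 4)%:E)%E.
    apply: (le_trans (hC g H mg mH bg _)); first by apply: boxed_le bH; rewrite lerDl.
    apply: (@le_trans _ _ (C%:E * (e / 4 / C)%:E)%E).
      by apply: lee_pmul => //; [rewrite lee_fin ltW|exact: sqdist_ge0].
    by rewrite -EFinM lee_fin mulrC divfK// gt_eqF.
  apply: (@le_trans _ _ (2%:E * (e / 4)%:E + 2%:E * (e / 4)%:E)%E).
    by apply: leeD; apply: lee_pmul => //; exact: sqdist_ge0.
  by rewrite -!EFinM -EFinD lee_fin; lra.
exists f; split; [split|split].
- split; first exact: cm.
  move=> i; split; first by move=> x; exact: (partial_moll_trunc m i x r0).1.
  by rewrite pf; split.
- by exists (m%:R + 1) => //; rewrite addr_ge0.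
- by apply: (final _ (trunc u m)) => //; exact: continuous_measurable_rV.
- move=> i; rewrite pf; apply: (final _ (truncG u G m i)) => //.
    exact: continuous_measurable_rV.
  by rewrite -pf; exact: boxed_partial.
Unshelve. all: by end_near. Qed.

End weak.
End H1_approx.

Lemma Lfun2_sqr_integrable {d} {T : measurableType d} {R : realType}
    (mu : {measure set T -> \bar R}) (f : T -> R) : measurable_fun setT f ->
  mu.-integrable setT (EFin \o (fun x => f x ^+ 2)) -> f \in Lfun mu 2%:E.
Proof.
move=> mf /integrableP[_ foo]; rewrite inE; apply/andP; split; rewrite inE//=.
rewrite /finite_norm unlock; apply: poweR_lty; apply: le_lt_trans foo.
rewrite le_eqVlt; apply/orP; left; apply/eqP; apply: eq_integral => x _ /=.
by rewrite powR_mulrn// real_normK ?num_real// ger0_norm ?sqr_ge0.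
Qed.

Lemma Rintegral_sum {d} {T : measurableType d} {R : realType}
    (mu : {measure set T -> \bar R}) (I : Type) (s : seq I) (F : I -> T -> R) :
  (forall i, mu.-integrable setT (EFin \o F i)) ->
  \int[mu]_x (\sum_(i <- s) F i x) = \sum_(i <- s) \int[mu]_x F i x.
Proof.
move=> iF; elim: s => [|i s IHs].
  under eq_Rintegral do rewrite big_nil; rewrite big_nil.
  by rewrite /Rintegral integral0.
under eq_Rintegral do rewrite big_cons; rewrite big_cons RintegralD// ?IHs//.
rewrite (_ : EFin \o _ = fun x => (\sum_(i <- s) (F i x)%:E)%E).
  by apply: integrable_sum => // j _; exact: iF.
by apply/funext => x /=; rewrite sumEFin.
Qed.

Lemma bounded_integrable d (T : measurableType d) (R : realType)
    (mu : probability T R) (f : T -> R) (C : R) :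
  measurable_fun setT f -> (forall x, `|f x| <= C) ->
  mu.-integrable setT (EFin \o f).
Proof.
move=> mf fC; apply: measurable_bounded_integrable => //.
  by rewrite (le_lt_trans (probability_le1 mu measurableT))// ltry.
exists C; split; first exact: num_real.
by move=> M CM x _ /=; rewrite (le_trans (fC x))// ltW.
Qed.

(** * Functions of class C^1 with bounded support belong to H^1 *)

Section C1.
Context {R : realType} {d : nat}.
Implicit Types (f g : 'rV[R]_d -> R).
Notation leb := (@lebesgue_rV R d).

Lemma continuous_fsum (I : Type) (s : seq I) (F : I -> 'rV[R]_d -> R) :
  (forall i, continuous (F i)) -> continuous (fun x => \sum_(i <- s) F i x).
Proof.
move=> cF; elim: s => [|i s IHs].
  rewrite (_ : (fun x => _) = fun=> 0); first exact: cst_continuous.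
  by apply/funext => x; rewrite big_nil.
rewrite (_ : (fun x => _) = fun x => F i x + \sum_(i <- s) F i x).
  exact: continuous_fD.
by apply/funext => x; rewrite big_cons.
Qed.

Lemma derive_expR_comp f i x : class_C 1 f ->
  derivable (fun y => expR (f y)) x (delta_mx ord0 i) /\
  partial i (fun y => expR (f y)) x = expR (f x) * partial i f x.
Proof.
move=> Cf; apply: derivable_line.
have dl := is_derive_line (derivable_line0 (class_C_derivable Cf (i := i) (x := x))).
rewrite scale0r addr0 in dl.
have := @is_derive1_comp _ expR (fun s : R => f (x + s *: delta_mx ord0 i)) 0 _ _
  (is_derive_expR _) dl.
by rewrite /= scale0r addr0.
Qed.

Lemma continuous_expR_comp f : continuous f -> continuous (fun y => expR (f y)).
Proof.
by move=> cf x; exact: (cvg_comp _ _ (cf x) (@continuous_expR R (f x))).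
Qed.

Lemma class_C1_expR f : class_C 1 f -> class_C 1 (fun y => expR (f y)).
Proof.
move=> Cf; have cf := class_C_continuous Cf; split; first exact: continuous_expR_comp.
move=> i; split; first by move=> x; exact: (derive_expR_comp i x Cf).1.
rewrite (_ : partial i _ = fun x => expR (f x) * partial i f x).
  split=> //; apply: continuous_fM; first exact: continuous_expR_comp.
  exact: class_C_continuous (class_C_partial i Cf).
by apply/funext => x; exact: (derive_expR_comp i x Cf).2.
Qed.

Lemma boxedMl M f g : boxed M f -> boxed M (fun x => f x * g x).
Proof. by move=> bf x i Mx; rewrite (bf x i Mx) mul0r. Qed.

Lemma integrable_boxed_finite (mu : probability 'rV[R]_d R) M f :
  continuous f -> boxed M f -> mu.-integrable setT (EFin \o f).
Proof.
move=> cf bf; have [C C0 hC] := boxed_bounded cf bf.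
exact: bounded_integrable (continuous_measurable_rV cf) hC.
Qed.

Lemma Rintegral_partial f i M : class_C 1 f -> boxed M f ->
  \int[leb]_x partial i f x = 0.
Proof.
move=> Cf bf; rewrite /Rintegral (integral_partial (M := M))//.
- exact: class_C_continuous Cf.
- by move=> x; exact: class_C_derivable Cf.
- exact: class_C_continuous (class_C_partial i Cf).
Qed.

Lemma measurable_compact_rV (K : set 'rV[R]_d) : compact K -> measurable K.
Proof.
move=> cK; have clK : closed K by exact: (compact_closed (@norm_hausdorff _ _) cK).
by rewrite -[K]setCK; apply: measurableC; apply: open_measurable_rV; exact: closed_openC.
Qed.

Lemma loc_integrable_continuous f : continuous f -> loc_integrable f.
Proof.
move=> cf; have mf := continuous_measurable_rV cf; split; first exact: mf.
move=> K cK.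
have [M M0 KM] := compact_sub_rVbox cK.
have [C C0 hC] := compact_rV_continuous_bounded cf cK.
have mK := measurable_compact_rV cK.
have h1 : (\int[leb]_(x in K) `|f x|%:E <= C%:E * leb K)%E.
  rewrite -(integral_cst leb mK); apply: ge0_le_integral => //.
  by apply/measurable_EFinP; apply: measurable_funTS; exact: measurableT_comp.
have h2 : (leb K < +oo)%E.
  apply: le_lt_trans (@lebesgue_rVbox_fin R d M).
  by apply: le_measure; rewrite ?inE//; exact: measurable_rVbox.
apply: (le_lt_trans h1); rewrite lte_mul_pinfty ?lee_fin ?(ltW C0)//.
Qed.

(** The product [f * phi] is of class C^1 with bounded support, so its partial derivatives have
    integral zero. *)
Lemma weak_gradient_C1 f M : class_C 1 f -> boxed M f -> weak_gradient f (grad f).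
Proof.
move=> Cf bf; have cf := class_C_continuous Cf.
have gE i : (fun x => grad f x ord0 i) = partial i f by apply/funext => x; rewrite mxE.
have cpf i : continuous (partial i f) := class_C_continuous (class_C_partial i Cf).
split.
- exact: loc_integrable_continuous.
- by move=> i; rewrite gE; exact: loc_integrable_continuous.
move=> phi i [Cphi _].
have cphi := class_C_continuous (Cphi 0).
have cpphi : continuous (partial i phi) := class_C_continuous (class_C_partial i (Cphi 1)).
have := Rintegral_partial i (class_CM Cf (Cphi 1)) (boxedMl _ bf).
under eq_Rintegral do rewrite partialM//.
rewrite RintegralD//; last 2 first.
- exact: integrable_boxed (continuous_fM cf cpphi) (boxedMl _ bf).
- apply: (@integrable_boxed _ _ M); first exact: continuous_fM.
  by move=> x j Mx; rewrite (boxed_partial i bf Mx) mulr0.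
move=> E; rewrite (_ : \int[leb]_x (grad f x ord0 i * phi x) =
    \int[leb]_x (phi x * partial i f x)).
  by apply/eqP; rewrite -addr_eq0 E.
by apply: eq_Rintegral => x _; rewrite mxE mulrC.
Qed.

Lemma enorm_sqr (x : 'rV[R]_d) : enorm x ^+ 2 = \sum_(i < d) x ord0 i ^+ 2.
Proof.
by rewrite /enorm sqr_sqrtr ?sumr_ge0// => *; rewrite sqr_ge0.
Qed.

Lemma enorm_grad_sqr f x : enorm (grad f x) ^+ 2 = \sum_(i < d) partial i f x ^+ 2.
Proof. by rewrite enorm_sqr; apply: eq_bigr => i _; rewrite mxE. Qed.

Lemma continuous_enorm_grad f : class_C 1 f -> continuous (fun x => enorm (grad f x) ^+ 2).
Proof.
move=> Cf; under eq_fun do rewrite enorm_grad_sqr.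
have cpf i : continuous (partial i f) := class_C_continuous (class_C_partial i Cf).
by apply: continuous_fsum => i; exact: continuous_fM.
Qed.

Lemma boxed_enorm_grad f M : boxed M f -> boxed M (fun x => enorm (grad f x) ^+ 2).
Proof.
move=> bf x j Mx; rewrite enorm_grad_sqr big1// => i _.
by rewrite (boxed_partial i bf Mx) expr0n.
Qed.

Lemma H1_C1 (mu : probability 'rV[R]_d R) f M : class_C 1 f -> boxed M f ->
  H1 mu f (grad f).
Proof.
move=> Cf bf; have cf := class_C_continuous Cf; split.
- exact: weak_gradient_C1 bf.
- apply: Lfun2_sqr_integrable; first exact: continuous_measurable_rV.
  apply: (@integrable_boxed_finite _ M); first exact: continuous_fM.
  exact: boxedMl.
- have ce := continuous_enorm_grad Cf.
  apply: Lfun2_sqr_integrable.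
    rewrite (_ : enorm \o _ = fun x => Num.sqrt (enorm (grad f x) ^+ 2)).
      apply: continuous_measurable_rV => x.
      exact: (cvg_comp _ _ (ce x) (@sqrt_continuous R _)).
    by apply/funext => x; rewrite sqrtr_sqr ger0_norm// sqrtr_ge0.
  exact: (@integrable_boxed_finite _ M _ ce (boxed_enorm_grad bf)).
Qed.

End C1.

(** * The ground state transform *)

Section smooth_energy.
Context {R : realType} {d : nat}.
Variables (V W : 'rV[R]_d -> R) (mu nu : probability 'rV[R]_d R).
Hypothesis W_C1 : class_C 1 W.
Hypothesis Z_C2 : class_C 2 (Zfun V W).
Hypothesis mu_density : has_density mu (fun x => expR (- V x)).
Hypothesis nu_density : has_density nu (fun x => expR (- W x)).
Notation leb := (@lebesgue_rV R d).
Notation Z := (Zfun V W).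
Implicit Types (f : 'rV[R]_d -> R).

Lemma Zfun_potential x : V x = 2 * Z x + W x.
Proof. by rewrite /Zfun; field. Qed.

Let Z_C1 : class_C 1 Z. Proof. exact: class_CW Z_C2. Qed.

Lemma class_C1_V : class_C 1 V.
Proof.
rewrite (_ : V = fun x => 2 * Z x + W x); last exact/funext/Zfun_potential.
exact: (class_CD (class_CM (class_C_cst 1 2) Z_C1) W_C1).
Qed.

Lemma class_CN k f : class_C k f -> class_C k (fun x => - f x).
Proof.
move=> Cf; rewrite (_ : (fun x => _) = fun x => (-1) * f x).
  by apply: class_CM => //; exact: class_C_cst.
by apply/funext => x; rewrite mulN1r.
Qed.

Lemma partialN f i x : class_C 1 f -> partial i (fun y => - f y) x = - partial i f x.
Proof. by move=> Cf; apply: deriveN; exact: class_C_derivable Cf. Qed.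

Lemma continuous_weight (U : 'rV[R]_d -> R) : class_C 1 U -> continuous (fun x => expR (- U x)).
Proof. by move=> CU; exact: class_C_continuous (class_C1_expR (class_CN CU)). Qed.

Lemma Rintegral_boxed_density (U : 'rV[R]_d -> R) (rho : probability 'rV[R]_d R) f M :
  class_C 1 U -> has_density rho (fun x => expR (- U x)) ->
  continuous f -> boxed M f -> \int[rho]_x f x = \int[leb]_x (f x * expR (- U x)).
Proof.
move=> CU rhoU cf bf; apply: (Rintegral_density _ _ rhoU).
- exact: continuous_measurable_rV (continuous_weight CU).
- by move=> x; exact: expR_ge0.
- exact: integrable_boxed_finite cf bf.
Qed.

(* [d mu = exp (- 2 Z) d nu], so the L^2(nu) norm of [ground f] is the L^2(mu)
   norm of f. *)
Definition ground f x : R := f x * expR (- Z x).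

Lemma class_C1_ground f : class_C 1 f -> class_C 1 (ground f).
Proof. by move=> Cf; exact: (class_CM Cf (class_C1_expR (class_CN Z_C1))). Qed.

Lemma boxed_ground M f : boxed M f -> boxed M (ground f).
Proof. exact: boxedMl. Qed.

Lemma partial_ground f i x : class_C 1 f ->
  partial i (ground f) x = expR (- Z x) * (partial i f x - f x * partial i Z x).
Proof.
move=> Cf; rewrite (partialM i x Cf (class_C1_expR (class_CN Z_C1))).
rewrite (derive_expR_comp i x (class_CN Z_C1)).2 (partialN i x Z_C1); ring.
Qed.

Lemma weight_ground x : expR (- Z x) ^+ 2 * expR (- W x) = expR (- V x).
Proof. by rewrite expr2 -!expRD Zfun_potential; congr expR; ring. Qed.

(* The vector field whose divergence relates the two energies. *)
Let Phi f i x := f x * f x * partial i Z x * expR (- V x).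

Let Phi_C1 f i : class_C 1 f -> class_C 1 (Phi f i).
Proof.
move=> Cf; apply: class_CM; last exact: class_C1_expR (class_CN class_C1_V).
by apply: (class_CM (class_CM Cf Cf)); exact: class_C_partial Z_C2.
Qed.

Let partial_Phi f i x : class_C 1 f -> partial i (Phi f i) x =
  expR (- V x) * (2 * f x * partial i f x * partial i Z x +
    f x ^+ 2 * partial i (partial i Z) x -
    f x ^+ 2 * partial i Z x * (2 * partial i Z x + partial i W x)).
Proof.
move=> Cf; have CZ := class_C_partial i Z_C2.
have CV := class_C1_V.
have dV : partial i V x = 2 * partial i Z x + partial i W x.
  have VE : V = fun x => 2 * Z x + W x by exact/funext/Zfun_potential.
  have C2 : class_C 1 (fun _ : 'rV[R]_d => 2 : R) := class_C_cst 1 2.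
  have C2Z := class_CM C2 Z_C1.
  rewrite {1}VE {1}/partial deriveD; last 2 first.
  - exact: class_C_derivable C2Z.
  - exact: class_C_derivable W_C1.
  congr (_ + _); exact: (@deriveZ _ _ _ Z 2 x (delta_mx ord0 i) (class_C_derivable Z_C1)).
have Cff := class_CM Cf Cf.
rewrite (partialM i x (class_CM Cff CZ) (class_C1_expR (class_CN CV))).
rewrite (derive_expR_comp i x (class_CN CV)).2 (partialN i x CV) dV.
rewrite (partialM i x Cff CZ) (partialM i x Cf Cf); ring.
Qed.

(** The divergence of [Phi] has integral zero, so it may be subtracted freely; after that the two
    integrands can be compared at each point. *)
Lemma energy_ground_le f M (m : R) : class_C 1 f -> boxed M f ->
  (forall x, m <= delta V W x) ->
  energy nu (grad (ground f)) <= energy mu (grad f) - m * \int[mu]_x (f x ^+ 2).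
Proof.
move=> Cf bf hm; have cf := class_C_continuous Cf.
have Cw := class_C1_ground Cf; have bw := boxed_ground bf.
have CV := class_C1_V.
have cV := continuous_weight CV; have cW := continuous_weight W_C1.
have cf2 : continuous (fun x => f x ^+ 2) by exact: continuous_fM.
have bf2 : boxed M (fun x => f x ^+ 2) by exact: boxedMl.
have cE := continuous_enorm_grad Cf; have bE := boxed_enorm_grad bf.
rewrite /energy (Rintegral_boxed_density W_C1 nu_density (continuous_enorm_grad Cw) (boxed_enorm_grad bw)).
rewrite (Rintegral_boxed_density CV mu_density cE bE).
rewrite (Rintegral_boxed_density CV mu_density cf2 bf2).
have iE : leb.-integrable setT (EFin \o (fun x => enorm (grad f x) ^+ 2 * expR (- V x))).
  exact: (integrable_boxed (continuous_fM cE cV) (boxedMl _ bE)).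
have iS : leb.-integrable setT (EFin \o (fun x => f x ^+ 2 * expR (- V x))).
  exact: (integrable_boxed (continuous_fM cf2 cV) (boxedMl _ bf2)).
have bP i : boxed M (Phi f i).
  by move=> x j Mx; rewrite /Phi (bf x j Mx) !mul0r.
have iP i : leb.-integrable setT (EFin \o partial i (Phi f i)).
  apply: (integrable_boxed _ (boxed_partial i (bP i))).
  exact: class_C_continuous (class_C_partial i (@Phi_C1 f i Cf)).
have P0 : \int[leb]_x (\sum_(i < d) partial i (Phi f i) x) = 0.
  rewrite Rintegral_sum//; apply: big1 => i _.
  exact: (Rintegral_partial i (@Phi_C1 f i Cf) (bP i)).
have iPs : leb.-integrable setT (EFin \o (fun x => \sum_(i < d) partial i (Phi f i) x)).
  rewrite (_ : EFin \o _ = fun x => (\sum_(i < d) (partial i (Phi f i) x)%:E)%E).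
    by apply: integrable_sum => // j _; exact: iP.
  by apply/funext => x /=; rewrite sumEFin.
have imS := integrable_fZl m iS.
rewrite -(RintegralZl m measurableT iS).
rewrite -(RintegralB measurableT iE imS).
rewrite -[leRHS]subr0 -P0.
have iES := integrable_fB iE imS.
rewrite -(RintegralB measurableT iES iPs).
apply: le_Rintegral => //.
- exact: (integrable_boxed (continuous_fM (continuous_enorm_grad Cw) cW) (boxedMl _ (boxed_enorm_grad bw))).
- exact: (integrable_fB iES iPs).
move=> x _; rewrite -subr_ge0.
(* The cross terms [2 f grad f . grad Z] of [Phi] and of the squared gradient of [ground f] cancel,
   and grad V = 2 grad Z + grad W collects the rest into exactly [delta]. *)
have -> : enorm (grad f x) ^+ 2 * expR (- V x) - m * (f x ^+ 2 * expR (- V x)) -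
    \sum_(i < d) partial i (Phi f i) x -
    enorm (grad (ground f) x) ^+ 2 * expR (- W x) =
    (delta V W x - m) * (f x ^+ 2 * expR (- V x)).
  rewrite !enorm_grad_sqr /delta enorm_grad_sqr /dotmul /laplacian.
  have -> : \sum_(i < d) grad Z x ord0 i * grad W x ord0 i =
      \sum_(i < d) partial i Z x * partial i W x.
    by apply: eq_bigr => i _; rewrite !mxE.
  rewrite -sumrB -big_split/= mulrBl !mulr_suml.
  have K : \sum_(i < d) partial i f x ^+ 2 * expR (- V x) -
      \sum_(i < d) partial i (Phi f i) x -
      \sum_(i < d) partial i (ground f) x ^+ 2 * expR (- W x) =
    \sum_(i < d) (partial i Z x ^+ 2 - partial i (partial i Z) x +
      partial i Z x * partial i W x) * (f x ^+ 2 * expR (- V x)).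
    rewrite -!sumrB; apply: eq_bigr => i _.
    rewrite (partial_Phi i x Cf) (partial_ground i x Cf) exprMn.
    by rewrite [_ ^+ 2 * _ * expR (- W x)]mulrAC weight_ground; ring.
  by rewrite -K; ring.
by rewrite mulr_ge0 ?subr_ge0// mulr_ge0 ?sqr_ge0// expR_ge0.
Qed.

End smooth_energy.

(** * Interpolation inequalities for mu *)

Lemma best_constant_adherent (R : realType) (P : R -> Prop) (K : R) :
  (best_constant P <= K%:E)%E ->
  [/\ best_constant P \is a fin_num, 0 <= fine (best_constant P) &
   forall e, 0 < e ->
     exists C, [/\ 0 <= C, P C & C < fine (best_constant P) + e]].
Proof.
move=> PK.
have P0 : (0 <= best_constant P)%E.
  by apply: le_ereal_inf_tmp => _ /= [C [C0 _] <-]; rewrite lee_fin.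
have Pf : best_constant P \is a fin_num.
  by rewrite ge0_fin_numE// (le_lt_trans PK)// ltry.
split=> //; first by rewrite fine_ge0.
move=> e e0; have [_ [C [C0 PC] <-]] := lb_ereal_inf_adherent e0 Pf.
by rewrite -[X in (_ < X + _)%E](fineK Pf) -EFinD lte_fin => Ce; exists C.
Qed.

(** For a fixed function the right side is affine in the constant, so the inequality survives the
    passage to the infimum, which is finite since it is at most K. *)
Lemma best_constant_attained (R : realType) (I : Type) (A : I -> \bar R)
    (B : I -> R) (Q : I -> Prop) (P : R -> Prop) (K : R) :
  (forall C, P C -> forall i, Q i -> (A i <= (C * B i)%:E)%E) ->
  (forall i, 0 <= B i) ->
  (best_constant P <= K%:E)%E ->
  forall i, Q i -> (A i <= (fine (best_constant P) * B i)%:E)%E.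
Proof.
move=> PQ B0 PK i Qi; have [_ _ adh] := best_constant_adherent PK.
apply/lee_addgt0Pr => e e0; have B1 : 0 < B i + 1 by rewrite ltr_wpDl.
(* The excess over the infimum gets multiplied by [B i]; dividing by [B i + 1] keeps it below e even
   when [B i] is 0. *)
have [C [C0 PC Ce]] := adh (e / (B i + 1)) (divr_gt0 e0 B1).
apply: le_trans (PQ _ PC _ Qi) _; rewrite -EFinD lee_fin.
apply: le_trans (_ : (fine (best_constant P) + e / (B i + 1)) * B i <= _).
  by rewrite ler_wpM2r// ltW.
rewrite mulrDl lerD2l -mulrA ler_piMr ?(ltW e0)//.
rewrite mulrC ler_pdivrMr// mul1r.
by rewrite lerDl.
Qed.

Section hoelder_real.
Context d (T : measurableType d) (R : realType) (mu : {measure set T -> \bar R}).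

Lemma Lnorm_Rintegral (f : T -> R) (p : R) : 0 < p ->
  mu.-integrable setT (EFin \o (fun x => `|f x| `^ p)) ->
  'N[mu]_(p%:E)[EFin \o f]%E = ((\int[mu]_x (`|f x| `^ p)) `^ p^-1)%:E.
Proof.
move=> p0 fp; rewrite unlock -poweR_EFin; congr (_ `^ _)%E.
rewrite /Rintegral fineK; last exact: integrable_fin_num fp.
by [].
Qed.

Lemma Rhoelder (f g : T -> R) (p q a b : R) :
  measurable_fun setT f -> measurable_fun setT g ->
  0 < p -> 0 < q -> p^-1 + q^-1 = 1 ->
  'N[mu]_(p%:E)[EFin \o f]%E = a%:E -> 'N[mu]_(q%:E)[EFin \o g]%E = b%:E ->
  mu.-integrable setT (EFin \o (fun x => f x * g x)) /\
  \int[mu]_x `|f x * g x| <= a * b.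
Proof.
move=> mf mg p0 q0 pq fa gb.
have := hoelder mu mf mg p0 q0 pq; rewrite fa gb Lnorm1 => H.
have i : mu.-integrable setT (EFin \o (fun x => f x * g x)).
  apply/integrableP; split; first by apply/measurable_EFinP; exact: measurable_funM.
  by apply: le_lt_trans H _; rewrite ltry.
split=> //; rewrite -lee_fin /Rintegral fineK; first exact: H.
by apply: integrable_fin_num => //; exact: (integrable_abse i).
Qed.

End hoelder_real.

Lemma conj_expP (R : realType) (p : R) : 1 < p ->
  0 < conj_exp p /\ p^-1 + (conj_exp p)^-1 = 1.
Proof.
move=> p1; have p0 : 0 < p by rewrite (lt_trans _ p1).
have p10 : 0 < p - 1 by rewrite subr_gt0.
split; first exact: divr_gt0.
by rewrite /conj_exp invf_div -[X in X + _]mul1r -mulrDl addrC subrK divff// gt_eqF.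
Qed.

(* Young's inequality is the tangent line bound for [x `^ p]. *)
Lemma powR_sub_le (R : realType) (p a b : R) : 1 < p -> 0 <= a -> 0 <= b ->
  a `^ p - b `^ p <= p * a `^ (p - 1) * (a - b).
Proof.
move=> p1 a0 b0; have [q0 pq] := conj_expP p1.
have p0 : 0 < p by rewrite (lt_trans _ p1).
have p10 : p - 1 != 0 by rewrite gt_eqF// subr_gt0.
have := conjugate_powR b0 (powR_ge0 a (p - 1)) p0 q0 pq.
rewrite -powRrM /conj_exp mulrCA divff// mulr1 invf_div => H.
have aM : a `^ (p - 1) * a = a `^ p.
  have [->|an0] := eqVneq a 0; first by rewrite mulr0 powR0// gt_eqF.
  by rewrite -{2}[a]powRr1// -powRD ?an0 ?implybT// subrK.
have : p * (b * a `^ (p - 1)) <= b `^ p + (p - 1) * a `^ p.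
  rewrite -[leRHS](_ : p * (b `^ p / p + a `^ p * ((p - 1) / p)) = _).
    by rewrite ler_pM2l.
  by field; rewrite gt_eqF.
rewrite mulrBr -[X in _ <= X - _]mulrA aM; set y := a `^ _; set z := _ `^ p; nra.
Qed.

Section constants_attained.
Context {R : realType} {d : nat}.
Implicit Types (rho : probability 'rV[R]_d R) (u : 'rV[R]_d -> R)
  (G : 'rV[R]_d -> 'rV[R]_d).

Lemma energy_ge0 rho G : 0 <= energy rho G.
Proof. by apply: Rintegral_ge0 => x _; exact: sqr_ge0. Qed.

Let Q rho (i : ('rV[R]_d -> R) * ('rV[R]_d -> 'rV[R]_d)) := H1 rho i.1 i.2.

Let attained rho (A : ('rV[R]_d -> R) -> \bar R) (P : R -> Prop) K :
  (forall C, P C -> forall u G, H1 rho u G -> (A u <= (C * energy rho G)%:E)%E) ->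
  (best_constant P <= K%:E)%E -> forall u G, H1 rho u G ->
  (A u <= (fine (best_constant P) * energy rho G)%:E)%E.
Proof.
move=> PA PK u G uG.
apply: (@best_constant_attained R _ (fun i => A i.1) (fun i => energy rho i.2)
  (Q rho) P K _ _ PK (u, G) uG).
- by move=> C PC [v H] vH; exact: PA.
- by move=> i; exact: energy_ge0.
Qed.

Lemma C1_attained rho K u G : (C1 rho <= K%:E)%E -> H1 rho u G ->
  (entropy rho u <= (fine (C1 rho) * energy rho G)%:E)%E.
Proof. by move=> CK; apply: (attained _ CK) => C; exact. Qed.

Lemma C2_attained rho K u G : (C2 rho <= K%:E)%E -> H1 rho u G ->
  \int[rho]_x (`|u x - \int[rho]_y u y| ^+ 2) <= fine (C2 rho) * energy rho G.
Proof.
move=> CK uG; rewrite -lee_fin.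
apply: (attained (A := fun u => (\int[rho]_x (`|u x - \int[rho]_y u y| ^+ 2))%:E) _ CK uG).
by move=> C HC v H vH; rewrite lee_fin; exact: HC.
Qed.

Lemma Cp_attained p rho K u G : (Cp p rho <= K%:E)%E -> H1 rho u G ->
  (p - 1)^-1 * (\int[rho]_x (`|u x| ^+ 2) -
                (\int[rho]_x (`|u x| `^ (2 / p))) `^ p)
  <= fine (Cp p rho) * energy rho G.
Proof.
move=> CK uG; rewrite -lee_fin.
apply: (attained (A := fun u => ((p - 1)^-1 * (\int[rho]_x (`|u x| ^+ 2) -
  (\int[rho]_x (`|u x| `^ (2 / p))) `^ p))%:E) _ CK uG).
by move=> C HC v H vH; rewrite lee_fin; exact: HC.
Qed.

End constants_attained.

Lemma Lnorm_probability_cst1 d (T : measurableType d) (R : realType)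
    (P : probability T R) (r : R) :
  'N[P]_(r%:E)[EFin \o cst (1 : R)%R]%E = 1%E.
Proof.
have -> : EFin \o cst (1 : R) = cst 1%E :> (T -> \bar R) by [].
by rewrite Lnorm_cst1 /= probability_setT poweR1r.
Qed.

Section interpolation.
Context {R : realType} {d : nat}.
Variables (V W : 'rV[R]_d -> R) (mu nu : probability 'rV[R]_d R).
Hypothesis W_C1 : class_C 1 W.
Hypothesis Z_C2 : class_C 2 (Zfun V W).
Hypothesis mu_density : has_density mu (fun x => expR (- V x)).
Hypothesis nu_density : has_density nu (fun x => expR (- W x)).
Notation leb := (@lebesgue_rV R d).
Notation Z := (Zfun V W).

Let measurable_powR_norm (f : 'rV[R]_d -> R) q : measurable_fun setT f ->
  measurable_fun setT (fun x => `|f x| `^ q).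
Proof.
move=> mf; apply: (measurableT_comp (measurable_powR q)).
exact: (measurableT_comp (@normr_measurable R setT) mf).
Qed.

Let powR_norm_bounded (f : 'rV[R]_d -> R) q C : 0 <= q ->
  (forall x, `|f x| <= C) -> forall x, `| `|f x| `^ q| <= C `^ q.
Proof.
move=> q0 fC x; rewrite ger0_norm ?powR_ge0//.
apply: ge0_ler_powR => //; rewrite ?nnegrE//.
by rewrite (le_trans _ (fC x)).
Qed.

Lemma Rintegral_ground_sqr f M : class_C 1 f -> boxed M f ->
  \int[nu]_x (ground V W f x ^+ 2) = \int[mu]_x (f x ^+ 2).
Proof.
move=> Cf bf; have cf := class_C_continuous Cf.
have cw := class_C_continuous (class_C1_ground Z_C2 Cf).
have bw := @boxed_ground _ _ V W _ _ bf.
rewrite (Rintegral_boxed_density (class_C1_V W_C1 Z_C2) mu_density (continuous_fM cf cf) (boxedMl _ bf)).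
rewrite (Rintegral_boxed_density W_C1 nu_density (continuous_fM cw cw) (boxedMl _ bw)).
apply: eq_Rintegral => x _; rewrite -!expr2 -(weight_ground V W) /ground exprMn.
by rewrite mulrA.
Qed.

Lemma powR_ground f (q : R) x :
  `|ground V W f x| `^ q * (1 - (2 - q) * Z x) * expR (- W x) <=
  `|f x| `^ q * expR (- V x).
Proof.
have -> : `|ground V W f x| `^ q = `|f x| `^ q * expR (- (q * Z x)).
  rewrite /ground normrM powRM//; congr (_ * _).
  by rewrite (ger0_norm (expR_ge0 _)) -expRM mulNr mulrC.
rewrite -!mulrA ler_wpM2l ?powR_ge0//.
have -> : - V x = - (q * Z x) + (- (2 - q) * Z x + - W x).
  by rewrite (Zfun_potential V W); ring.
rewrite !expRD; apply: ler_wpM2l; first exact: expR_ge0.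
apply: ler_wpM2r; first exact: expR_ge0.
by apply: le_trans (expR_ge1Dx _); rewrite mulNr.
Qed.

Variable p : R.
Hypothesis p1 : 1 < p.
Hypothesis Zp : Z \in Lfun nu (conj_exp p)%:E.
Hypothesis Np : Z_norm V W nu p \is a fin_num.

Let N := fine (Z_norm V W nu p).

(** The function [|w| ^ (2/p)] has norm [S ^ (1/p)] in L^p(nu). Hoelder's inequality with exponents
    p and p' is used twice, against the constant 1 for the first bound and against Z for the
    second. *)
Lemma Rintegral_powR_ground_le f M : class_C 1 f -> boxed M f ->
  let a := \int[nu]_x (`|ground V W f x| `^ (2 / p)) in
  let S := \int[mu]_x (f x ^+ 2) in
  a <= S `^ p^-1 /\
  a - (2 - 2 / p) * (S `^ p^-1 * N) <= \int[mu]_x (`|f x| `^ (2 / p)).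
Proof.
move=> Cf bf a S.
have p0 : 0 < p by rewrite (lt_trans _ p1).
have q0 : 0 < 2 / p by rewrite divr_gt0.
have [p'0 pp'] := conj_expP p1.
have cf := class_C_continuous Cf.
have Cw := class_C1_ground Z_C2 Cf; have cw := class_C_continuous Cw.
have bw := @boxed_ground _ _ V W _ _ bf.
set w := ground V W f in a Cw cw bw *.
have mw := measurable_powR_norm (2 / p) (continuous_measurable_rV cw).
have mf := measurable_powR_norm (2 / p) (continuous_measurable_rV cf).
have mZ := Lfun_measurable Zp.
have [Cf0 _ fC] := boxed_bounded cf bf; have [Cw0 _ wC] := boxed_bounded cw bw.
have iw := bounded_integrable nu mw (powR_norm_bounded (ltW q0) wC).
have if_ := bounded_integrable mu mf (powR_norm_bounded (ltW q0) fC).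
have wp x : `| `|w x| `^ (2 / p)| `^ p = w x ^+ 2.
  rewrite ger0_norm ?powR_ge0// -powRrM divfK ?gt_eqF// powR_mulrn//.
  by rewrite real_normK// num_real.
have Nw : 'N[nu]_(p%:E)[EFin \o (fun x => (`|w x| `^ (2 / p))%R)]%E = (S `^ p^-1)%:E.
  rewrite Lnorm_Rintegral//.
    congr (_ `^ _)%:E; rewrite /S -(Rintegral_ground_sqr Cf bf).
    by apply: eq_Rintegral => x _; rewrite wp.
  have -> : (fun x => `| `|w x| `^ (2 / p)| `^ p) = (fun x => w x ^+ 2).
    by apply/funext => x; rewrite wp.
  exact: (integrable_boxed_finite _ (continuous_fM cw cw) (boxedMl _ bw)).
have NZ : 'N[nu]_((conj_exp p)%:E)[EFin \o Z]%E = N%:E by rewrite /N fineK.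
have N1 : 'N[nu]_((conj_exp p)%:E)[EFin \o cst (1 : R)%R]%E = 1%:E.
  exact: (Lnorm_probability_cst1 nu (conj_exp p)).
have [iZ HZ] := Rhoelder mw mZ p0 p'0 pp' Nw NZ.
have mcst : measurable_fun [set: 'rV[R]_d] (cst (1 : R)) by exact: measurable_cst.
have [_ H1'] := Rhoelder mw mcst p0 p'0 pp' Nw N1.
split.
  rewrite mulr1 in H1'; apply: le_trans H1'; rewrite le_eqVlt; apply/orP; left.
  by apply/eqP/eq_Rintegral => x _; rewrite /= mulr1 [in RHS](ger0_norm (powR_ge0 _ _)).
have t0 : 0 <= 2 - 2 / p.
  by rewrite subr_ge0 ler_pdivrMr// ler_pMr// ltW.
apply: le_trans (_ : a - (2 - 2 / p) * \int[nu]_x (`|w x| `^ (2 / p) * Z x) <= _).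
  rewrite lerD2l lerN2 ler_wpM2l//; apply: le_trans HZ.
  by apply: le_trans (le_normr_Rintegral measurableT iZ); exact: ler_norm.
have itZ := integrable_fZl (2 - 2 / p) iZ.
rewrite -(RintegralZl _ measurableT iZ) /a -(RintegralB measurableT iw itZ).
have itw := integrable_fB iw itZ.
have CV := class_C1_V W_C1 Z_C2.
have mV := continuous_measurable_rV (continuous_weight CV).
have mW := continuous_measurable_rV (continuous_weight W_C1).
have V0 x : 0 <= expR (- V x) by exact: expR_ge0.
have W0 x : 0 <= expR (- W x) by exact: expR_ge0.
rewrite (Rintegral_density mV V0 mu_density if_).
rewrite (Rintegral_density mW W0 nu_density itw).
apply: le_Rintegral => //.
- apply: ((integrable_density mW W0 nu_density _).1 itw).
  by apply/measurable_EFinP; exact: measurable_int itw.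
- exact: ((integrable_density mV V0 mu_density mf).1 if_).
move=> x _; apply: le_trans (powR_ground f (2 / p) x).
by rewrite -/w mulrBr mulr1 mulrCA.
Qed.

(** The difference splits as [(S - a ^ p) + (a ^ p - b ^ p)]. The first part is the p-inequality for
    nu. In the second the tangent bound yields the factor p (2 - 2/p) = 2 (p - 1), which compensates
    (p - 1)^-1, and [a ^ (p - 1) * S ^ (1/p) <= S] because [a <= S ^ (1/p)]. *)
Lemma interpolation_ground f M K m : class_C 1 f -> boxed M f ->
  (Cp p nu <= K%:E)%E -> (forall x, m <= delta V W x) ->
  let S := \int[mu]_x (f x ^+ 2) in
  (p - 1)^-1 * (S - (\int[mu]_x (`|f x| `^ (2 / p))) `^ p) <=
  fine (Cp p nu) * (energy mu (grad f) - m * S) + 2 * N * S.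
Proof.
move=> Cf bf CK hm /=; set S := \int[mu]_x (f x ^+ 2).
have := Rintegral_powR_ground_le Cf bf; rewrite /= -/S.
have Cw := class_C1_ground Z_C2 Cf; have bw := @boxed_ground _ _ V W _ _ bf.
set a := \int[nu]_x _; set b := \int[mu]_x (_ `^ _) => -[aS ab].
have p0 : 0 < p by rewrite (lt_trans _ p1).
have p10 : 0 < p - 1 by rewrite subr_gt0.
have S0 : 0 <= S by apply: Rintegral_ge0 => x _; exact: sqr_ge0.
have a0 : 0 <= a by apply: Rintegral_ge0 => x _; exact: powR_ge0.
have b0 : 0 <= b by apply: Rintegral_ge0 => x _; exact: powR_ge0.
have N0 : 0 <= N by apply: fine_ge0; exact: Lnorm_ge0.
have [_ c0 _] := best_constant_adherent CK.
have HC : (p - 1)^-1 * (S - a `^ p) <= fine (Cp p nu) * energy nu (grad (ground V W f)).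
  have := Cp_attained CK (H1_C1 nu Cw bw); rewrite -/a.
  rewrite [X in (_ * (X - _))](_ : _ = S)// /S -(Rintegral_ground_sqr Cf bf).
  by apply: eq_Rintegral => x _; rewrite real_normK// num_real.
have HE := energy_ground_le W_C1 Z_C2 mu_density nu_density Cf bf hm.
have Hab : a `^ p - b `^ p <= (p - 1) * (2 * N * S).
  apply: le_trans (powR_sub_le p1 a0 b0) _.
  apply: le_trans (_ : p * a `^ (p - 1) * ((2 - 2 / p) * (S `^ p^-1 * N)) <= _).
    by rewrite ler_wpM2l ?mulr_ge0 ?powR_ge0 ?(ltW p0)//; rewrite lerBlDr addrC -lerBlDr.
  have aS' : a `^ (p - 1) * S `^ p^-1 <= S.
    apply: le_trans (_ : (S `^ p^-1) `^ (p - 1) * S `^ p^-1 <= _).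
      rewrite ler_wpM2r ?powR_ge0//; apply: ge0_ler_powR; rewrite ?nnegrE ?powR_ge0//.
      exact: ltW.
    have [->|Sn0] := eqVneq S 0; first by rewrite [X in _ * X]powR0 ?mulr0// invr_eq0 gt_eqF.
    rewrite -powRrM -powRD ?Sn0 ?implybT// -[X in _ `^ (_ + X)]mulr1 -mulrDr subrK mulVf ?gt_eqF//.
    by rewrite powRr1.
  have -> : p * a `^ (p - 1) * ((2 - 2 / p) * (S `^ p^-1 * N)) =
      (p - 1) * (2 * N * (a `^ (p - 1) * S `^ p^-1)).
    by field; rewrite gt_eqF.
  apply: ler_wpM2l; first exact: ltW.
  by apply: ler_wpM2l => //; rewrite mulr_ge0.
have -> : S - b `^ p = (S - a `^ p) + (a `^ p - b `^ p) by rewrite addrA subrK.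
rewrite mulrDr; apply: lerD.
  by apply: le_trans HC _; rewrite ler_wpM2l.
by rewrite mulrC ler_pdivrMr// mulrC.
Qed.

End interpolation.

(** * The limit p -> 1 *)

Lemma expRN_le (R : realType) (z : R) : - 2^-1 <= z ->
  expR (- z) <= 1 - z + 2 * z ^+ 2.
Proof.
move=> z1; have z0 : 0 < 1 + z by lra.
rewrite expRN; apply: le_trans (_ : (1 + z)^-1 <= _).
  by rewrite lef_pV2 ?posrE ?expR_gt0// expR_ge1Dx.
rewrite -[leLHS]mul1r ler_pdivrMr//.
have -> : (1 - z + 2 * z ^+ 2) * (1 + z) = 1 + z ^+ 2 * (1 + 2 * z) by ring.
by rewrite lerDl mulr_ge0 ?sqr_ge0//; lra.
Qed.

(** With y = - t L / 2 the left side is [(2 / t)^2 * (exp(-y) * y)^2]; the first factor is at most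
    16 and the second at most 1. *)
Lemma expR_ln_sqr_le (R : realType) (t L : R) : 2^-1 <= t -> L <= 0 ->
  expR (t * L) * L ^+ 2 <= 16.
Proof.
move=> t1 L0; pose y := - (t * L) / 2.
have y0 : 0 <= y by rewrite /y divr_ge0// oppr_ge0 mulr_ge0_le0//; lra.
have t0 : 0 < t by lra.
have -> : expR (t * L) = expR (- y) ^+ 2.
  by rewrite expr2 -expRD; congr expR; rewrite /y; field.
have -> : L = - (2 / t) * y by rewrite /y; field; rewrite gt_eqF.
rewrite -exprMn mulrCA exprMn.
have h1 : (- (2 / t)) ^+ 2 <= 16.
  rewrite sqrrN (_ : 16 = 4 ^+ 2); last by ring.
  rewrite lerXn2r ?nnegrE//; first by rewrite divr_ge0// ltW.
  by rewrite ler_pdivrMr//; lra.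
have h2 : (expR (- y) * y) ^+ 2 <= 1.
  rewrite expr_le1//; last exact: mulr_ge0 (expR_ge0 _) y0.
  rewrite expRN mulrC ler_pdivrMr ?expR_gt0// mul1r.
  by apply: le_trans (expR_ge1Dx y); rewrite lerDr.
by rewrite -[leRHS]mulr1; apply: ler_pM; rewrite ?sqr_ge0.
Qed.

(** Expansion of [x ^ t] to second order at t = 1, with a remainder uniform in x. The constant 16
    takes care of x < 1, where the logarithm is unbounded but damped by the power, and [C ^+ 3] of x
    >= 1. It will be used at t = 1/p. *)
Lemma powR_taylor (R : realType) (C t x : R) : 2^-1 <= t <= 1 -> 0 <= x <= C ->
  x `^ t <= x - (1 - t) * (x * ln x) + (1 - t) ^+ 2 * (16 + C ^+ 3).
Proof.
move=> /andP[t1 t2] /andP[x0 xC].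
have C0 : 0 <= C by exact: le_trans xC.
have M0 : 0 <= 16 + C ^+ 3 by rewrite addr_ge0// exprn_ge0.
have [->|xn0] := eqVneq x 0.
  rewrite powR0; last by rewrite gt_eqF//; lra.
  by rewrite mul0r mulr0 subr0 add0r mulr_ge0// sqr_ge0.
have xp : 0 < x by rewrite lt_def xn0.
rewrite -{2 3}(lnK xp) {1}/powR (negbTE xn0).
set L := ln x; set h := 1 - t.
have h0 : 0 <= h by rewrite subr_ge0.
have [L0|L0] := leP 0 L.
  have -> : expR (t * L) = expR L * expR (- (h * L)).
    by rewrite -expRD; congr expR; rewrite /h; ring.
  have hL : 0 <= h * L by rewrite mulr_ge0.
  have e1 : expR (- (h * L)) <= 1 - h * L + (h * L) ^+ 2.
    have := expR_ge1Dx (h * L); have := expR_gt0 (h * L) => ep e1.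
    rewrite expRN; apply: le_trans (_ : (1 + h * L)^-1 <= _).
      by rewrite lef_pV2 ?posrE//; lra.
    rewrite -[leLHS]mul1r ler_pdivrMr; last lra.
    have -> : (1 - h * L + (h * L) ^+ 2) * (1 + h * L) = 1 + (h * L) ^+ 3 by ring.
    by rewrite lerDl exprn_ge0.
  apply: le_trans (_ : expR L * (1 - h * L + (h * L) ^+ 2) <= _).
    by rewrite ler_wpM2l// expR_ge0.
  have -> : expR L * (1 - h * L + (h * L) ^+ 2) =
     expR L - h * (expR L * L) + h ^+ 2 * (expR L * L ^+ 2) by ring.
  rewrite lerD2l ler_wpM2l ?sqr_ge0//.
  have Lx : L <= C by apply: le_trans xC; rewrite -[leRHS](lnK xp); have := expR_ge1Dx L; rewrite /L; lra.
  have : expR L * L ^+ 2 <= C * C ^+ 2.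
    rewrite ler_pM ?expR_ge0 ?sqr_ge0//; first by rewrite lnK.
    by rewrite lerXn2r ?nnegrE.
  by rewrite -exprS => /le_trans; apply; rewrite lerDr.
have -> : expR L = expR (t * L) * expR (h * L).
  by rewrite -expRD; congr expR; rewrite /h; ring.
have := expR_ge1Dx (h * L) => e1.
have hL : h * L <= 0 by rewrite mulr_ge0_le0// ltW.
have e2 : 1 - (h * L) ^+ 2 <= expR (h * L) * (1 - h * L).
  have -> : 1 - (h * L) ^+ 2 = (1 + h * L) * (1 - h * L) by ring.
  by rewrite ler_wpM2r// subr_ge0 (le_trans hL).
have e3 := expR_ln_sqr_le t1 (ltW L0).
rewrite -lerBlDr.
apply: le_trans (_ : expR (t * L) * (1 - (h * L) ^+ 2) <= _).
  have -> : expR (t * L) * (1 - (h * L) ^+ 2) =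
    expR (t * L) - h ^+ 2 * (expR (t * L) * L ^+ 2) by ring.
  rewrite lerD2l lerN2 ler_wpM2l ?sqr_ge0//; apply: le_trans e3 _.
  by rewrite lerDl exprn_ge0.
have -> : expR (t * L) * expR (h * L) - h * (expR (t * L) * expR (h * L) * L) =
  expR (t * L) * (expR (h * L) * (1 - h * L)) by ring.
by rewrite ler_wpM2l// expR_ge0.
Qed.

(** The real-variable end of the limit, with h = p - 1, e the normalized entropy and psi the p-th
    power of the normalized integral. Expanding the exponential to second order leaves S e with an
    error of order h; the two smallness conditions on h validate the expansion and put that error
    below eps. *)
Lemma tsallis_bound (R : realType) (S e M eps h psi : R) :
  0 <= S -> 0 <= M -> 0 < h -> h * (`|e| + M + 1) <= 2^-1 ->
  h * (S * (M + 2 * (`|e| + M) ^+ 2) + 1) <= eps ->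
  psi <= expR (- (h * (e - h * M))) ->
  S * e - eps <= h^-1 * (S - S * psi).
Proof.
set B := `|e| + M => S0 M0 h0 hB hD hpsi.
have B0 : 0 <= B by rewrite addr_ge0.
have h1 : h <= 1 by nra.
have zB : `|e - h * M| <= B.
  rewrite (le_trans (ler_normB _ _))// lerD2l ger0_norm ?mulr_ge0// ?(ltW h0)//.
  by rewrite ler_piMl.
set y := e - h * M in hpsi zB.
have z1 : - 2^-1 <= h * y.
  have : `|h * y| <= 2^-1.
    rewrite normrM (gtr0_norm h0); apply: le_trans hB; rewrite ler_wpM2l ?(ltW h0)//.
    by apply: le_trans zB _; rewrite lerDl.
  by rewrite ler_norml => /andP[].
have hpsi' := le_trans hpsi (expRN_le z1).
have y2 : y ^+ 2 <= B ^+ 2.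
  by rewrite -real_normK ?num_real// lerXn2r ?nnegrE.
have key : S * (h * (y - 2 * h * B ^+ 2)) <= S - S * psi.
  have -> : S - S * psi = S * (1 - psi) by ring.
  apply: ler_wpM2l => //.
  have hy : h ^+ 2 * y ^+ 2 <= h ^+ 2 * B ^+ 2 by rewrite ler_wpM2l ?sqr_ge0.
  move: hpsi'; rewrite exprMn; move: hy.
  have -> : h * (y - 2 * h * B ^+ 2) = h * y - 2 * (h ^+ 2 * B ^+ 2) by ring.
  by move: (h ^+ 2 * y ^+ 2) (h ^+ 2 * B ^+ 2) (h * y) => *; lra.
rewrite ler_pdivlMl//; apply: le_trans key.
have -> : S * (h * (y - 2 * h * B ^+ 2)) = h * (S * (y - 2 * h * B ^+ 2)) by ring.
rewrite ler_pM2l//.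
have -> : S * (y - 2 * h * B ^+ 2) = S * e - h * (S * (M + 2 * B ^+ 2)) by rewrite /y; ring.
rewrite lerD2l lerN2; apply: le_trans hD; rewrite ler_pM2l//.
by rewrite lerDl.
Qed.

Section tsallis.
Context d (T : measurableType d) (R : realType) (mu : probability T R).
Variables (F : T -> R) (C : R).
Hypotheses (mF : measurable_fun setT F) (F0 : forall x, 0 <= F x)
  (FC : forall x, F x <= C).

Let S := \int[mu]_x F x.
Hypothesis S0 : 0 < S.

Let iF : mu.-integrable setT (EFin \o F).
Proof. by apply: bounded_integrable mF _ => x; rewrite ger0_norm. Qed.

Let G x := F x / S.
Let G0 x : 0 <= G x. Proof. by rewrite divr_ge0// ltW. Qed.
Let GC x : G x <= C / S. Proof. by rewrite ler_pM2r// invr_gt0. Qed.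
Let mG : measurable_fun setT G.
Proof. exact: measurable_funM mF (measurable_cst _). Qed.
Let iG : mu.-integrable setT (EFin \o G).
Proof. by apply: bounded_integrable mG _ => x; rewrite ger0_norm. Qed.

Let iGL : mu.-integrable setT (EFin \o (fun x => G x * ln (G x))).
Proof.
apply: (@bounded_integrable _ _ _ _ _ (1 + (C / S) ^+ 2)).
  exact: measurable_funM mG (measurableT_comp (@measurable_ln R) mG).
move=> x; have C0 : 0 <= C / S := le_trans (G0 x) (GC x).
have [->|Gn0] := eqVneq (G x) 0; first by rewrite mul0r normr0 addr_ge0// sqr_ge0.
have Gp : 0 < G x by rewrite lt_def Gn0 G0.
have lx : ln (G x) <= G x.
  by rewrite -[leRHS](lnK Gp); have := expR_ge1Dx (ln (G x)); lra.
have lV : - ln (G x) <= (G x)^-1.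
  by rewrite -lnV// -[leRHS](@lnK _ (G x)^-1) ?posrE ?invr_gt0//; have := expR_ge1Dx (ln (G x)^-1); lra.
rewrite ler_norml; apply/andP; split.
  rewrite lerNl -mulrN; apply: le_trans (_ : 1 <= _); last by rewrite lerDl sqr_ge0.
  by rewrite -(mulfV Gn0) ler_wpM2l.
apply: le_trans (_ : (C / S) ^+ 2 <= _); last by rewrite lerDr.
rewrite expr2; apply: le_trans (_ : G x * G x <= _); first by rewrite ler_wpM2l.
by rewrite ler_pM.
Qed.

Let M := 16 + (C / S) ^+ 3.
Let e := \int[mu]_x (G x * ln (G x)).

Let C0 : 0 <= C / S.
Proof.
have : (0 < mu setT)%E by rewrite probability_setT.
have [[x _] _|noT] := pselect (exists x : T, True); first exact: (le_trans (G0 x) (GC x)).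
by rewrite (_ : [set: T] = set0) ?measure0 ?ltxx//; apply/seteqP; split => x // _; apply: noT; exists x.
Qed.

Let M0 : 0 <= M. Proof. by rewrite addr_ge0// exprn_ge0. Qed.

Let int1 : \int[mu]_x G x = 1.
Proof.
rewrite /G; under eq_Rintegral do rewrite mulrC.
by rewrite (RintegralZl _ measurableT iF) mulVf// gt_eqF.
Qed.

Let iGp t : 0 <= t -> mu.-integrable setT (EFin \o (fun x => G x `^ t)).
Proof.
move=> t0; apply: (@bounded_integrable _ _ _ _ _ ((C / S) `^ t)).
  exact: measurableT_comp (measurable_powR t) mG.
move=> x; rewrite ger0_norm ?powR_ge0//.
by apply: ge0_ler_powR; rewrite ?nnegrE.
Qed.

Let phi_le t : 2^-1 <= t <= 1 ->
  \int[mu]_x (G x `^ t) <= 1 - (1 - t) * e + (1 - t) ^+ 2 * M.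
Proof.
move=> t12; have t0 : 0 <= t by case/andP : t12 => ? _; lra.
have iZ := integrable_fZl (1 - t) iGL.
have iD := integrable_fB iG iZ.
have ic : mu.-integrable setT (EFin \o cst ((1 - t) ^+ 2 * M)).
  apply: (@bounded_integrable _ _ _ _ _ `|(1 - t) ^+ 2 * M|) => //.
have -> : 1 - (1 - t) * e + (1 - t) ^+ 2 * M =
    \int[mu]_x ((G x - (1 - t) * (G x * ln (G x))) + (1 - t) ^+ 2 * M).
  rewrite (RintegralD measurableT iD ic) (RintegralB measurableT iG iZ).
  rewrite (RintegralZl _ measurableT iGL) int1 Rintegral_cst//.
  by rewrite /= probability_setT /= mulr1.
apply: le_Rintegral => //; first exact: iGp.
  exact: integrable_fD iD ic.
by move=> x _; apply: powR_taylor => //; rewrite G0 GC.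
Qed.

Let powR_phi_le p : 1 < p < 2 ->
  (\int[mu]_x (G x `^ p^-1)) `^ p <= expR (- ((p - 1) * (e - (p - 1) * M))).
Proof.
move=> /andP[p1 p2]; have p0 : 0 < p by lra.
have pV : 2^-1 <= p^-1 <= 1.
  by rewrite lef_pV2 ?posrE// (ltW p2)/= invf_le1// ltW.
have phi0 : 0 <= \int[mu]_x (G x `^ p^-1).
  by apply: Rintegral_ge0 => x _; exact: powR_ge0.
(* The bound [1 + x <= expR x] turns the p-th power into a multiplication of the exponent by p, and
   p (1 - 1/p) = p - 1. *)
apply: le_trans (_ : expR (\int[mu]_x (G x `^ p^-1) - 1) `^ p <= _).
  apply: ge0_ler_powR; rewrite ?nnegrE ?expR_ge0//; first exact: ltW.
  by have := expR_ge1Dx (\int[mu]_x (G x `^ p^-1) - 1); rewrite addrC subrK.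
rewrite -expRM ler_expR.
apply: le_trans (_ : (- (1 - p^-1) * (e - (p - 1) * M)) * p <= _).
  rewrite ler_pM2r// lerBlDl (le_trans (phi_le pV))//.
  rewrite -subr_ge0.
  have -> : 1 + - (1 - p^-1) * (e - (p - 1) * M) - (1 - (1 - p^-1) * e + (1 - p^-1) ^+ 2 * M) =
      (p - 1) ^+ 3 / p ^+ 2 * M by field; rewrite gt_eqF.
  by rewrite mulr_ge0// divr_ge0 ?sqr_ge0// exprn_ge0// subr_ge0 ltW.
rewrite le_eqVlt; apply/orP; left; apply/eqP.
by field; rewrite gt_eqF.
Qed.

(** Half of the convergence to the entropy, the half that bounds the entropy from above. Dividing F
    by its mean S makes the expansion of the integral of [G ^ (1/p)] start at 1, and boundedness of
    F makes its remainder integrable. *)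
Lemma entropy_le_tsallis (eps : R) : 0 < eps ->
  \forall p \near 1^'+, \int[mu]_x (F x * ln (F x / S)) - eps <=
    (p - 1)^-1 * (S - (\int[mu]_x (F x `^ p^-1)) `^ p).
Proof.
move=> eps0; pose B := `|e| + M; pose D := S * (M + 2 * B ^+ 2) + 1.
have B0 : 0 <= B by rewrite addr_ge0.
have D0 : 0 < D by rewrite ltr_wpDl// mulr_ge0 ?(ltW S0)// addr_ge0// mulr_ge0// sqr_ge0.
pose r := Num.min (2^-1 / (B + 1)) (eps / D).
have r0 : 0 < r by rewrite lt_min !divr_gt0// ltr_wpDl.
exists r => //= p /= pr p1.
have h0 : 0 < p - 1 by rewrite subr_gt0.
have : p - 1 < r by rewrite -(ger0_norm (ltW h0)) distrC.
rewrite lt_min => /andP[hB hD].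
have B1 : 0 < B + 1 by rewrite ltr_wpDl.
have hB' : (p - 1) * (B + 1) <= 2^-1 by move: hB; rewrite ltr_pdivlMr// => /ltW.
have hD' : (p - 1) * D <= eps by move: hD; rewrite ltr_pdivlMr// => /ltW.
have p2 : p < 2 by nra.
have p0 : 0 < p by lra.
have intF : \int[mu]_x (F x * ln (F x / S)) = S * e.
  rewrite /e -(RintegralZl _ measurableT iGL); apply: eq_Rintegral => x _.
  by rewrite mulrA /G [S * _]mulrC divfK// gt_eqF.
have intFp : (\int[mu]_x (F x `^ p^-1)) `^ p = S * (\int[mu]_x (G x `^ p^-1)) `^ p.
  have -> : \int[mu]_x (F x `^ p^-1) = S `^ p^-1 * \int[mu]_x (G x `^ p^-1).
    rewrite -(RintegralZl _ measurableT); last by apply: iGp; rewrite invr_ge0 ltW.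
    apply: eq_Rintegral => x _; rewrite -powRM ?(ltW S0)//.
    by rewrite /G [S * _]mulrC divfK// gt_eqF.
  rewrite powRM ?powR_ge0//; last by apply: Rintegral_ge0 => x _; exact: powR_ge0.
  by rewrite -powRrM mulVf ?gt_eqF// powRr1// ltW.
rewrite intF intFp; set psi := (\int[mu]_x _) `^ p.
have hpsi : psi <= expR (- ((p - 1) * (e - (p - 1) * M))) by apply: powR_phi_le; rewrite p1.
exact: (tsallis_bound (ltW S0) M0 h0 hB' hD' hpsi).
Qed.

End tsallis.

(** * Lower semicontinuity of the entropy *)

Lemma limf_einf_le_cst (T : choiceType) (X : filteredType T) (R : realType)
    (F : set_system X) (u : X -> \bar R) (c : \bar R) : ProperFilter F ->
  (forall x, (u x <= c)%E) -> (limf_einf u F <= c)%E.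
Proof.
move=> PF uc; rewrite limf_einfE; apply: ge_ereal_sup => _ [V FV <-].
have [x Vx] := filter_ex FV.
by apply: le_trans (uc x); apply: ereal_inf_lbound; exists x.
Qed.

(** If [u] stayed at or above the lower limit plus e on V, its infimum there would exceed the
    supremum of such infima. Nothing more than one point in each V can be expected. *)
Lemma limf_einf_frequently (T : choiceType) (X : filteredType T) (R : realType)
    (F : set_system X) (u : X -> \bar R) (V : set X) (e : R) : Filter F ->
  limf_einf u F \is a fin_num -> 0 < e -> F V ->
  exists2 x, V x & (u x < limf_einf u F + e%:E)%E.
Proof.
move=> FF Lfin e0 FV; apply: contrapT => H.
have : (limf_einf u F + e%:E <= limf_einf u F)%E.
  rewrite {2}limf_einfE; apply: le_trans (_ : ereal_inf (u @` V) <= _)%E.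
    apply: le_ereal_inf_tmp => _ [x Vx <-]; rewrite leNgt; apply/negP => ux.
    by apply: H; exists x.
  by apply: ereal_sup_ubound; exists V.
by rewrite -(fineK Lfin) -EFinD lee_fin gerDl leNgt e0.
Qed.

(** Young's inequality for [2 * b * (a - b)] with a free weight c, to be taken small so that
    closeness in L^2 yields closeness of squared norms. *)
Lemma sqr_sub_le {R : realFieldType} (c a b : R) : 0 < c ->
  `|a ^+ 2 - b ^+ 2| <= c * b ^+ 2 + (1 + c^-1) * (a - b) ^+ 2.
Proof.
move=> c0; have Kp : 0 <= (c * b - (a - b)) ^+ 2 / c by rewrite divr_ge0 ?sqr_ge0// ltW.
have Km : 0 <= (c * b + (a - b)) ^+ 2 / c by rewrite divr_ge0 ?sqr_ge0// ltW.
rewrite ler_norml; apply/andP; split; rewrite -subr_ge0.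
  apply: le_trans (_ : (c * b + (a - b)) ^+ 2 / c + 2 * (a - b) ^+ 2 <= _).
    by rewrite addr_ge0// mulr_ge0// sqr_ge0.
  by rewrite le_eqVlt; apply/orP; left; apply/eqP; field; rewrite gt_eqF.
apply: le_trans Kp _.
by rewrite le_eqVlt; apply/orP; left; apply/eqP; field; rewrite gt_eqF.
Qed.

(* Subtracting F - S, whose integral vanishes when S is the mean of F, makes the
   entropy integrand nonnegative, so that Fatou's lemma applies. *)
Definition relent {R : realType} (F S : R) : R := F * ln (F / S) - F + S.

Lemma relent_ge0 (R : realType) (F S : R) : 0 <= F -> 0 < S -> 0 <= relent F S.
Proof.
move=> F0 S0; rewrite /relent; have [->|Fn0] := eqVneq F 0.
  by rewrite mul0r subr0 add0r ltW.
have Fp : 0 < F by rewrite lt_def Fn0.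
have FS : 0 < F / S by rewrite divr_gt0.
have h : - ln (F / S) <= S / F - 1.
  rewrite -lnV// invf_div; have := @le_ln1Dx _ (S / F - 1).
  by rewrite addrCA subrr addr0; apply; rewrite ltrBrDl subrr divr_gt0.
have := ler_wpM2l F0 h; rewrite mulrN mulrBr mulr1 mulrCA divff// mulr1.
by move: (F * _) => y; lra.
Qed.

Section relative_entropy.
Context d (T : measurableType d) (R : realType) (mu : probability T R).
Implicit Types (f g : T -> R).

Lemma measurable_relent g S : measurable_fun setT g ->
  measurable_fun setT (fun x => relent (g x ^+ 2) S).
Proof.
move=> mg; have mg2 : measurable_fun setT (fun x => g x ^+ 2) by exact: measurable_funX.
apply: measurable_funD; last exact: measurable_cst.
apply: measurable_funB => //; apply: measurable_funM => //.
apply: (measurableT_comp (@measurable_ln R)).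
exact: measurable_funM mg2 (measurable_cst _).
Qed.

(** The distances are summable, so the series of squared differences is integrable, hence finite
    almost everywhere, and its terms tend to 0. The prescribed speed replaces the extraction of a
    subsequence. *)
Lemma ae_cvg_sqdist (f : (T -> R)^nat) g :
  (forall k, measurable_fun setT (f k)) -> measurable_fun setT g ->
  (forall k, (sqdist mu setT (f k) g <= (1 / (2 ^ k.+1)%:R)%:E)%E) ->
  {ae mu, forall x, f k x @[k --> \oo] --> g x}.
Proof.
move=> mf mg H; pose u k x : \bar R := ((f k x - g x) ^+ 2)%:E.
have mu_ k : measurable_fun setT (u k) by exact: measurable_sqdiff.
have u0 k x : (0 <= u k x)%E by rewrite lee_fin sqr_ge0.
have su0 x : (0 <= \sum_(k <oo) u k x)%E by exact: nneseries_ge0.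
have iu : mu.-integrable setT (fun x => \sum_(k <oo) u k x)%E.
  apply/integrableP; split; first exact: ge0_emeasurable_sum.
  under eq_integral do rewrite gee0_abs//.
  rewrite integral_nneseries//; apply: le_lt_trans (ltry 1).
  apply: le_trans (epsilon_trick0 xpredT ler01).
  by apply: lee_nneseries => [k _ _|k _]; [apply: integral_ge0 => x _; exact: u0|exact: H].
have := integrable_ae measurableT iu; apply: filterS => x /(_ I) fx.
have ux : (\sum_(0 <= k <oo) u k x < +oo)%E by rewrite -ge0_fin_numE.
have tl := nneseries_tail_cvg ux (fun k _ => u0 k x).
apply/cvgrPdist_le => e e0.
have e20 : 0 < e ^+ 2 by exact: exprn_gt0.
have := cvge0_near_le e20 tl; apply: filterS => k hk.
have : (((f k x - g x) ^+ 2)%:E <= (e ^+ 2)%:E)%E.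
  apply: le_trans hk; have u0' j : (k <= j)%N -> (0 <= u j x)%E by [].
  by rewrite (nneseries_split k 1 u0') addn1 big_nat1 leeDl// nneseries_ge0.
rewrite lee_fin -(real_normK (num_real (_ - _))) ler_sqr ?nnegrE// ?(ltW e0)//.
by rewrite distrC.
Qed.

(** The normalizations [s k] vary with k since each approximant has its own mass; they converge to
    S, so the integrands still converge almost everywhere. *)
Lemma relent_lsc (f : (T -> R)^nat) (s : R^nat) g (S B : R) :
  (forall k, measurable_fun setT (f k)) -> measurable_fun setT g ->
  (forall k, (sqdist mu setT (f k) g <= (1 / (2 ^ k.+1)%:R)%:E)%E) ->
  (forall k, 0 < s k) -> 0 < S -> s @ \oo --> S ->
  (forall k, (\int[mu]_x (relent (f k x ^+ 2) (s k))%:E <= B%:E)%E) ->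
  (\int[mu]_x (relent (g x ^+ 2) S)%:E <= B%:E)%E.
Proof.
move=> mf mg H s0 S0 sS hB.
have mrf k : measurable_fun setT (fun x => (relent (f k x ^+ 2) (s k))%:E).
  exact/measurable_EFinP/measurable_relent.
have mrg : measurable_fun setT (fun x => (relent (g x ^+ 2) S)%:E).
  exact/measurable_EFinP/measurable_relent.
have rf0 k x : setT x -> (0 <= (relent (f k x ^+ 2) (s k))%:E)%E.
  by move=> _; rewrite lee_fin relent_ge0// sqr_ge0.
apply: le_trans (le_trans (fatou mu measurableT mrf rf0) _); last first.
  exact: limf_einf_le_cst.
apply: ae_ge0_le_integral => //.
- by move=> x _; rewrite lee_fin relent_ge0// sqr_ge0.
- move=> x _; rewrite limn_einf_lim; apply: lime_ge; first exact: is_cvg_einfs.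
  near=> n; apply: le_ereal_inf_tmp => _ [k /= _ <-]; exact: rf0.
- apply: (measurableT_comp (@oppe_measurable R setT)).
  apply: measurable_fun_limn_esup => k.
  exact: (measurableT_comp (@oppe_measurable R setT) (mrf k)).
have := ae_cvg_sqdist mf mg H; apply: filterS => x fx _.
rewrite le_eqVlt; apply/orP; left; apply/eqP.
(* Splitting the logarithm is legitimate at F = 0 too, thanks to the factor [F ^+ 2], and it exposes
   the function [y ^+ 2 * ln (y ^+ 2)], which is continuous everywhere. *)
have E (F t : R) : 0 < t -> relent (F ^+ 2) t = F ^+ 2 * ln (F ^+ 2) - F ^+ 2 * ln t - F ^+ 2 + t.
  move=> t0; rewrite /relent; have [->|Fn0] := eqVneq F 0.
    by rewrite expr0n/= !(mul0r, subr0).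
  by rewrite ln_div ?posrE ?exprn_even_gt0// mulrBr.
suff K : relent (f k x ^+ 2) (s k) @[k --> \oo] --> relent (g x ^+ 2) S.
  apply/esym; apply: (cvg_limn_einf_sup _).1.
  exact: (cvg_comp _ _ K).
rewrite (E _ _ S0) (_ : (fun k => _) = fun k => f k x ^+ 2 * ln (f k x ^+ 2) -
  f k x ^+ 2 * ln (s k) - f k x ^+ 2 + s k); last by apply/funext => k; exact: E.
have f2 : f k x ^+ 2 @[k --> \oo] --> g x ^+ 2 by exact: (cvgM fx fx).
apply: cvgD => //; apply: cvgB => //; apply: cvgB.
  exact: (cvg_comp _ _ fx (@continuous_sqrlnsqr R (g x))).
by apply: cvgM => //; exact: (cvg_comp _ _ sS (continuous_ln S0)).
Unshelve. all: by end_near. Qed.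

End relative_entropy.

Section sqr_close.
Context d (T : measurableType d) (R : realType) (mu : {measure set T -> \bar R}).
Implicit Types f g : T -> R.

Lemma Rintegral_sqr_close f g (c D : R) : measurable_fun setT f -> measurable_fun setT g ->
  mu.-integrable setT (EFin \o (fun x => f x ^+ 2)) ->
  mu.-integrable setT (EFin \o (fun x => g x ^+ 2)) ->
  0 < c -> (sqdist mu setT f g <= D%:E)%E ->
  `|\int[mu]_x (f x ^+ 2) - \int[mu]_x (g x ^+ 2)| <=
    c * \int[mu]_x (g x ^+ 2) + (1 + c^-1) * D.
Proof.
move=> mf mg f2 g2 c0 fgD.
have id : mu.-integrable setT (EFin \o (fun x => (f x - g x) ^+ 2)).
  apply/integrableP; split; first exact: measurable_sqdiff.
  under eq_integral do rewrite gee0_abs ?lee_fin ?sqr_ge0//.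
  by apply: le_lt_trans fgD _; rewrite ltry.
have c1 : 0 <= 1 + c^-1 by rewrite addr_ge0// invr_ge0 ltW.
have idD : \int[mu]_x ((f x - g x) ^+ 2) <= D by rewrite -lee_fin -EFin_Rintegral.
rewrite -(RintegralB measurableT f2 g2).
have ifg := integrable_fB f2 g2.
apply: le_trans (le_normr_Rintegral measurableT ifg) _.
have ig := integrable_fZl c g2; have idc := integrable_fZl (1 + c^-1) id.
apply: le_trans (_ : \int[mu]_x (c * g x ^+ 2 + (1 + c^-1) * (f x - g x) ^+ 2) <= _).
  apply: le_Rintegral => //.
  - exact: (integrable_abse ifg).
  - exact: integrable_fD.
  - by move=> x _; exact: sqr_sub_le.
rewrite (RintegralD measurableT ig idc) (RintegralZl _ measurableT g2).
by rewrite (RintegralZl _ measurableT id) lerD2l ler_wpM2l.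
Qed.

End sqr_close.

Lemma Rintegral_probability_cst d (T : measurableType d) (R : realType)
  (mu : probability T R) (c : R) : \int[mu]_x c = c.
Proof. by rewrite Rintegral_cst//= probability_setT /= mulr1. Qed.

Lemma integrable_probability_cst d (T : measurableType d) (R : realType)
  (mu : probability T R) (c : R) : mu.-integrable setT (EFin \o cst c).
Proof. exact: (@bounded_integrable _ _ _ _ _ `|c|). Qed.

Section entropy_probability.
Context d (T : measurableType d) (R : realType) (mu : probability T R).
Implicit Types f g u : T -> R.

Let ent g (S : R) x := g x ^+ 2 * ln (g x ^+ 2 / S).

Let measurable_ent g S : measurable_fun setT g -> measurable_fun setT (ent g S).
Proof.
move=> mg; have mg2 : measurable_fun setT (fun x => g x ^+ 2) by exact: measurable_funX.
apply: measurable_funM => //.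
apply: (measurableT_comp (@measurable_ln R)).
exact: measurable_funM mg2 (measurable_cst _).
Qed.

Lemma relent_integral g : mu.-integrable setT (EFin \o (fun x => g x ^+ 2)) ->
  let S := \int[mu]_x (g x ^+ 2) in
  mu.-integrable setT (EFin \o ent g S) ->
  (\int[mu]_x (relent (g x ^+ 2) S)%:E)%E = (\int[mu]_x ent g S x)%:E.
Proof.
move=> g2 S ig; have iS := integrable_probability_cst mu S.
have i1 := integrable_fB ig g2.
have i2 := integrable_fD i1 iS.
rewrite (EFin_Rintegral i2) (RintegralD measurableT i1 iS).
rewrite (RintegralB measurableT ig g2).
by rewrite [X in _ + X](Rintegral_probability_cst mu S) subrK.
Qed.

Lemma entropy_integrable g B : mu.-integrable setT (EFin \o (fun x => g x ^+ 2)) ->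
  measurable_fun setT g ->
  let S := \int[mu]_x (g x ^+ 2) in 0 < S ->
  (\int[mu]_x (relent (g x ^+ 2) S)%:E <= B%:E)%E ->
  mu.-integrable setT (EFin \o ent g S) /\ \int[mu]_x ent g S x <= B.
Proof.
move=> g2 mg S S0 HB; have iS := integrable_probability_cst mu S.
have ir : mu.-integrable setT (EFin \o (fun x => relent (g x ^+ 2) S)).
  apply/integrableP; split; first exact/measurable_EFinP/measurable_relent.
  under eq_integral do rewrite gee0_abs ?lee_fin ?relent_ge0 ?sqr_ge0//.
  by apply: le_lt_trans HB _; rewrite ltry.
have ie : mu.-integrable setT (EFin \o ent g S).
  rewrite (_ : ent g S = fun x => (relent (g x ^+ 2) S - cst S x) + g x ^+ 2).
    exact: (integrable_fD (integrable_fB ir iS) g2).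
  by apply/funext => x; rewrite /relent /ent /=; ring.
by split=> //; move: HB; rewrite (relent_integral g2 ie) lee_fin.
Qed.

(** The case S = 0 is set apart because the normalized entropy of g is meaningless there: u is then
    almost everywhere its mean a, and its entropy is 0. For a = 0, u is g. Otherwise [rothaus_shift]
    is integrated, and its linear term drops since g is centred. *)
Lemma entropy_rothaus u B : measurable_fun setT u ->
  mu.-integrable setT (EFin \o u) ->
  mu.-integrable setT (EFin \o (fun x => u x ^+ 2)) ->
  let g x := u x - \int[mu]_y u y in
  let S := \int[mu]_x (g x ^+ 2) in
  0 <= B -> (0 < S -> (\int[mu]_x (relent (g x ^+ 2) S)%:E <= B%:E)%E) ->
  (\int[mu]_x (ent u (\int[mu]_y (u y ^+ 2)) x)%:E <= (B + 2 * S)%:E)%E.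
Proof.
move=> mu_ iu u2; set a := \int[mu]_y u y => g S B0 HB.
have ic c := integrable_probability_cst mu c.
have mg : measurable_fun setT g by exact: measurable_funB mu_ (measurable_cst a).
have ig : mu.-integrable setT (EFin \o g) by exact: (integrable_fB iu (ic a)).
have intg : \int[mu]_x g x = 0.
  by rewrite (RintegralB measurableT iu (ic a)) [X in _ - X](Rintegral_probability_cst mu a) subrr.
have g2 : mu.-integrable setT (EFin \o (fun x => g x ^+ 2)).
  rewrite (_ : (fun x => g x ^+ 2) = fun x => (u x ^+ 2 - 2 * a * u x) + cst (a ^+ 2) x).
    exact: (integrable_fD (integrable_fB u2 (integrable_fZl (2 * a) iu)) (ic _)).
  by apply/funext => x; rewrite /g /=; ring.
have uE x : u x = a + g x by rewrite /g addrC subrK.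
have intu : \int[mu]_y (u y ^+ 2) = a ^+ 2 + S.
  have i1 := integrable_fD (ic (a ^+ 2)) (integrable_fZl (2 * a) ig).
  rewrite (_ : (fun x => u x ^+ 2) = fun x => (cst (a ^+ 2) x + 2 * a * g x) + g x ^+ 2).
    rewrite (RintegralD measurableT i1 g2).
    rewrite (RintegralD measurableT (ic _) (integrable_fZl (2 * a) ig)).
    rewrite (RintegralZl _ measurableT ig) intg mulr0 addr0.
    by rewrite [X in X + _](Rintegral_probability_cst mu (a ^+ 2)).
  by apply/funext => x; rewrite uE /=; ring.
rewrite intu.
have S0 : 0 <= S by apply: Rintegral_ge0 => x _; exact: sqr_ge0.
have [S00|Sn0] := eqVneq S 0.
  rewrite S00 mulr0 !addr0.
  rewrite (@ae_eq_integral _ _ _ _ setT (cst 0%E))//.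
  - by rewrite integral_cst// mul0e lee_fin.
  - exact/measurable_EFinP/measurable_ent.
  have : ae_eq mu setT (EFin \o (fun x => g x ^+ 2)) (cst 0%E).
    apply/ae_eq_integral_abs => //; first exact: measurable_int g2.
    under eq_integral do rewrite gee0_abs ?lee_fin ?sqr_ge0//.
    by rewrite (EFin_Rintegral g2) -/S S00.
  apply: filterS => x /(_ I) gx0 _.
  have gx : g x = 0 by apply/eqP; rewrite -sqrf_eq0; case: gx0 => ->.
  rewrite /ent uE gx addr0; congr EFin.
  have [->|a0] := eqVneq a 0; first by rewrite expr0n/= mul0r.
  by rewrite divff ?expf_neq0// ln1 mulr0.
have Sp : 0 < S by rewrite lt_def Sn0.
have [ie leB] := entropy_integrable g2 mg Sp (HB Sp).
have [a0|a0] := eqVneq a 0.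
  have -> : u = g by apply/funext => x; rewrite uE a0 add0r.
  rewrite a0 expr0n/= add0r (EFin_Rintegral ie) lee_fin.
  by apply: le_trans leB _; rewrite lerDl mulr_ge0.
have [[[c0 c1] c2] /= [cS Hc]] := rothaus_shift a0 Sp.
set r := fun x => (ent g S x + cst c0 x + c1 * g x) + c2 * g x ^+ 2.
have i1 := integrable_fD ie (ic c0).
have i2 := integrable_fD i1 (integrable_fZl c1 ig).
have ir : mu.-integrable setT (EFin \o r) by exact: (integrable_fD i2 (integrable_fZl c2 g2)).
have intr : \int[mu]_x r x <= B + 2 * S.
  rewrite (RintegralD measurableT i2 (integrable_fZl c2 g2)).
  rewrite (RintegralD measurableT i1 (integrable_fZl c1 ig)).
  rewrite (RintegralD measurableT ie (ic c0)).
  rewrite (RintegralZl _ measurableT ig) (RintegralZl _ measurableT g2) intg mulr0 addr0 -/S.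
  rewrite [X in _ + X + _](Rintegral_probability_cst mu c0) -cS -addrA.
  by rewrite lerD2r.
have lr x : ent u (a ^+ 2 + S) x <= r x by rewrite /ent uE; exact: Hc.
have T0 : 0 < a ^+ 2 + S by rewrite ltr_wpDl// sqr_ge0.
(* Nonnegativity of [relent] gives an integrable lower bound; with the upper bound [r] it makes the
   entropy integrand of u integrable. *)
have rl x : - (u x ^+ 2 + (a ^+ 2 + S)) <= ent u (a ^+ 2 + S) x.
  rewrite -subr_ge0.
  have -> : ent u (a ^+ 2 + S) x - - (u x ^+ 2 + (a ^+ 2 + S)) =
    relent (u x ^+ 2) (a ^+ 2 + S) + 2 * u x ^+ 2 by rewrite /relent /ent; ring.
  by rewrite addr_ge0 ?relent_ge0 ?sqr_ge0// mulr_ge0 ?sqr_ge0.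
have il : mu.-integrable setT (EFin \o ent u (a ^+ 2 + S)).
  apply: (@integrable_fle _ _ _ _ _ (fun x => `|r x| + (u x ^+ 2 + cst (a ^+ 2 + S) x))).
  - exact: measurable_ent.
  - move=> x; rewrite ler_norml /=; apply/andP; split.
      apply: le_trans (rl x); rewrite opprD gerDr oppr_le0; exact: normr_ge0.
    apply: le_trans (lr x) _; apply: le_trans (ler_norm _) _.
    by rewrite lerDl addr_ge0 ?sqr_ge0// ltW.
  exact: (integrable_fD (integrable_abse ir) (integrable_fD u2 (ic _))).
rewrite (EFin_Rintegral il) lee_fin; apply: le_trans intr.
by apply: le_Rintegral.
Qed.

End entropy_probability.

(** * From smooth functions to H^1 *)

Section weak_gradient_shift.
Context {R : realType} {d : nat}.
Notation leb := (@lebesgue_rV R d).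

Lemma loc_integrableB (f g : 'rV[R]_d -> R) :
  loc_integrable f -> loc_integrable g -> loc_integrable (fun x => f x - g x).
Proof.
move=> [mf lf] [mg lg]; split; first exact: measurable_funB.
move=> K cK; have mK := measurable_compact_rV cK.
have mE (h : 'rV[R]_d -> R) : measurable_fun setT h ->
    measurable_fun K (fun x => `|h x|%:E).
  by move=> mh; apply/measurable_EFinP; apply: measurable_funTS; exact: measurableT_comp.
apply: le_lt_trans (_ : (\int[leb]_(x in K) (`|f x|%:E + `|g x|%:E) < +oo)%E).
  apply: ge0_le_integral => //.
  - by apply: mE; exact: measurable_funB.
  - by apply: emeasurable_funD; exact: mE.
  - by move=> x _; rewrite -EFinD lee_fin ler_normB.
rewrite ge0_integralD//; [|exact: mE|exact: mE].
by rewrite lte_add_pinfty ?lf ?lg.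
Qed.

Lemma test_function_is_boxed (phi : 'rV[R]_d -> R) : test_function phi ->
  exists M, boxed M phi.
Proof.
move=> [_ cphi]; have [M M0 KM] := compact_sub_rVbox cphi.
exists M => x i Mx; apply: contrapT => /eqP phix.
have : rVbox M x by apply: KM; apply: (@subset_closure _ [set y | phi y != 0]); exact: phix.
by move=> /(_ i); rewrite leNgt Mx.
Qed.

(** The constant contributes a multiple of the integral of [partial i phi], which is zero. *)
Lemma weak_gradient_subr (u : 'rV[R]_d -> R) (G : 'rV[R]_d -> 'rV[R]_d) a :
  weak_gradient u G -> weak_gradient (fun x => u x - a) G.
Proof.
move=> [lu lG uG]; split=> //.
  apply: (loc_integrableB lu (g := cst a)).
  exact: loc_integrable_continuous (class_C_continuous (class_C_cst 0 a)).
move=> phi i tphi; rewrite -uG//; have [M bphi] := test_function_is_boxed tphi.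
have Cphi := tphi.1 1%N.
have cp := class_C_continuous (class_C_partial i Cphi).
have bp := boxed_partial i bphi.
have ip := integrable_boxed cp bp.
have iu := loc_integrable_mul_boxed lu cp bp.
rewrite -[RHS]subr0 -(mulr0 a) -(Rintegral_partial i Cphi bphi).
rewrite -(RintegralZl a measurableT ip) -(RintegralB measurableT iu (integrable_fZl a ip)).
by apply: eq_Rintegral => x _; rewrite mulrBl.
Qed.

End weak_gradient_shift.

Lemma Rintegral_sqr_delta d (T : measurableType d) (R : realType)
    (mu : {measure set T -> \bar R}) (g : T -> R) (e : R) :
  measurable_fun setT g -> mu.-integrable setT (EFin \o (fun x => g x ^+ 2)) ->
  0 < e -> exists2 D, 0 < D & forall f : T -> R, measurable_fun setT f ->
    mu.-integrable setT (EFin \o (fun x => f x ^+ 2)) ->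
    (sqdist mu setT f g <= D%:E)%E ->
    `|\int[mu]_x (f x ^+ 2) - \int[mu]_x (g x ^+ 2)| <= e.
Proof.
move=> mg g2 e0; set S := \int[mu]_x (g x ^+ 2).
have S0 : 0 <= S by apply: Rintegral_ge0 => x _; exact: sqr_ge0.
have S1 : 0 < S + 1 by rewrite ltr_wpDl.
pose c := e / 2 / (S + 1).
have c0 : 0 < c by rewrite !divr_gt0.
have cV : 0 < 1 + c^-1 by rewrite addr_gt0// invr_gt0.
exists (e / 2 / (1 + c^-1)); first by rewrite !divr_gt0.
move=> f mf f2 fg; apply: le_trans (Rintegral_sqr_close mf mg f2 g2 c0 fg) _.
rewrite -/S [X in _ + X](_ : _ = e / 2); last by rewrite mulrC divfK// gt_eqF.
rewrite [leRHS](splitr e) lerD2r /c mulrAC ler_pdivrMr// ler_wpM2l ?lerDl//.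
by rewrite divr_ge0// ltW.
Qed.

Section energy_close.
Context {R : realType} {d : nat} (mu : probability 'rV[R]_d R).
Variable G : 'rV[R]_d -> 'rV[R]_d.
Hypothesis mG : forall i, measurable_fun setT (fun x => G x ord0 i).
Hypothesis G2 : forall i, mu.-integrable setT (EFin \o (fun x => G x ord0 i ^+ 2)).

Lemma energy_sum : energy mu G = \sum_(i < d) \int[mu]_x (G x ord0 i ^+ 2).
Proof.
rewrite /energy -Rintegral_sum//.
by apply: eq_Rintegral => x _; exact: enorm_sqr.
Qed.

Lemma energy_close f M c D : class_C 1 f -> boxed M f -> 0 < c ->
  (forall i, (sqdist mu setT (partial i f) (fun x => G x ord0 i) <= D%:E)%E) ->
  energy mu (grad f) <= energy mu G + (c * energy mu G + d%:R * ((1 + c^-1) * D)).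
Proof.
move=> Cf bf c0 hD.
have cp i : continuous (partial i f) := class_C_continuous (class_C_partial i Cf).
have ip i : mu.-integrable setT (EFin \o (fun x => partial i f x ^+ 2)).
  exact: integrable_boxed_finite (continuous_fM (cp i) (cp i)) (boxedMl _ (boxed_partial i bf)).
have -> : energy mu (grad f) = \sum_(i < d) \int[mu]_x (partial i f x ^+ 2).
  rewrite /energy -Rintegral_sum//.
  by apply: eq_Rintegral => x _; exact: enorm_grad_sqr.
rewrite energy_sum mulr_sumr.
rewrite [d%:R * _](_ : _ = \sum_(i < d) ((1 + c^-1) * D)); last first.
  by rewrite sumr_const card_ord mulr_natl.
rewrite -!big_split /=; apply: ler_sum => i _.
have := Rintegral_sqr_close (continuous_measurable_rV (cp i)) (mG i) (ip i) (G2 i) c0 (hD i).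
by move=> H; rewrite -lerBlDl; apply: le_trans H; exact: ler_norm.
Qed.

End energy_close.

Lemma powR2_norm (R : realType) (p x : R) : `|x| `^ (2 / p) = (x ^+ 2) `^ p^-1.
Proof.
by rewrite powRrM powR_mulrn// real_normK// num_real.
Qed.

Section smooth_functions.
Context {R : realType} {d : nat}.
Variables (V W : 'rV[R]_d -> R) (mu nu : probability 'rV[R]_d R).
Hypothesis W_C1 : class_C 1 W.
Hypothesis Z_C2 : class_C 2 (Zfun V W).
Hypothesis mu_density : has_density mu (fun x => expR (- V x)).
Hypothesis nu_density : has_density nu (fun x => expR (- W x)).
Variable K : R.
Hypothesis uniform : \forall p \near 1^'+,
     [/\ (Cp p nu <= K%:E)%E, (C2 mu <= K%:E)%E,
         Zfun V W \in Lfun nu (conj_exp p)%:E /\ (Z_norm V W nu p <= K%:E)%E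
       & ((- K)%:E <= inf_delta V W)%E].
Hypothesis Lfin : limf_einf (Cbound V W mu nu) 1^'+ \is a fin_num.

Let L := fine (limf_einf (Cbound V W mu nu) 1^'+).
Let c2 := fine (C2 mu).
Let m := fine (inf_delta V W).
Let c p := fine (Cp p nu).
Let N p := fine (Z_norm V W nu p).
Let A p := Num.max (2 * N p - m * c p) 0.

(** A bound for [A p] near p = 1, from [N p <= K], [- K <= m] and [0 <= c p <= K]. *)
Let K1 := 2 * K + K * K.

Lemma C2_le : (C2 mu <= K%:E)%E.
Proof. by have [p [_ h _ _]] := @filter_ex _ _ (at_right_proper_filter 1) _ uniform. Qed.

Lemma fine_C2_ge0 : 0 <= c2.
Proof. by have [] := best_constant_adherent C2_le. Qed.

Lemma C2_fineE : C2 mu = c2%:E.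
Proof. by have [fin _ _] := best_constant_adherent C2_le; rewrite /c2 fineK. Qed.

Lemma uniform_bound_ge0 : 0 <= K.
Proof. by rewrite -lee_fin (le_trans _ C2_le)// C2_fineE lee_fin fine_C2_ge0. Qed.

Let inf_delta_fin : inf_delta V W \is a fin_num /\ - K <= m.
Proof.
have mK : ((- K)%:E <= inf_delta V W)%E.
  by have [p [_ _ _ h]] := @filter_ex _ _ (at_right_proper_filter 1) _ uniform.
have fin : inf_delta V W \is a fin_num.
  rewrite fin_numE; apply/andP; split.
    by rewrite gt_eqF// (lt_le_trans _ mK)// ltNyr.
  rewrite lt_eqF//; apply: le_lt_trans (ltry (delta V W 0)).
  by apply: ereal_inf_lbound; exists 0.
by split=> //; rewrite -lee_fin /m fineK.
Qed.

Lemma delta_ge x : m <= delta V W x.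
Proof.
rewrite -lee_fin /m (fineK inf_delta_fin.1).
by apply: ereal_inf_lbound; exists x.
Qed.

(** Put Y = c p + c2 A p and h = 2 - 2/p. Then [Cbound] is 2 c2 + Y - h (c2 + Y), with h <= 2 (p -
    1) and c2 + Y <= [X] for all p near 1. Half of e pays for the approach to the lower limit and
    half for the term in h. [P] lets the caller impose on the same p any condition that holds
    eventually. *)
Lemma constants_near (P : set R) e : 0 < e -> (\forall p \near 1^'+, P p) ->
  exists p, [/\ P p, 1 < p < 2, (Cp p nu <= K%:E)%E,
    Zfun V W \in Lfun nu (conj_exp p)%:E /\ Z_norm V W nu p \is a fin_num &
    [/\ 0 <= c p <= K, 0 <= A p <= K1 & c p + c2 * A p <= L - 2 * c2 + e]].
Proof.
move=> e0 nP; have K0 := uniform_bound_ge0.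
have c20 := fine_C2_ge0; have [mfin mK] := inf_delta_fin.
pose X := K + (K + K * K1).
have K10 : 0 <= K1 by rewrite addr_ge0 ?mulr_ge0.
have X0 : 0 <= X by rewrite !addr_ge0// mulr_ge0.
have near1 : \forall p \near 1^'+, p < 2 /\ 2 * (p - 1) * X <= e / 2.
  pose r := Num.min 1 (e / 2 / (2 * X + 1)).
  have r0 : 0 < r by rewrite lt_min ltr01 !divr_gt0// ltr_wpDl// mulr_ge0.
  exists r => //= p /= pr p1.
  have h0 : 0 < p - 1 by rewrite subr_gt0.
  have : p - 1 < r by rewrite -(ger0_norm (ltW h0)) distrC.
  rewrite lt_min => /andP[h1 h2]; split; first lra.
  have : (p - 1) * (2 * X + 1) < e / 2 by rewrite -ltr_pdivlMr// ltr_wpDl// mulr_ge0.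
  by rewrite mulrDr mulr1 mulrCA mulrA; move: (2 * (p - 1) * X) => Y; lra.
have near2 : \forall p \near (1 : R)^'+, 1 < p by exact: nbhs_right_gt.
have e20 : 0 < e / 2 by rewrite divr_gt0.
have [p [[[Pp p1] [p2 hX]] [CpK C2K [ZL ZK] _]] Cb] :=
  limf_einf_frequently _ Lfin e20 (filterI (filterI (filterI nP near2) near1) uniform).
have Zfin : Z_norm V W nu p \is a fin_num.
  by rewrite ge0_fin_numE ?Lnorm_ge0// (le_lt_trans ZK)// ltry.
have N0 : 0 <= N p by apply: fine_ge0; exact: Lnorm_ge0.
have NK : N p <= K by rewrite -lee_fin /N fineK.
have [Cpfin c0 _] := best_constant_adherent CpK.
rewrite -/(c p) in c0; have cK : c p <= K by rewrite -lee_fin /c fineK.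
have A0 : 0 <= A p by rewrite le_max lexx orbT.
have AK : A p <= K1.
  rewrite ge_max K10 andbT; have : (m + K) * c p >= 0 by rewrite mulr_ge0// -lerBlDr sub0r.
  rewrite mulrDl; have : K * c p <= K * K by rewrite ler_wpM2l.
  by rewrite /K1; move: NK; move: (m * c p) (N p) (K * K) (K * c p) => *; lra.
exists p; split; rewrite ?p1//; split; rewrite ?c0 ?A0//.
have CE : Cbound V W mu nu p =
    (2 / p * c2 + (2 / p - 1) * (c p + c2 * A p))%:E.
  have CpE : Cp p nu = (c p)%:E by rewrite /c fineK.
  have ZE : Z_norm V W nu p = (N p)%:E by rewrite /N fineK.
  have mE : inf_delta V W = m%:E by rewrite /m fineK.
  rewrite /Cbound /Cstar C2_fineE CpE ZE mE.
  by rewrite -!EFinM -EFinB -EFin_max -!EFinM -!EFinD.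
move: Cb; rewrite CE -(fineK Lfin) -EFinD lte_fin -/L => Cb.
have c2K : c2 <= K by rewrite -lee_fin -C2_fineE.
have YX : c2 + (c p + c2 * A p) <= X.
  by rewrite !lerD// ler_pM.
have Y0 : 0 <= c2 + (c p + c2 * A p) by rewrite !addr_ge0// mulr_ge0.
have p0 : 0 < p by lra.
have h0 : 0 <= p - 1 by lra.
pose h := 2 - 2 / p.
have hp : h <= 2 * (p - 1).
  rewrite -subr_ge0 (_ : _ - _ = 2 * (p - 1) ^+ 2 / p); last by rewrite /h; field; rewrite gt_eqF.
  by rewrite divr_ge0 ?(ltW p0)// mulr_ge0 ?sqr_ge0.
have : h * (c2 + (c p + c2 * A p)) <= 2 * (p - 1) * X.
  apply: le_trans (_ : 2 * (p - 1) * (c2 + (c p + c2 * A p)) <= _); first exact: ler_wpM2r.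
  by rewrite ler_wpM2l// mulr_ge0.
move: hX Cb; have -> : 2 / p = 2 - h by rewrite /h; ring.
by move: (c p + c2 * A p) (2 * (p - 1) * X); move=> Y T; nra.
Qed.

(** The quantity [c p + c2 * A p] is nonnegative and comes within any e of [L - 2 * c2]. This makes
    the bounds below nonnegative, as admissible constants must be. *)
Lemma liminf_ge : 2 * c2 <= L.
Proof.
rewrite -subr_ge0; apply/ler_addgt0Pr => e e0.
have [p [_ _ _ _ [/andP[c0 _] /andP[A0 _]]]] := constants_near e0 filterT.
by apply: le_trans; rewrite addr_ge0// mulr_ge0// fine_C2_ge0.
Qed.

(** The exponent p chosen here depends on f and e, and the statement forgets it: it retains two
    constants together with bounds that depend neither on f nor on p. *)
Lemma entropy_smooth f M e : class_C 1 f -> boxed M f ->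
  let S := \int[mu]_x (f x ^+ 2) in 0 < S -> 0 < e ->
  exists cA : R * R, [/\ 0 <= cA.1 <= K, 0 <= cA.2 <= K1,
    cA.1 + c2 * cA.2 <= L - 2 * c2 + e &
    \int[mu]_x (f x ^+ 2 * ln (f x ^+ 2 / S)) <=
      cA.1 * energy mu (grad f) + cA.2 * S + e].
Proof.
move=> Cf bf S S0 e0; have cf := class_C_continuous Cf.
have [C C0 fC] := boxed_bounded cf bf.
have F0 x : 0 <= f x ^+ 2 by exact: sqr_ge0.
have FC x : f x ^+ 2 <= C ^+ 2.
  by rewrite -real_normK ?num_real// lerXn2r ?nnegrE// ltW.
have mF : measurable_fun setT (fun x => f x ^+ 2).
  by apply: measurable_funX; exact: continuous_measurable_rV.
have nT := entropy_le_tsallis mF F0 FC S0 e0.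
have [p [Tp /andP[p1 p2] CpK [ZL Zfin] [hc hA hL]]] := constants_near e0 nT.
exists (c p, A p); split=> //=.
rewrite -lerBlDr; apply: le_trans Tp _.
have := interpolation_ground W_C1 Z_C2 mu_density nu_density p1 ZL Zfin Cf bf CpK delta_ge.
rewrite /= (_ : \int[mu]_x (`|f x| `^ (2 / p)) = \int[mu]_x ((f x ^+ 2) `^ p^-1)).
  move=> H; apply: le_trans H _; rewrite -/S -/(c p) -/(N p).
  have : (2 * N p - m * c p) * S <= A p * S by rewrite ler_wpM2r ?(ltW S0)// le_max lexx.
  by move: (energy _ _) (A p * S) => E AS; lra.
by apply: eq_Rintegral => x _; exact: powR2_norm.
Qed.

Let cV : continuous V := class_C_continuous (class_C1_V W_C1 Z_C2).

(** The hypothesis [S <= c2 * energy mu G] turns the mass term [Ak * S] into [c2 * Ak] times the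
    energy, so that only the combination [ck + c2 * Ak], controlled by [L - 2 * c2], has to be known
    along the approximation. *)
Lemma relent_H1 g G e : weak_gradient g G ->
  mu.-integrable setT (EFin \o (fun x => g x ^+ 2)) ->
  (forall i, mu.-integrable setT (EFin \o (fun x => G x ord0 i ^+ 2))) ->
  let S := \int[mu]_x (g x ^+ 2) in
  0 < S -> S <= c2 * energy mu G -> 0 < e ->
  (\int[mu]_x (relent (g x ^+ 2) S)%:E <=
    ((L - 2 * c2) * energy mu G + e)%:E)%E.
Proof.
move=> gG g2 G2 S S0 SE e0; have [[mg _] lG _] := gG.
have mG i : measurable_fun setT (fun x => G x ord0 i) by case: (lG i).
have K0 := uniform_bound_ge0; have c20 := fine_C2_ge0.
have K10 : 0 <= K1 by rewrite addr_ge0 ?mulr_ge0.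
set E := energy mu G in SE *.
have E0 : 0 <= E by exact: energy_ge0.
(* The sum of the coefficients of [e1] in the final estimate: E from the excess over [L - 2 * c2], K
   from the energy error, K1 from the mass error, and 1 from the additive error of
   [entropy_smooth]. *)
pose B := E + K + K1 + 1.
have B0 : 0 < B by rewrite ltr_wpDl//; exact: addr_ge0 (addr_ge0 E0 K0) K10.
(* The bound by S/2 keeps the masses of the approximants positive. *)
pose e1 := Num.min (e / B) (S / 2).
have e10 : 0 < e1 by rewrite lt_min !divr_gt0.
have e1e : e1 * B <= e by rewrite -ler_pdivlMr// ge_min lexx.
have e1S : e1 < S.
  by rewrite (@le_lt_trans _ _ (S / 2))// ?ge_min ?lexx ?orbT// ltr_pdivrMr// ltr_pMr// ltr1n.
have [D D0 hD] := Rintegral_sqr_delta mg g2 e10.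
pose t := e1 / 2 / (E + 1).
have E1 : 0 < E + 1 by rewrite ltr_wpDl.
have c0 : 0 < t by rewrite !divr_gt0.
have cV0 : 0 < 1 + t^-1 by rewrite addr_gt0// invr_gt0.
(* The d coordinates share the energy error; [d.+1] is written so that the denominator is positive
   in dimension 0 as well. *)
pose D1 := e1 / 2 / (d.+1%:R * (1 + t^-1)).
have D10 : 0 < D1 by rewrite !divr_gt0// mulr_gt0.
(* The three bounds give, in order, closeness of the masses, closeness of the energies, and the
   speed required for almost everywhere convergence. *)
pose Dk (k : nat) := Num.min (Num.min D D1) (1 / (2 ^ k.+1)%:R).
have Dk0 k : 0 < Dk k by rewrite !lt_min D0 D10 divr_gt0// ltr0n expn_gt0.
have /choice[f fP] k := H1_approx cV mu_density gG g2 G2 (Dk0 k).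
have cf k : continuous (f k) by have [[Cf _] _] := fP k; exact: class_C_continuous Cf.
have mf k : measurable_fun setT (f k) by exact: continuous_measurable_rV.
have f2 k : mu.-integrable setT (EFin \o (fun x => f k x ^+ 2)).
  have [[_ [M _ bf]] _] := fP k.
  exact: integrable_boxed_finite (continuous_fM (cf k) (cf k)) (boxedMl _ bf).
pose s k := \int[mu]_x (f k x ^+ 2).
have hs k : `|s k - S| <= e1.
  have [_ [h _]] := fP k; apply: (hD _ (mf k) (f2 k)).
  by apply: le_trans h _; rewrite lee_fin !ge_min lexx.
have s0 k : 0 < s k.
  by have := hs k; rewrite ler_norml => /andP[h _]; move: h e1S; rewrite lerBrDl; lra.
have dist k : (sqdist mu setT (f k) g <= (1 / (2 ^ k.+1)%:R)%:E)%E.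
  by have [_ [h _]] := fP k; apply: le_trans h _; rewrite lee_fin !ge_min lexx orbT.
apply: (relent_lsc mf mg dist s0 S0).
  apply/cvgrPdist_le => eta eta0.
  have [D2 D20 hD2] := Rintegral_sqr_delta mg g2 eta0.
  have [n _ hn] := near_infty_natSinv_expn_lt (PosNum D20).
  exists n => // k /= nk; rewrite distrC; apply: (hD2 _ (mf k) (f2 k)).
  apply: le_trans (dist k) _; rewrite lee_fin natrX; apply/ltW.
  by apply: (hn k.+1) => /=; exact: leqW.
move=> k; have [[Cf [M _ bf]] [_ hG]] := fP k.
have [[ck Ak] /= [/andP[ck0 ckK] /andP[Ak0 AkK] hL hE]] := entropy_smooth Cf bf (s0 k) e10.
have Ef : energy mu (grad (f k)) <= E + e1.
  have hG' i : (sqdist mu setT (partial i (f k)) (fun x => G x ord0 i) <= D1%:E)%E.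
    by apply: le_trans (hG i) _; rewrite lee_fin !ge_min lexx ?orbT.
  apply: le_trans (energy_close mG G2 Cf bf c0 hG') _; rewrite -/E lerD2l.
  rewrite [leRHS](splitr e1) lerD//.
    by rewrite /t mulrAC ler_pdivrMr// ler_wpM2l ?lerDl// divr_ge0// ltW.
  apply: le_trans (_ : d.+1%:R * ((1 + t^-1) * D1) <= _).
    by rewrite ler_wpM2r ?ler_nat// mulr_ge0 ?(ltW D10)// ltW.
  by rewrite mulrA /D1 mulrC divfK// gt_eqF// mulr_gt0.
have ie : mu.-integrable setT (EFin \o (fun x => f k x ^+ 2 * ln (f k x ^+ 2 / s k))).
  have -> : (fun x => f k x ^+ 2 * ln (f k x ^+ 2 / s k)) =
      fun x => f k x ^+ 2 * ln (f k x ^+ 2) - ln (s k) * f k x ^+ 2.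
    apply/funext => x; have [->|fn0] := eqVneq (f k x) 0.
      by rewrite expr0n/= !(mul0r, mulr0) subr0.
    by rewrite ln_div ?posrE ?exprn_even_gt0// mulrBr [ln (s k) * _]mulrC.
  apply: integrable_fB; last exact: integrable_fZl.
  apply: (@integrable_boxed_finite _ _ _ M) => [x|x i Mx].
    exact: (cvg_comp _ _ (@cf k x) (@continuous_sqrlnsqr R (f k x))).
  by rewrite (bf x i Mx) expr0n/= mul0r.
rewrite (relent_integral (f2 k) ie) lee_fin; apply: le_trans hE _.
have sS : s k <= S + e1 by have := hs k; rewrite ler_norml => /andP[_]; rewrite lerBlDl.
have h1 : ck * energy mu (grad (f k)) <= ck * E + K * e1.
  apply: le_trans (_ : ck * (E + e1) <= _); first exact: ler_wpM2l.
  by rewrite mulrDr lerD2l ler_wpM2r// ltW.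
have h2 : Ak * s k <= c2 * Ak * E + K1 * e1.
  apply: le_trans (_ : Ak * (S + e1) <= _); first exact: ler_wpM2l.
  rewrite mulrDr; apply: lerD; last by rewrite ler_wpM2r// ltW.
  by rewrite [c2 * Ak]mulrC -mulrA ler_wpM2l.
have h3 : (ck + c2 * Ak) * E <= (L - 2 * c2 + e1) * E by rewrite ler_wpM2r.
apply: le_trans (_ : (L - 2 * c2) * E + e1 * B <= _); last by rewrite lerD2l.
apply: le_trans (lerD (lerD h1 h2) (lexx e1)) _.
move: h3; rewrite /B; set LL := L - 2 * c2.
rewrite (_ : (ck + c2 * Ak) * E = ck * E + c2 * Ak * E); last by ring.
rewrite (_ : (LL + e1) * E = LL * E + e1 * E); last by ring.
rewrite (_ : e1 * (E + K + K1 + 1) = e1 * E + K * e1 + K1 * e1 + e1); last by ring.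
by move: (ck * E) (c2 * Ak * E) (LL * E) (e1 * E) (K * e1) (K1 * e1) => *; lra.
Qed.

Lemma entropy_H1_le u G : H1 mu u G -> (entropy mu u <= (L * energy mu G)%:E)%E.
Proof.
move=> uG; have [wG u2' G2'] := uG; have [[mu_ _] lG _] := wG.
have u2 := Lfun2_integrable_sqr u2'.
have mG i : measurable_fun setT (fun x => G x ord0 i) by case: (lG i).
have G2 i : mu.-integrable setT (EFin \o (fun x => G x ord0 i ^+ 2)).
  apply: (@integrable_fle _ _ _ _ _ (fun x => enorm (G x) ^+ 2)).
  - exact: measurable_funX.
  - move=> x; rewrite ger0_norm ?sqr_ge0// enorm_sqr (bigD1 i)//= lerDl.
    by apply: sumr_ge0 => j _; exact: sqr_ge0.
  - exact: (Lfun2_integrable_sqr G2').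
have iu : mu.-integrable setT (EFin \o u).
  apply: (@integrable_fle _ _ _ _ _ (fun x => cst 1 x + u x ^+ 2)) => //.
    move=> x /=; rewrite -(real_normK (num_real (u x))).
    by have := sqr_ge0 (`|u x| - 1); have := normr_ge0 (u x); nra.
  exact: (integrable_fD (integrable_probability_cst mu 1) u2).
pose a := \int[mu]_y u y; pose g x := u x - a.
have SE : \int[mu]_x (g x ^+ 2) <= c2 * energy mu G.
  have := C2_attained C2_le uG; apply: le_trans.
  by rewrite le_eqVlt; apply/orP; left; apply/eqP/eq_Rintegral => x _; rewrite real_normK// num_real.
have g2 : mu.-integrable setT (EFin \o (fun x => g x ^+ 2)).
  rewrite (_ : (fun x => g x ^+ 2) = fun x => (u x ^+ 2 - 2 * a * u x) + cst (a ^+ 2) x).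
    exact: (integrable_fD (integrable_fB u2 (integrable_fZl (2 * a) iu)) (integrable_probability_cst mu _)).
  by apply/funext => x; rewrite /g /=; ring.
have B0 : 0 <= (L - 2 * c2) * energy mu G.
  by rewrite mulr_ge0 ?energy_ge0// subr_ge0 liminf_ge.
(* The 2 S added by Rothaus' inequality is at most [2 * c2 * energy mu G], which restores the full
   constant L. *)
apply: le_trans (entropy_rothaus mu_ iu u2 B0 _) _.
  move=> S0; apply/lee_addgt0Pr => e e0.
  exact: (relent_H1 (weak_gradient_subr a wG) g2 G2 S0 SE e0).
rewrite lee_fin -[leRHS](subrK (2 * c2 * energy mu G)) -mulrBl lerD2l -mulrA.
by rewrite ler_wpM2l.
Qed.

End smooth_functions.

Unset Implicit Arguments.
Set Strict Implicit.

Theorem corollary2 (R : realType) (d : nat) (V W : 'rV[R]_d -> R)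
  (mu nu : probability 'rV[R]_d R)
  (W_C1 : class_C 1 W) (Z_C2 : class_C 2 (Zfun V W))
  (mu_density : has_density mu (fun x => expR (- V x)))
  (nu_density : has_density nu (fun x => expR (- W x)))
  (uniform_assumptions : exists K : R, \forall p \near 1^'+,
     [/\ (Cp p nu <= K%:E)%E, (C2 mu <= K%:E)%E,
         Zfun V W \in Lfun nu (conj_exp p)%:E /\ (Z_norm V W nu p <= K%:E)%E
       & ((- K)%:E <= inf_delta V W)%E])
  (liminf_finite : limf_einf (Cbound V W mu nu) 1^'+ \is a fin_num) :
  (forall u G, H1 mu u G ->
     (entropy mu u <= C1 mu * (energy mu G)%:E)%E) /\
  (C1 mu <= limf_einf (Cbound V W mu nu) 1^'+)%E.
Proof.
have [K uniform] := uniform_assumptions.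
set L := limf_einf _ _ in liminf_finite *.
have C1L : (C1 mu <= L)%E.
  rewrite -(fineK liminf_finite).
  (* The infimum defining [C1] ranges over nonnegative constants, so L has to be shown to be one
     before its admissibility can be used. *)
  have L0 : 0 <= fine L.
    apply: le_trans (liminf_ge uniform liminf_finite).
    by rewrite mulr_ge0 ?(fine_C2_ge0 uniform).
  apply: ereal_inf_lbound; exists (fine L) => //; split=> // u G uG.
  exact: (entropy_H1_le W_C1 Z_C2 mu_density nu_density uniform liminf_finite uG).
split=> // u G uG; rewrite -(fineK liminf_finite) in C1L.
have [C1fin _ _] := best_constant_adherent C1L.
have C1E : C1 mu = (fine (C1 mu))%:E by rewrite fineK.
by rewrite C1E -EFinM; exact: C1_attained C1L uG.
Qed.
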